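(* There is an absolute constant $C\ge1$ such that, for every centered nondegenerate log-concave random vector $X$ in $\mathbb{R}^n$, every $r\ge2$, every $p\ge1$ and every $u\ge1$, $$\ln\mathsf M\left(Z_p(X),Cu\,\mathcal I_r(X)Z_r(X)^\circ\right)\le Cp\left[\left(\frac{r\,\mathcal I_2(X)}{u\,\mathcal I_r(X)}\right)^2+\frac{r\,\mathcal I_2(X)}{u\,\mathcal I_r(X)}\right].$$ Consequently, $$\ln\mathsf M\left(Z_p(X),Cu\,\mathcal I_r(X)Z_r(X)^\circ\right)\le Cp\left[\left(\frac ru\right)^2+\frac ru\right].$$ If, in addition, $X$ is isotropic and $2\le r\le n$, then $$\ln\mathsf M\left(Z_p(X),Cu\,\mathcal I_r(X)Z_r(X)^\circ\right)\le Cp\left(\frac r{u^2}+\frac{\sqrt r}{u}\right).$$ In particular (taking $u=\sqrt r$), for isotropic $X$ and $2\le r\le n$, $$\mathsf M\left(Z_p(X),C\sqrt r\,\mathcal I_r(X)Z_r(X)^\circ\right)\le e^{Cp}.$$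
   Context: A random vector in $\mathbb{R}^n$ is log-concave if its law $\mu$ satisfies $\mu((1-\lambda)A+\lambda B)\ge\mu(A)^{1-\lambda}\mu(B)^\lambda$ for all nonempty compact $A,B\subseteq\mathbb{R}^n$ and $0<\lambda<1$. Centered means $\mathbb{E}X=0$; nondegenerate means the covariance matrix is invertible; isotropic means centered with identity covariance. For a compact convex set $K$, $h_K(x)=\sup_{y\in K}\langle x,y\rangle$, and $K^\circ=\{x:h_K(x)\le1\}$. For $p\ge1$, $Z_p(X)$ (the $L_p$-centroid body) is the origin symmetric convex body with support function $h_{Z_p(X)}(\theta)=(\mathbb{E}|\langle X,\theta\rangle|^p)^{1/p}$. Put $\mathcal I_r(X)=\mathbb{E}\,h_{Z_r(X)}(X)$ (the expectation over $X$ of the function $h_{Z_r(X)}$ of the fixed body $Z_r(X)$ evaluated at $X$). For a bounded set $A$ and an origin symmetric convex body $B$, $\mathsf M(A,B)$ is the largest cardinality of a subset $S\subseteq A$ such that $s-t\notin B$ for all distinct $s,t\in S$. *)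

(* Defs.v *)
From HB Require Import structures.
From mathcomp Require Import all_boot all_order all_algebra.
From mathcomp Require Import all_classical all_reals all_analysis.

Set Implicit Arguments.
Unset Strict Implicit.
Unset Printing Implicit Defensive.

Import Order.TTheory GRing.Theory Num.Theory.
Import numFieldNormedType.Exports.

Local Open Scope classical_set_scope.
Local Open Scope ring_scope.

Definition dotr (R : realType) (n : nat) (x y : 'rV[R]_n) : R :=
  \sum_(i < n) x ord0 i * y ord0 i.

(* The supremum is the real one: only meaningful for nonempty bounded [K]. *)
Definition support_fun (R : realType) (n : nat) (K : set 'rV[R]_n)
    (x : 'rV[R]_n) : R :=
  sup [set dotr x y | y in K].

Definition polar (R : realType) (n : nat) (K : set 'rV[R]_n) : set 'rV[R]_n :=
  [set x | support_fun K x <= 1].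

Definition dilate (R : realType) (n : nat) (c : R) (K : set 'rV[R]_n) :
    set 'rV[R]_n :=
  [set c *: x | x in K].

(* [counting S] is the cardinality of [S], and +oo when [S] is infinite; a
   finite supremum of cardinalities is attained. *)
Definition packing (R : realType) (n : nat) (A B : set 'rV[R]_n) : \bar R :=
  ereal_sup [set counting S | S in
    [set S : set 'rV[R]_n | S `<=` A /\
       forall s t, S s -> S t -> s <> t -> ~ B (s - t)]].

Section RandomVectors.
Context (d : measure_display) (T : measurableType d) (R : realType).
Variables (P : probability T R) (n : nat) (X : T -> 'rV[R]_n).

(* Coordinatewise measurability is Borel measurability into R^n. *)
Definition random_vector : Prop :=
  forall i : 'I_n, measurable_fun [set: T] (fun w => X w ord0 i).

Definition log_concave : Prop :=
  forall (A B : set 'rV[R]_n) (l : R),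
    compact A -> A !=set0 -> compact B -> B !=set0 -> 0 < l < 1 ->
    (P (X @^-1` A) `^ (1 - l) * P (X @^-1` B) `^ l
       <= P (X @^-1` [set ((1 - l) *: a + l *: b)%R | a in A & b in B]))%E.

Definition centered : Prop :=
  forall i : 'I_n, ('E_P[(fun w => X w ord0 i)] = 0)%E.

Definition cov_mx : 'M[R]_n :=
  \matrix_(i < n, j < n)
    fine (covariance P (fun w => X w ord0 i) (fun w => X w ord0 j)).

Definition nondegenerate_law : Prop := cov_mx \in unitmx.

Definition isotropic : Prop := centered /\ cov_mx = 1%:M.

Definition is_Lp_centroid (p : R) (Z : set 'rV[R]_n) : Prop :=
  [/\ compact Z, convex_set (Z : set (convex_lmodType 'rV[R]_n)), Z !=set0,
      (forall x, Z x -> Z (- x))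
    & forall theta : 'rV[R]_n,
        (support_fun Z theta)%:E
          = 'N[P]_(p%:E)[(fun w => (dotr (X w) theta)%:E)]%E].

(* [xget] picks the set satisfying [is_Lp_centroid p]: it is unique, since a
   compact convex set is determined by its support function, and it exists as
   soon as [X] has finite moments of order [p >= 1], which is the case when [X]
   is log-concave. *)
Definition Lp_centroid (p : R) : set 'rV[R]_n :=
  xget set0 [set Z | is_Lp_centroid p Z].

Definition mean_support (r : R) : R :=
  fine 'E_P[(fun w => support_fun (Lp_centroid r) (X w))].

End RandomVectors.

(* Main.v *)
(** Let N(z) = (E<X,z>^2)^(1/2), a Hilbert seminorm, and I = E N(X) = I_2(X). By Borell's lemma
    h_{Z_r} <= C r N, so it suffices to show that a subset of Z_p whose points are at mutual
    N-distance more than C t I has at most exp(C p (1/t^2 + 1/t)) points.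

    A half-space {<x,th> >= s} with 2 s < h_{Z_p}(th) has mass at least exp(-5 p). It contains a piece
    of N-diameter O(I) whose mass is still exp(-C p): choose k ~ p rows x_i typical for X and cut along
    the values <x,x_i> / I. By log-concavity some cell keeps a mass exp(-C p), and by the small ball
    estimate for <X,z> the rows separate all but a proportion eps^k of the pairs that are far apart.
    Averaging such pieces (Frank-Wolfe, again with log-concavity), every z in Z_p / 4 has sets B, B' of
    mass exp(-C p) such that x - x' is N-close to z up to O(I) for x in B, x' in B', with an error of
    prescribed sign against a prescribed vector.

    Maurey's empirical method then runs with samples common to all points: after m ~ 1/t^2 steps x - x'
    a proportion exp(-C p m) of the points z are within O(I m^(1/2)) / m of the same walk, hence equal.
    For t > 1 one step is enough after mixing B, B' with weight 1/t into the bulk ball {N <= 16 I}.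

    In the isotropic case I_2 <= n^(1/2), and I_r >= c (r n)^(1/2) follows from Welch's bound for the
    moments of <X,Y>, of order about r, with X and Y independent. *)

Require Import Defs.
From HB Require Import structures.
From mathcomp Require Import all_boot all_order all_algebra.
From mathcomp Require Import all_classical all_reals all_analysis.
From mathcomp Require Import measurable_realfun ring lra.
Import Order.TTheory GRing.Theory Num.Theory.
Import numFieldNormedType.Exports.
Local Open Scope classical_set_scope.
Local Open Scope ring_scope.

Set Implicit Arguments.
Unset Strict Implicit.
Unset Printing Implicit Defensive.

(** * Real-valued probabilities and expectations *)

(** Maurey's method usually draws independent samples with mean z, so that the cross terms vanish on
    average. Here one walk must serve many points at once: its steps are found by pigeonhole in sets
    that depend on the point, and no expectation is left. The sign prescribed against the current
    error replaces it: the cross terms are almost nonpositive, and the squared errors just add up.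
    This is why an approximation by sets, for every vector g, is needed, and not only a barycentre.

    Two facts keep the cost at exp(-C p), free of the dimension. Averaging two sets of mass at least
    m gives a set of mass at least m^(1-l) m^l = m, so Frank-Wolfe may run for as long as it needs
    and its error be made negligible. And each row costs a cell only a constant factor of its mass,
    while the factor eps that it puts on the far apart pairs is free: with eps below the square of
    that constant, the pairs that escape all rows are fewer than the pairs of points of the cell.
    About p rows are taken because the half-space itself may have mass as small as exp(-5 p).

    The ratio r I_2 / (u I_r) is 1/t, and it comes from h_{Z_r} <= C r N alone. *)

HB.lock Definition pr {d : measure_display} {T : measurableType d} {R : realType}
  (P : probability T R) (D : set T) : R := fine (P D).

(** [fine] sends an infinite integral to 0, so the value is the expectation only when [intg]
    holds. *)
HB.lock Definition Ex {d : measure_display} {T : measurableType d} {R : realType}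
  (P : probability T R) (f : T -> R) : R := fine (\int[P]_w (f w)%:E)%E.

Section RealExpectation.
Context (d : measure_display) (T : measurableType d) (R : realType).
Variable P : probability T R.
Implicit Types (A B D : set T) (f g : T -> R).

Definition intg f : Prop := P.-integrable [set: T] (EFin \o f).

Lemma EFin_pr D : measurable D -> (pr P D)%:E = P D.
Proof. by move=> mD; rewrite pr.unlock fineK// fin_num_measure. Qed.

Lemma pr_ge0 D : 0 <= pr P D. Proof. by rewrite pr.unlock; exact: fine_ge0. Qed.

Lemma pr_le A B : measurable A -> measurable B -> A `<=` B -> pr P A <= pr P B.
Proof.
move=> mA mB AB; rewrite -lee_fin !EFin_pr//; apply: le_measure => //; exact: mem_set.
Qed.

Lemma pr_le1 D : measurable D -> pr P D <= 1.
Proof. by move=> mD; rewrite -lee_fin EFin_pr//; exact: probability_le1. Qed.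

Lemma prT : pr P [set: T] = 1.
Proof. by rewrite pr.unlock probability_setT. Qed.

Lemma pr_set0 : pr P set0 = 0.
Proof. by rewrite pr.unlock measure0. Qed.

Lemma prC D : measurable D -> pr P (~` D) = 1 - pr P D.
Proof.
move=> mD; apply: EFin_inj; rewrite EFinB !EFin_pr//; last exact: measurableC.
exact: probability_setC.
Qed.

Lemma prU A B : measurable A -> measurable B -> pr P (A `|` B) <= pr P A + pr P B.
Proof.
move=> mA mB; rewrite -lee_fin EFinD !EFin_pr//; last exact: measurableU.
exact: measureU2.
Qed.

Lemma prI_ge A B : measurable A -> measurable B -> pr P A + pr P B - 1 <= pr P (A `&` B).
Proof.
move=> mA mB.
have := prU (measurableC mA) (measurableC mB).
rewrite -setCI !prC//; last exact: measurableI.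
lra.
Qed.

Lemma intg_meas f : intg f -> measurable_fun [set: T] f.
Proof. by move=> /measurable_int/measurable_EFinP. Qed.

Lemma intgD f g : intg f -> intg g -> intg (fun w => f w + g w).
Proof.
by move=> hf hg; have := integrableD measurableT hf hg.
Qed.

Lemma intgZ k f : intg f -> intg (fun w => k * f w).
Proof.
by move=> hf; have := integrableZl measurableT k hf.
Qed.

Lemma intg_sum (I : Type) (s : seq I) (Q : pred I) (h : I -> T -> R) :
  (forall i, intg (h i)) -> intg (fun w => \sum_(i <- s | Q i) h i w).
Proof.
move=> hh.
have := @integrable_sum _ _ _ P _ measurableT I s Q (fun i => EFin \o h i).
move=> /(_ (fun i _ => hh i)); rewrite /intg; congr (P.-integrable _ _).
by apply/funext => w /=; rewrite sumEFin.
Qed.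

Lemma intg_cst k : intg (fun=> k).
Proof. exact: finite_measure_integrable_cst. Qed.

Lemma intg_le f g : measurable_fun [set: T] f -> intg g ->
  (forall w, `|f w| <= g w) -> intg f.
Proof.
move=> mf hg fg; apply: (le_integrable measurableT _ _ hg).
  exact/measurable_EFinP.
move=> w _ /=; rewrite lee_fin; apply: (le_trans (fg w)); exact: ler_norm.
Qed.

Lemma intg_bounded f M : measurable_fun [set: T] f ->
  (forall w, `|f w| <= M) -> intg f.
Proof. by move=> mf; exact: intg_le mf (intg_cst M). Qed.

Lemma intg_indic D : measurable D -> intg (\1_D).
Proof.
move=> mD; apply: (@intg_bounded _ 1); first exact: measurable_indic.
by move=> w; rewrite indicE; case: (_ \in _); rewrite ?normr1 ?normr0.
Qed.

Lemma ExEFin f : intg f -> (Ex P f)%:E = (\int[P]_w (f w)%:E)%E.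
Proof. by move=> hf; rewrite Ex.unlock fineK//; have := integrable_fin_num measurableT hf. Qed.

Lemma ExD f g : intg f -> intg g -> Ex P (fun w => f w + g w) = Ex P f + Ex P g.
Proof.
move=> hf hg; apply: EFin_inj; rewrite EFinD !ExEFin//; last exact: intgD.
by rewrite -integralD.
Qed.

Lemma ExZ k f : intg f -> Ex P (fun w => k * f w) = k * Ex P f.
Proof.
move=> hf; apply: EFin_inj; rewrite EFinM !ExEFin//; last exact: intgZ.
rewrite -integralZl//.
Qed.

Lemma Ex_sum (I : Type) (s : seq I) (Q : pred I) (h : I -> T -> R) :
  (forall i, intg (h i)) ->
  Ex P (fun w => \sum_(i <- s | Q i) h i w) = \sum_(i <- s | Q i) Ex P (h i).
Proof.
move=> hh; elim: s => [|i s IH].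
  under [in LHS]eq_fun do rewrite big_nil.
  by rewrite big_nil Ex.unlock integral0.
under [in LHS]eq_fun do rewrite big_cons.
rewrite big_cons; case: (Q i) => //.
rewrite ExD ?IH//; exact: intg_sum.
Qed.

Lemma Ex_indic D : measurable D -> Ex P (\1_D) = pr P D.
Proof. by move=> mD; rewrite Ex.unlock pr.unlock integral_indic// setIT. Qed.

Lemma Ex_cst k : Ex P (fun=> k) = k.
Proof. by rewrite Ex.unlock integral_cst//= probability_setT mule1. Qed.

Lemma Ex_le f g : intg f -> intg g -> (forall w, f w <= g w) -> Ex P f <= Ex P g.
Proof.
move=> hf hg fg; rewrite -lee_fin !ExEFin//; apply: le_integral => //.
by move=> w _ /=; rewrite lee_fin.
Qed.

Lemma Ex_ge0 f : (forall w, 0 <= f w) -> 0 <= Ex P f.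
Proof. by move=> f0; rewrite Ex.unlock; apply: fine_ge0; apply: integral_ge0 => w _; rewrite lee_fin. Qed.

(** Integration of the pointwise bound. It turns bounded overlap into a bound on total mass for the
    disjoint intervals of the small ball estimate, for the enlarged cells, and in the pigeonhole
    principle. *)
Lemma overlap_bound (I : Type) (s : seq I) (Q : pred I) (a : I -> R) (E : I -> set T) K :
  (forall i, measurable (E i)) ->
  (forall w, \sum_(i <- s | Q i) a i * \1_(E i) w <= K) ->
  \sum_(i <- s | Q i) a i * pr P (E i) <= K.
Proof.
move=> mE hK.
have h i : intg (fun w => a i * \1_(E i) w) by apply: intgZ; exact: intg_indic.
rewrite (eq_bigr (fun i => Ex P (fun w => a i * \1_(E i) w))); last first.
  by move=> i _; rewrite ExZ ?Ex_indic//; exact: intg_indic.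
rewrite -Ex_sum// -[leRHS]Ex_cst; apply: Ex_le => //; first exact: intg_sum.
exact: intg_cst.
Qed.

Lemma measurable_ge f t : measurable_fun [set: T] f -> measurable [set w | t <= f w].
Proof.
move=> mf; rewrite (_ : mkset _ = f @^-1` `[t, +oo[%classic).
  by rewrite -[X in measurable X]setTI; exact: mf.
by apply/seteqP; split => w; rewrite /= in_itv /= andbT.
Qed.

Lemma pr_markov f t : intg f -> (forall w, 0 <= f w) -> 0 < t ->
  pr P [set w | t <= f w] <= Ex P f / t.
Proof.
move=> hf f0 t0; rewrite ler_pdivlMr// mulrC.
have mD : measurable [set w | t <= f w] by apply: measurable_ge; exact: intg_meas.
rewrite -Ex_indic// -ExZ; last exact: intg_indic.
apply: Ex_le => //; first by apply: intgZ; exact: intg_indic.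
by move=> w; rewrite indicE; case: (boolP (w \in _)); rewrite ?inE /= ?mulr1 ?mulr0.
Qed.

Lemma pr_trunc D (F : nat -> set T) e : measurable D -> (forall m, measurable (F m)) ->
  (forall m, F m `<=` F m.+1) -> (forall w, exists m, F m w) -> 0 < e ->
  exists m, pr P D - e <= pr P (D `&` F m).
Proof.
move=> mD mF ndF cF e0.
have mDF m : measurable (D `&` F m) by exact: measurableI.
have ndDF : nondecreasing_seq (fun m => D `&` F m).
  by apply/nondecreasing_seqP => m; apply/subsetPset => w [Dw Fw]; split => //; exact: ndF.
have UD : \bigcup_m (D `&` F m) = D.
  apply/seteqP; split => [w [m _ []]//|w Dw]; have [m Fm] := cF w; by exists m.
have : (P \o (fun m => D `&` F m)) m @[m --> \oo] --> (pr P D)%:E.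
  rewrite EFin_pr// -[X in P X]UD.
  exact: nondecreasing_cvg_mu mDF (bigcup_measurable (fun m _ => mDF m)) ndDF.
move => /fine_cvgP[_].
move=> /cvgrPdist_lt /(_ _ e0) [m _ /(_ m (leqnn m))] /=.
move=> h; exists m; move: h; have -> : fine (P (D `&` F m)) = pr P (D `&` F m) by rewrite pr.unlock.
by rewrite ltr_norml => /andP[_]; lra.
Qed.

End RealExpectation.

(** * Inner product, Borel sets and log-concavity on closed sets *)

Lemma lipschitz_continuous (R : realType) (V : normedModType R) (f : V -> R) (c : R) :
  (forall x z, `|f x - f z| <= c * `|x - z|) -> continuous f.
Proof.
move=> hf x; apply/cvgrPdist_lt => e e0.
have c0 : 0 < `|c| + 1 by rewrite ltr_wpDl.
near=> z; apply: (le_lt_trans (hf x z)).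
apply: (@le_lt_trans _ _ ((`|c| + 1) * `|x - z|)).
  by rewrite ler_wpM2r// (le_trans (ler_norm c))// lerDl.
rewrite mulrC -ltr_pdivlMr//.
near: z; have := nbhsx_ballx x _ (divr_gt0 e0 c0).
by rewrite -ball_normE.
Unshelve. all: end_near. Qed.

Section Dot.
Context (R : realType) (n : nat).
Implicit Types (x y z : 'rV[R]_n) (a : R).

Lemma dotrC x y : dotr x y = dotr y x.
Proof. by apply: eq_bigr => i _; rewrite mulrC. Qed.

Lemma dotrDl x y z : dotr (x + y) z = dotr x z + dotr y z.
Proof. by rewrite -big_split; apply: eq_bigr => i _; rewrite mxE mulrDl. Qed.

Lemma dotrZl a x y : dotr (a *: x) y = a * dotr x y.
Proof. by rewrite /dotr mulr_sumr; apply: eq_bigr => i _; rewrite mxE mulrA. Qed.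

Lemma dotrNl x y : dotr (- x) y = - dotr x y.
Proof. by rewrite -scaleN1r dotrZl mulN1r. Qed.

Lemma dotrBl x y z : dotr (x - y) z = dotr x z - dotr y z.
Proof. by rewrite dotrDl dotrNl. Qed.

Lemma dotr0l x : dotr 0 x = 0.
Proof. by rewrite -(scale0r 0) dotrZl mul0r. Qed.

Lemma dotrDr x y z : dotr z (x + y) = dotr z x + dotr z y.
Proof. by rewrite !(dotrC z) dotrDl. Qed.

Lemma dotrZr a x y : dotr y (a *: x) = a * dotr y x.
Proof. by rewrite !(dotrC y) dotrZl. Qed.

Lemma dotrNr x y : dotr y (- x) = - dotr y x.
Proof. by rewrite !(dotrC y) dotrNl. Qed.

Lemma dotr0r x : dotr x 0 = 0.
Proof. by rewrite dotrC dotr0l. Qed.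

Lemma dotr_delta x i : dotr x (delta_mx ord0 i) = x ord0 i.
Proof.
rewrite /dotr (bigD1 i)//= mxE !eqxx mulr1 big1 ?addr0// => j ji.
by rewrite mxE (negbTE ji) andbF mulr0.
Qed.

Lemma le_coord_norm x i : `|x ord0 i| <= `|x|.
Proof.
rewrite [leRHS]/Num.norm /= mx_normrE; apply/bigmax_geP; right => /=.
by exists (ord0, i).
Qed.

Lemma norm_le_coord x a : 0 <= a -> (forall i, `|x ord0 i| <= a) -> `|x| <= a.
Proof.
move=> a0 h; rewrite [leLHS]/Num.norm /= mx_normrE; apply/bigmax_leP; split => //.
by move=> [i j] _ /=; rewrite (ord1 i).
Qed.

(** The norm of a row vector is the maximum of its coordinates; this is the dual norm. *)
Definition l1norm y : R := \sum_i `|y ord0 i|.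

Lemma l1norm_ge0 y : 0 <= l1norm y.
Proof. exact: sumr_ge0. Qed.

Lemma dotr_le_norm x y : `|dotr x y| <= `|x| * l1norm y.
Proof.
rewrite /dotr /l1norm mulr_sumr (le_trans (ler_norm_sum _ _ _))//.
by apply: ler_sum => i _; rewrite normrM ler_wpM2r// le_coord_norm.
Qed.

Lemma dotr_continuous y : continuous (fun x => dotr x y).
Proof.
apply: (lipschitz_continuous (c := l1norm y)) => x z.
by rewrite -dotrBl mulrC dotr_le_norm.
Qed.

Lemma closed_le_fun (f : 'rV[R]_n -> R) a : continuous f -> closed [set x | f x <= a].
Proof. by move=> cf; apply: (@closed_comp _ _ f [set t | t <= a]) => [x _|]; [exact: cf|exact: closed_le]. Qed.

Lemma closed_ge_fun (f : 'rV[R]_n -> R) a : continuous f -> closed [set x | a <= f x].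
Proof. by move=> cf; apply: (@closed_comp _ _ f [set t | a <= t]) => [x _|]; [exact: cf|exact: closed_ge]. Qed.

Lemma closed_ball_norm a : closed [set x : 'rV[R]_n | `|x| <= a].
Proof. apply: closed_le_fun; exact: norm_continuous. Qed.

Lemma compact_in_ball (A : set 'rV[R]_n) a : closed A -> A `<=` [set x | `|x| <= a] -> compact A.
Proof.
move=> cA Aa; apply: bounded_closed_compact => //.
exists a; split; first exact: num_real.
by move=> M aM x /Aa /le_trans; apply; exact: ltW.
Qed.

Lemma compact_in_some_ball (A : set 'rV[R]_n) : compact A ->
  exists2 a, 0 < a & A `<=` [set x | `|x| <= a].
Proof.
move=> /compact_bounded [M [Mr hM]].
exists (Num.max 1 (M + 1)); first by rewrite lt_max ltr01.
move=> x /hM; apply; by rewrite lt_max ltrDl ltr01 orbT.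
Qed.

End Dot.

(** * Borel sets, tightness and log-concavity of the law *)

Section Law.
Context (d : measure_display) (T : measurableType d) (R : realType).
Variables (P : probability T R) (n : nat) (X : T -> 'rV[R]_n).
Hypothesis hX : random_vector X.

(** An open set is the union of the countably many rational cubes that it contains, and preimages of
    cubes are measurable coordinate by coordinate. *)
Lemma measurable_preimage_open (U : set 'rV[R]_n) : open U -> measurable (X @^-1` U).
Proof.
move=> oU.
pose box (q : 'rV[rat]_n) (m : nat) := [set x : 'rV[R]_n | forall i, `|x ord0 i - ratr (q ord0 i)| < m.+1%:R^-1].
have mbox q m : measurable (X @^-1` box q m).
  rewrite (_ : _ @^-1` _ = \bigcap_(i in [set: 'I_n]) [set w | `|X w ord0 i - ratr (q ord0 i)| < m.+1%:R^-1]); last first.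
    by apply/seteqP; split => w /= h i; [move=> _; exact: h|exact: h].
  apply: fin_bigcap_measurable => // i _.
  have mf : measurable_fun [set: T] (fun w => `|X w ord0 i - ratr (q ord0 i)|).
    apply: measurableT_comp => //; apply: measurable_funB => //; exact: hX.
  rewrite (_ : mkset _ = (fun w => `|X w ord0 i - ratr (q ord0 i)|) @^-1` `]-oo, m.+1%:R^-1[%classic).
    by rewrite -[X in measurable X]setTI; exact: mf.
  by apply/seteqP; split => w; rewrite /= in_itv.
rewrite (_ : X @^-1` U = \bigcup_(qm in [set qm | box qm.1 qm.2 `<=` U]) (X @^-1` box qm.1 qm.2)).
  rewrite bigcup_mkcond; apply: countable_bigcupT_measurable => [|qm]; last by case: ifP.
  exact: countableP.
apply/seteqP; split => [w Uw|w [qm /= qU]]; last exact: qU.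
have /= := open_nbhs_nbhs (conj oU Uw) => /nbhs_ballP [e /= e0 he].
have [m hm] : exists m : nat, m.+1%:R^-1 < e / 2 :> R.
  have e2 : 0 < e / 2 by rewrite divr_gt0.
  by have [m _ /(_ m (leqnn m))] := near_infty_natSinv_lt (PosNum e2); exists m.
have hq i : exists q : rat, `|X w ord0 i - ratr q| < m.+1%:R^-1.
  have : X w ord0 i - m.+1%:R^-1 < X w ord0 i + m.+1%:R^-1.
    by rewrite ltrBlDr -addrA ltrDl addr_gt0 ?invr_gt0.
  move=> /rat_in_itvoo[q].
  rewrite in_itv /= => /andP[h1 h2]; exists q.
  move: h1 h2; move: (ratr q) (m.+1%:R^-1) => a c h1 h2.
  by rewrite ltr_norml; apply/andP; split; lra.
pose q := \row_i projT1 (cid (hq i)).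
have hqi i : `|X w ord0 i - ratr (q ord0 i)| < m.+1%:R^-1.
  by rewrite mxE; case: (cid (hq i)).
exists (q, m) => //= y hy.
apply: he; split => // a i; rewrite (_ : a = ord0) ?(ord1 a)//.
suff : `|X w ord0 i - y ord0 i| < e by [].
have : `|X w ord0 i - ratr (q ord0 i)| < m.+1%:R^-1 by exact: hqi.
have : `|y ord0 i - ratr (q ord0 i)| < m.+1%:R^-1 by exact: hy.
move: hm; move: (ratr (q ord0 i)) (m.+1%:R^-1) (X w ord0 i) (y ord0 i) => r c u v.
rewrite !ltr_norml => ? /andP[? ?] /andP[? ?].
by apply/andP; split; lra.
Qed.

Lemma measurable_preimage_closed (A : set 'rV[R]_n) : closed A -> measurable (X @^-1` A).
Proof.
move=> cA; rewrite -[A]setCK preimage_setC; apply: measurableC.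
apply: (measurable_preimage_open (U := ~` A)); exact: closed_openC.
Qed.

Lemma measurable_dotr y : measurable_fun [set: T] (fun w => dotr (X w) y).
Proof.
apply: measurable_sum => i; apply: measurable_funM => //; exact: hX.
Qed.

Lemma measurable_of_closed_le (f : 'rV[R]_n -> R) :
  (forall a, closed [set x | f x <= a]) -> measurable_fun [set: T] (fun w => f (X w)).
Proof.
move=> cf.
apply: (measurability _ (RGenOInfty.measurableE R)) => _ [_ [a ->] <-].
rewrite setTI (_ : _ @^-1` _ = ~` (X @^-1` [set x | f x <= a])).
  by apply: measurableC; exact: measurable_preimage_closed.
by apply/seteqP; split => w /=; rewrite in_itv /= andbT ltNge => /negP.
Qed.

(** Tightness. One radius serves all closed sets; later bounds that must be uniform in a direction
    depend on this. *)
Lemma exists_trunc e : 0 < e -> exists2 M : R, 0 < M &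
  forall A, closed A -> pr P (X @^-1` A) - e <= pr P (X @^-1` (A `&` [set x | `|x| <= M])).
Proof.
move=> e0.
have mF m : measurable (X @^-1` [set x | `|x| <= m.+1%:R]).
  by apply: measurable_preimage_closed; exact: closed_ball_norm.
have [|w|m] := @pr_trunc _ _ _ P setT (fun m => X @^-1` [set x | `|x| <= m.+1%:R]) e measurableT mF _ _ e0.
- by move=> m w /= /le_trans; apply; rewrite ler_nat.
- exists (Num.truncn `|X w|); rewrite /= ltW//.
  by have /andP[] := truncn_itv (normr_ge0 (X w)).
rewrite setTI prT => hm; exists m.+1%:R; first by rewrite ltr0n.
move=> A cA.
have := prI_ge P (measurable_preimage_closed cA) (mF m).
rewrite -preimage_setI; lra.
Qed.

Hypothesis hL : log_concave P X.

Lemma compact_mean (A B : set 'rV[R]_n) (l : R) : compact A -> compact B ->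
  compact [set (1 - l) *: a + l *: b | a in A & b in B].
Proof.
move=> cA cB.
rewrite (_ : [set _ | a in A & b in B] = (fun ab : 'rV[R]_n * 'rV[R]_n => (1 - l) *: ab.1 + l *: ab.2) @` (A `*` B)).
  apply: continuous_compact; last exact: compact_setX.
  apply: continuous_subspaceT => -[a b].
  apply: cvgD; apply: cvgZ; try exact: cvg_cst; [exact: cvg_fst|exact: cvg_snd].
apply/seteqP; split => x.
  by move=> [a Aa [b Bb <-]]; exists (a, b).
by move=> [[a b] [/= Aa Bb] <-]; exists a => //; exists b.
Qed.

Lemma log_concave_compact (A B : set 'rV[R]_n) (l : R) : compact A -> compact B -> 0 < l < 1 ->
  A !=set0 -> B !=set0 ->
  pr P (X @^-1` A) `^ (1 - l) * pr P (X @^-1` B) `^ l <=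
  pr P (X @^-1` [set ((1 - l) *: a + l *: b)%R | a in A & b in B]).
Proof.
move=> cA cB l01 A0 B0.
have mX K : compact K -> measurable (X @^-1` K).
  by move=> cK; apply: measurable_preimage_closed; exact: compact_closed cK.
have cAB := compact_mean (l := l) cA cB.
have := hL cA A0 cB B0 l01.
rewrite -!EFin_pr; try exact: mX.
by rewrite !poweR_EFin -EFinM lee_fin.
Qed.

(** The hypothesis speaks of nonempty compact sets. Truncation to balls keeps a proportion 1 - e of
    both masses, and e is arbitrary. The mean of two closed sets need not be closed, hence the
    measurable superset [E]. *)
Lemma log_concave_closed (A B E : set 'rV[R]_n) (l : R) : closed A -> closed B ->
  measurable (X @^-1` E) -> 0 < l < 1 ->
  (forall a b, A a -> B b -> E ((1 - l) *: a + l *: b)) ->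
  pr P (X @^-1` A) `^ (1 - l) * pr P (X @^-1` B) `^ l <= pr P (X @^-1` E).
Proof.
move=> cA cB mE /andP[l0 l1] hE.
have mX K : closed K -> measurable (X @^-1` K) by exact: measurable_preimage_closed.
set pA := pr P (X @^-1` A); set pB := pr P (X @^-1` B).
have [pA0|] := leP pA 0.
  have -> : pA = 0 by apply/eqP; rewrite eq_le pA0 pr_ge0.
  by rewrite powR0 ?mul0r ?pr_ge0//; lra.
have [pB0|] := leP pB 0.
  have -> : pB = 0 by apply/eqP; rewrite eq_le pB0 pr_ge0.
  by rewrite powR0 ?mulr0 ?pr_ge0//; lra.
move=> pB0 pA0.
suff H e : 0 < e < 1 -> (1 - e : R) * (pA `^ (1 - l) * pB `^ l) <= pr P (X @^-1` E).
  rewrite leNgt; apply/negP => hlt.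
  set Q := pA `^ (1 - l) * pB `^ l in H hlt.
  have Q0 : 0 < Q by rewrite mulr_gt0// powR_gt0.
  set q := pr P (X @^-1` E) in H hlt.
  have q0 : 0 <= q by exact: pr_ge0.
  have := H ((Q - q) / (Q + Q)).
  have e1 : 0 < (Q - q) / (Q + Q) < 1.
    apply/andP; split; first by apply: divr_gt0; [rewrite subr_gt0|exact: addr_gt0].
    by rewrite ltr_pdivrMr ?addr_gt0//; lra.
  move=> /(_ e1); rewrite mulrBl mul1r.
  have -> : (Q - q) / (Q + Q) * Q = (Q - q) / 2 by field; lra.
  lra.
move=> /andP[e0 e1].
have [MA MA0 hA] := @exists_trunc (e * pA) (mulr_gt0 e0 pA0).
have [MB MB0 hB] := @exists_trunc (e * pB) (mulr_gt0 e0 pB0).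
have {}hA := hA _ cA; have {}hB := hB _ cB.
set A' := A `&` _ in hA; set B' := B `&` _ in hB.
have kA' : compact A'.
  by apply: (@compact_in_ball _ _ _ MA) => [|x []//]; apply: closedI => //; exact: closed_ball_norm.
have kB' : compact B'.
  by apply: (@compact_in_ball _ _ _ MB) => [|x []//]; apply: closedI => //; exact: closed_ball_norm.
have hA' : (1 - e) * pA <= pr P (X @^-1` A') by rewrite mulrBl mul1r.
have hB' : (1 - e) * pB <= pr P (X @^-1` B') by rewrite mulrBl mul1r.
have ne K : 0 < pr P (X @^-1` K) -> K !=set0.
  move=> h; apply/set0P/negP => /eqP K0; move: h.
  by rewrite K0 preimage_set0 pr_set0 ltxx.
have a0 : 0 < 1 - e by rewrite subr_gt0.
have A'0 : A' !=set0 by apply: ne; apply: lt_le_trans hA'; rewrite mulr_gt0.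
have B'0 : B' !=set0 by apply: ne; apply: lt_le_trans hB'; rewrite mulr_gt0.
have l01 : 0 < l < 1 by rewrite l0.
have h := log_concave_compact kA' kB' l01 A'0 B'0.
have -> : (1 - e : R) * (pA `^ (1 - l) * pB `^ l) = ((1 - e) * pA) `^ (1 - l) * ((1 - e) * pB) `^ l.
  rewrite !powRM ?(ltW a0) ?(ltW pA0) ?(ltW pB0)//.
  have e1l : (1 - e) `^ (1 - l) * (1 - e) `^ l = 1 - e.
    by rewrite -powRD ?subrK ?powRr1 ?ltW// (gt_eqF a0) implybT.
  by rewrite mulrACA e1l.
apply: le_trans (le_trans h _).
  have l1' : 0 <= 1 - l by rewrite subr_ge0 ltW.
  apply: ler_pM; rewrite ?powR_ge0//.
    by apply: ge0_ler_powR; rewrite ?nnegrE ?pr_ge0 ?mulr_ge0 ?(ltW a0) ?(ltW pA0).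
  by apply: ge0_ler_powR; rewrite ?nnegrE ?pr_ge0 ?mulr_ge0 ?(ltW a0) ?(ltW pB0) ?(ltW l0).
apply: pr_le => //.
  apply: mX; apply: compact_closed; first exact: norm_hausdorff.
  exact: compact_mean.
by move=> w /= [a [Aa _] [b [Bb _] <-]]; exact: hE.
Qed.

End Law.

(** * Tails and moments of linear functionals *)

Section ExpFacts.
Context (R : realType).
Implicit Types (x y : R).

Lemma expR_ge2 : 2 <= expR 1 :> R.
Proof. by have := expR_ge1Dx (1 : R); lra. Qed.

Lemma expRN1_le : expR (-1) <= 2^-1 :> R.
Proof. by rewrite expRN lef_pV2 ?posrE ?expR_gt0 ?expR_ge2. Qed.

Lemma expR_powR x y : (expR x) `^ y = expR (x * y).
Proof. by rewrite expRM. Qed.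

Lemma powR_le_expR x y l : 0 <= x -> 0 < l -> x `^ l <= expR y -> x <= expR (y / l).
Proof.
move=> x0 l0 h.
have -> : x = (x `^ l) `^ (l^-1) by rewrite -powRrM mulfV ?powRr1 // gt_eqF.
rewrite -expR_powR; apply: ge0_ler_powR => //; rewrite ?nnegrE ?invr_ge0 ?powR_ge0 ?expR_ge0 //.
exact: ltW.
Qed.

End ExpFacts.

Section Tails.
Context (d : measure_display) (T : measurableType d) (R : realType).
Variables (P : probability T R) (n : nat) (X : T -> 'rV[R]_n).
Hypotheses (hX : random_vector X) (hL : log_concave P X).
Implicit Types (th y : 'rV[R]_n) (t s b p : R).

Definition tail th t : set T := X @^-1` [set x | t <= `|dotr x th|].

Lemma norm_dotr_continuous th : continuous (fun x : 'rV[R]_n => `|dotr x th|).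
Proof.
apply: (lipschitz_continuous (c := l1norm th)) => x z.
apply: (le_trans (ler_dist_dist _ _)).
by rewrite -dotrBl mulrC dotr_le_norm.
Qed.

Lemma closed_tail th t : closed [set x : 'rV[R]_n | t <= `|dotr x th|].
Proof. by apply: closed_ge_fun; exact: norm_dotr_continuous. Qed.

Lemma measurable_tail th t : measurable (tail th t).
Proof. by apply: measurable_preimage_closed => //; exact: closed_tail. Qed.

(* With l = 2 / (s + 1), (1 - l) {|xi| < t} + l {|xi| >= s t} misses {|xi| < t}. *)
Lemma borell th t b s : 1 <= b -> 1 <= s -> pr P (tail th t) <= expR (- b) ->
  pr P (tail th (s * t)) <= expR (- (b - 1) * (s + 1) / 2).
Proof.
move=> b1 s1 ht.
(* At s = 1 the weight l would be 1, outside the range of log-concavity. *)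
have [s1'|s_gt1] := leP s 1.
  have -> : s = 1 by apply/eqP; rewrite eq_le s1 s1'.
  by rewrite mul1r; apply: (le_trans ht); rewrite ler_expR; lra.
pose l := 2 / (s + 1).
have s10 : 0 < s + 1 by lra.
have l0 : 0 < l by rewrite divr_gt0.
have l1 : l < 1 by rewrite ltr_pdivrMr//; lra.
have cK : closed [set x : 'rV[R]_n | `|dotr x th| <= t].
  by apply: closed_le_fun; exact: norm_dotr_continuous.
have h := @log_concave_closed _ _ _ _ _ _ hX hL _ _ [set x | t <= `|dotr x th|] l cK
  (@closed_tail th (s * t)) (measurable_tail th t).
have /h {}h : 0 < l < 1 by rewrite l0.
(* The bulk has mass at least 1 - 1/e >= 1/e, so its power 1 - l costs at most a factor e: this is
   the 1 in b - 1. *)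
have K2 : expR (-1) <= pr P (X @^-1` [set x | `|dotr x th| <= t]).
  have : pr P (~` tail th t) <= pr P (X @^-1` [set x | `|dotr x th| <= t]).
    apply: pr_le.
    - by apply: measurableC; exact: measurable_tail.
    - exact: measurable_preimage_closed.
    - by move=> w /= /negP; rewrite -ltNge => /ltW.
  rewrite prC; last exact: measurable_tail.
  have : expR (- b) <= expR (-1) :> R by rewrite ler_expR; lra.
  have := expRN1_le R; lra.
have {}h : pr P (X @^-1` [set x | `|dotr x th| <= t]) `^ (1 - l) *
    pr P (tail th (s * t)) `^ l <= pr P (tail th t).
  apply: h => a c /= ha hc; rewrite dotrDl !dotrZl.
  have hl : l * (s + 1) = 2 by rewrite /l divfK// gt_eqF.
  have := lerB_normD (l * dotr c th) ((1 - l) * dotr a th).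
  have n1 : `|l * dotr c th| = l * `|dotr c th| by rewrite normrM (ger0_norm (ltW l0)).
  have n2 : `|(1 - l) * dotr a th| = (1 - l) * `|dotr a th|.
    by rewrite normrM (@ger0_norm _ (1 - l)) ?subr_ge0 ?(ltW l1).
  rewrite n1 n2.
  rewrite [in X in _ <= X](addrC (l * _)) => /(le_trans _); apply.
  have h1 : l * (s * t) <= l * `|dotr c th| by rewrite ler_pM2l.
  have h2 : (1 - l) * `|dotr a th| <= (1 - l) * t by rewrite ler_pM2l ?subr_gt0.
  have : l * (s * t) - (1 - l) * t = t * (l * (s + 1) - 1) by ring.
  rewrite hl; lra.
have {}h : expR (- (1 - l)) * pr P (tail th (s * t)) `^ l <= expR (- b).
  apply: le_trans (le_trans h ht); apply: ler_wpM2r; first exact: powR_ge0.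
  rewrite -mulN1r -expR_powR; apply: ge0_ler_powR => //; rewrite ?nnegrE ?subr_ge0 ?(ltW l1) ?expR_ge0 ?pr_ge0//.
have {}h : pr P (tail th (s * t)) `^ l <= expR (- (b - 1)).
  rewrite -[leLHS]mul1r -{1}(expRxMexpNx_1 (1 - l)) -mulrA.
  apply: (@le_trans _ _ (expR (1 - l) * expR (- b))); first by rewrite ler_wpM2l ?expR_ge0.
  by rewrite -expRD ler_expR; lra.
apply: le_trans (powR_le_expR (pr_ge0 _ _) l0 h) _.
by rewrite ler_expR /l invf_div mulrA.
Qed.

(** Layer cake: the p-th power is at most the sum over m of ((m + 1) t)^p on the event that the
    functional reaches m t. [borell] with b = 5 p bounds that event for m + 1 by exp(-2 p (m + 2)),
    as 5 p - 1 >= 4 p; this beats (m + 2)^p and leaves a geometric series. *)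
Lemma moment_bound th t p : 1 <= p -> 0 < t -> pr P (tail th t) <= expR (- (5 * p)) ->
  intg P (fun w => `|dotr (X w) th| `^ p) /\
  Ex P (fun w => `|dotr (X w) th| `^ p) <= (2 * t) `^ p.
Proof.
move=> p1 t0 ht.
pose f w := `|dotr (X w) th| `^ p.
have p0 : 0 < p by lra.
pose c (m : nat) := (m.+1%:R * t) `^ p.
pose g (m : nat) (w : T) := (c m * \1_(tail th (m%:R * t)) w)%:E.
have mf : measurable_fun [set: T] f.
  apply: (@measurableT_comp _ _ _ _ _ _ (@powR R ^~ p)) => //; apply: measurableT_comp => //.
  exact: measurable_dotr.
have mg m : measurable_fun [set: T] (g m).
  apply/measurable_EFinP; apply: measurable_funM => //; apply: measurable_indic.
  exact: measurable_tail.
have g0 m w : (0 <= g m w)%E.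
  by rewrite lee_fin mulr_ge0 ?powR_ge0// indicE.
have fg w : ((f w)%:E <= \sum_(m <oo) g m w)%E.
  pose m := Num.truncn (`|dotr (X w) th| / t).
  have /truncn_itv /andP[h1 h2] : 0 <= `|dotr (X w) th| / t by rewrite divr_ge0// ltW.
  apply: (@le_trans _ _ (g m w)); last first.
    apply: le_trans (nneseries_lim_ge m.+1 _); last by [].
    by rewrite big_mkord big_ord_recr /= leeDr// sume_ge0.
  rewrite /g indicE mem_set /tail /=; last by rewrite -ler_pdivlMr.
  rewrite mulr1 lee_fin /f /c; apply: ge0_ler_powR; rewrite ?nnegrE ?(ltW p0)//.
    by rewrite mulr_ge0// ltW.
  by rewrite -ler_pdivrMr// ltW.
have gm m : (\int[P]_w g m w <= ((2 * t `^ p) / (2 ^ m.+1)%:R)%:E)%E.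
  rewrite /g -ExEFin; last by apply: intgZ; apply: intg_indic; exact: measurable_tail.
  rewrite lee_fin ExZ ?Ex_indic; try exact: measurable_tail; last first.
    by apply: intg_indic; exact: measurable_tail.
  case: m => [|m].
    rewrite /c mul1r expn1 mulrAC divff// mul1r ler_piMr ?powR_ge0//.
    by apply: pr_le1; exact: measurable_tail.
  have h5 : 1 <= 5 * p by lra.
  have hm1 : 1 <= m.+1%:R :> R by rewrite ler1n.
  have := borell h5 hm1 ht.
  set q := pr P _ => hq.
  rewrite /c powRM ?(ltW t0)// [_ * t `^ p]mulrC -mulrA.
  apply: (@le_trans _ _ (t `^ p * (2 ^ m.+2)%:R^-1)); last first.
    by rewrite ler_peMl ?mulr_ge0 ?powR_ge0 ?invr_ge0// ler1n.
  rewrite -(mulrA (t `^ p)) ler_wpM2l ?powR_ge0//.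
  have hq' : q <= expR (- (2 * m.+2%:R)) `^ p.
    apply: (le_trans hq); rewrite expR_powR ler_expR.
    have -> : m.+2%:R = m.+1%:R + 1 :> R by rewrite -natr1.
    move: hm1; move: (m.+1%:R) => y hy.
    have : 0 <= (p - 1) * (y + 1) by rewrite mulr_ge0; lra.
    have : 0 <= p * (y + 1) by rewrite mulr_ge0; lra.
    have -> : - (5 * p - 1) * (y + 1) / 2 = - (5/2) * (p * (y + 1)) + (y + 1) / 2 by ring.
    nra.
  apply: (@le_trans _ _ (m.+2%:R `^ p * expR (- (2 * m.+2%:R)) `^ p)).
    by rewrite ler_wpM2l ?powR_ge0.
  rewrite -powRM ?expR_ge0//.
  have h2 : m.+2%:R * expR (- (2 * m.+2%:R)) <= (2 ^ m.+2)%:R^-1 :> R.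
    have e1 : m.+2%:R <= expR m.+2%:R :> R by have := expR_ge1Dx (m.+2%:R : R); lra.
    apply: (@le_trans _ _ (expR m.+2%:R * expR (- (2 * m.+2%:R)))).
      by rewrite ler_wpM2r ?expR_ge0.
    rewrite -expRD (_ : _ + _ = -1 * m.+2%:R); last by ring.
    rewrite mulrC -[_ * _]mulrC expRM_natr natrX -exprVn.
    by apply: lerXn2r; rewrite ?nnegrE ?expR_ge0 ?invr_ge0// expRN1_le.
  apply: le_trans (ge0_ler_powR (ltW p0) _ _ h2) _; rewrite ?nnegrE ?mulr_ge0 ?expR_ge0 ?invr_ge0//.
  apply: ge1r_powR => //; rewrite invr_gt0 ltr0n expn_gt0/= invf_le1 ?ltr0n ?expn_gt0//.
  by rewrite ler1n expn_gt0.
have hint : (\int[P]_w (f w)%:E <= ((2 * t) `^ p)%:E)%E.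
  apply: (@le_trans _ _ (\int[P]_w (\sum_(m <oo) g m w))%E).
    apply: ge0_le_integral => //.
    - by move=> w _; rewrite lee_fin powR_ge0.
    - exact/measurable_EFinP.
    - by apply: ge0_emeasurable_sum.
  rewrite integral_nneseries//.
  apply: (@le_trans _ _ (\sum_(m <oo) ((2 * t `^ p) / (2 ^ m.+1)%:R)%:E)%E).
    by apply: lee_nneseries => // m _ _; apply: integral_ge0.
  apply: le_trans (epsilon_trick0 _ _) _; first by rewrite mulr_ge0 ?powR_ge0.
  rewrite lee_fin powRM ?(ltW t0)// ler_wpM2r ?powR_ge0//.
  by apply: le1r_powR => //; rewrite ler1n.
have If : intg P f.
  apply/integrableP; split; first exact/measurable_EFinP.
  under eq_integral => w _ do rewrite /= ger0_norm ?powR_ge0//.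
  exact: le_lt_trans hint (ltry _).
by split => //; rewrite -lee_fin ExEFin.
Qed.

(** Some level always meets the hypothesis of [moment_bound]; hence all moments are finite. *)
Lemma tail_small th e : 0 < e -> exists2 t, 0 < t & pr P (tail th t) <= e.
Proof.
move=> e0; have [M M0 hM] := exists_trunc P hX e0.
have tl : 0 < M * l1norm th + 1 by rewrite ltr_wpDl// mulr_ge0 ?l1norm_ge0// ltW.
exists (M * l1norm th + 1) => //.
have := hM _ (@closed_tail th (M * l1norm th + 1)).
rewrite (_ : _ `&` _ = set0).
  by rewrite preimage_set0 pr_set0 subr_le0.
rewrite -subset0 => x [/= h1 h2].
have := le_trans h1 (dotr_le_norm x th).
have : `|x| * l1norm th <= M * l1norm th by rewrite ler_wpM2r ?l1norm_ge0.
lra.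
Qed.

Lemma intg_powR th p : 1 <= p -> intg P (fun w => `|dotr (X w) th| `^ p).
Proof.
move=> p1; have [t t0 ht] := @tail_small th (expR (- (5 * p))) (expR_gt0 _).
by have [] := moment_bound p1 t0 ht.
Qed.

Lemma intg_dotr th : intg P (fun w => dotr (X w) th).
Proof.
apply: intg_le (intg_powR th (lexx 1)) _; first exact: measurable_dotr.
by move=> w; rewrite powRr1.
Qed.

Lemma intg_norm_dotr th : intg P (fun w => `|dotr (X w) th|).
Proof.
have := intg_powR th (lexx 1); congr intg; apply/funext => w; by rewrite powRr1.
Qed.

Lemma intg_dotr2 th : intg P (fun w => dotr (X w) th ^+ 2).
Proof.
have := @intg_powR th 2; rewrite ler1n => /(_ isT); congr intg; apply/funext => w.
by rewrite powR_mulrn// real_normK// num_real.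
Qed.

Lemma intg_dotrM th y : intg P (fun w => dotr (X w) th * dotr (X w) y).
Proof.
apply: (@intg_le _ _ _ _ _ (fun w => dotr (X w) th ^+ 2 + dotr (X w) y ^+ 2)).
- by apply: measurable_funM; exact: measurable_dotr.
- by apply: intgD; exact: intg_dotr2.
- move=> w; rewrite normrM -(real_normK (num_real (dotr (X w) th))) -(real_normK (num_real (dotr (X w) y))).
  by move: `|_| `|_| (normr_ge0 (dotr (X w) th)) (normr_ge0 (dotr (X w) y)) => a c ha hc; nra.
Qed.

Lemma intg_coord i : intg P (fun w => X w ord0 i).
Proof.
by have := intg_dotr (delta_mx ord0 i); congr intg; apply/funext => w; rewrite dotr_delta.
Qed.

End Tails.

(** * The L2 seminorm *)

Section Cover.
Context (d : measure_display) (T : measurableType d) (R : realType).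
Variable P : probability T R.

Lemma pr_cover (I : eqType) (s : seq I) (D : set T) (E : I -> set T) :
  measurable D -> (forall i, measurable (E i)) ->
  (forall w, D w -> exists2 i, i \in s & E i w) -> pr P D <= \sum_(i <- s) pr P (E i).
Proof.
move=> mD mE h.
rewrite -Ex_indic// (eq_bigr (fun i => Ex P (\1_(E i)))); last by move=> i _; rewrite Ex_indic.
rewrite -(@Ex_sum _ _ _ P I s xpredT (fun i => \1_(E i))); last by move=> i; exact: intg_indic.
apply: Ex_le => [||w]; first exact: intg_indic.
  by apply: intg_sum => i; exact: intg_indic.
rewrite indicE; case: (boolP (w \in D)) => [|_]; last first.
  by apply: sumr_ge0 => i _; rewrite indicE.
rewrite inE => /h [i si Ei]; rewrite (big_rem i)//= indicE mem_set// lerDl.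
by apply: sumr_ge0 => j _; rewrite indicE.
Qed.

Lemma Lyapunov (f : T -> R) p q : 0 < q -> q <= p -> (forall w, 0 <= f w) ->
  intg P (fun w => f w `^ q) -> intg P (fun w => f w `^ p) ->
  Ex P (fun w => f w `^ q) `^ q^-1 <= Ex P (fun w => f w `^ p) `^ p^-1.
Proof.
move=> q0 qp f0 iq ip.
have p0 : 0 < p by exact: lt_le_trans qp.
set a := Ex P (fun w => f w `^ p).
(* Any positive bound N of the p-norm is used for normalization, so that a vanishing norm causes no
   division by 0; the bound is then let down to the norm. *)
suff H N : 0 < N -> a <= N `^ p -> Ex P (fun w => f w `^ q) <= N `^ q.
  have Ea0 : 0 <= Ex P (fun w => f w `^ q) by apply: Ex_ge0 => w; exact: powR_ge0.
  apply/ler_addgt0Pr => e e0.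
  have N0 : 0 < a `^ p^-1 + e by rewrite ltr_wpDl// powR_ge0.
  have a0 : 0 <= a by apply: Ex_ge0 => w; exact: powR_ge0.
  have /(H _ N0) {}H : a <= (a `^ p^-1 + e) `^ p.
    have {1}-> : a = (a `^ p^-1) `^ p by rewrite -powRrM mulVf ?powRr1 // gt_eqF.
    by apply: ge0_ler_powR; rewrite ?nnegrE ?powR_ge0 ?(ltW N0) ?(ltW p0)// lerDl ltW.
  have -> : a `^ p^-1 + e = ((a `^ p^-1 + e) `^ q) `^ q^-1.
    by rewrite -powRrM mulfV ?powRr1 ?(ltW N0)// gt_eqF.
  by apply: ge0_ler_powR; rewrite ?nnegrE ?powR_ge0 ?invr_ge0 ?(ltW q0).
move=> N0 aN.
have Nq0 : 0 < N `^ q by rewrite powR_gt0.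
have Np0 : 0 < N `^ p by rewrite powR_gt0.
pose t := q / p.
have t0 : 0 < t by rewrite divr_gt0.
have t1 : t <= 1 by rewrite ler_pdivrMr// mul1r.
(* Weighted arithmetic-geometric inequality x^t <= 1 + t (x - 1), at x = (f / N)^p. *)
have amgm x : 0 <= x -> x `^ t <= 1 + t * (x - 1).
  rewrite le_eqVlt => /predU1P[<-|x0].
    by rewrite powR0 ?gt_eqF//; lra.
  have [t1'|] := leP 1 t.
    have -> : t = 1 by apply/eqP; rewrite eq_le t1 t1'.
    by rewrite powRr1 ?(ltW x0)//; lra.
  move=> tl1.
  have t1V : 0 < (1 - t)^-1 by rewrite invr_gt0 subr_gt0.
  have tV : 0 < t^-1 by rewrite invr_gt0.
  have := @conjugate_powR R (x `^ t) 1 t^-1 (1 - t)^-1 (powR_ge0 _ _) ler01 tV t1V.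
  rewrite !invrK => /(_ (subrKC t 1)).
  rewrite -powRrM mulfV ?gt_eqF// powRr1 ?(ltW x0)// powR1 mulr1; lra.
have pw w : f w `^ q <= N `^ q * (1 - t) + N `^ q * t / N `^ p * f w `^ p.
  have := amgm (f w `^ p / N `^ p) (divr_ge0 (powR_ge0 _ _) (powR_ge0 _ _)).
  have -> : (f w `^ p / N `^ p) `^ t = f w `^ q / N `^ q.
    have pt : p * t = q by rewrite /t mulrCA mulfV ?mulr1// gt_eqF.
    by rewrite -powRN powRM ?powR_ge0// -!powRrM mulNr powRN pt.
  rewrite ler_pdivrMr// => /le_trans; apply.
  by rewrite [leLHS](_ : _ = N `^ q * (1 - t) + N `^ q * t / N `^ p * f w `^ p)//; ring.
apply: (@le_trans _ _ (Ex P (fun w => N `^ q * (1 - t) + N `^ q * t / N `^ p * f w `^ p))).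
  by apply: Ex_le => //; apply: intgD; [exact: intg_cst|exact: intgZ].
rewrite ExD; [|exact: intg_cst|exact: intgZ].
rewrite Ex_cst ExZ// -/a.
have : N `^ q * t / N `^ p * a <= N `^ q * t.
  have Nt0 : 0 <= N `^ q * t by exact: ltW (mulr_gt0 Nq0 t0).
  rewrite -mulrA ler_piMr//.
  by rewrite mulrC ler_pdivrMr// mul1r.
lra.
Qed.

End Cover.


HB.lock Definition Lp_norm (d : measure_display) (T : measurableType d) (R : realType)
    (P : probability T R) (n : nat) (X : T -> 'rV[R]_n) (p : R) (th : 'rV[R]_n) : R :=
  Ex P (fun w => `|dotr (X w) th| `^ p) `^ p^-1.

(** The second moment form, which is the covariance form since X is centered. [Lp_norm P X 2] is its
    seminorm. *)
HB.lock Definition cov_form (d : measure_display) (T : measurableType d) (R : realType)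
    (P : probability T R) (n : nat) (X : T -> 'rV[R]_n) (y z : 'rV[R]_n) : R :=
  Ex P (fun w => dotr (X w) y * dotr (X w) z).

Arguments Lp_norm {d T R} P {n} X p th.
Arguments cov_form {d T R} P {n} X y z.

Section Moments.
Context (d : measure_display) (T : measurableType d) (R : realType).
Variables (P : probability T R) (n : nat) (X : T -> 'rV[R]_n).
Hypotheses (hX : random_vector X) (hL : log_concave P X).
Implicit Types (th y z : 'rV[R]_n) (t s b p q : R).

Local Notation tail := (tail X).
Local Notation Np := (Lp_norm P X).
Local Notation N := (Lp_norm P X 2).
Local Notation B := (cov_form P X).

Lemma Lp_norm_ge0 p th : 0 <= Np p th.
Proof. by rewrite Lp_norm.unlock powR_ge0. Qed.

Lemma Lp_norm_mono p q th : 1 <= q -> q <= p -> Np q th <= Np p th.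
Proof.
move=> q1 qp; rewrite Lp_norm.unlock; apply: Lyapunov => //; [lra| |]; apply: intg_powR => //; lra.
Qed.

Lemma Lp_norm_powR p th : 1 <= p -> Np p th `^ p = Ex P (fun w => `|dotr (X w) th| `^ p).
Proof.
move=> p1; rewrite Lp_norm.unlock -powRrM mulVf ?gt_eqF//; last lra.
by rewrite powRr1// Ex_ge0// => w; exact: powR_ge0.
Qed.

Lemma cov_formC y z : B y z = B z y.
Proof. by rewrite cov_form.unlock; congr Ex; apply/funext => w; rewrite mulrC. Qed.

Lemma cov_formDl y y' z : B (y + y') z = B y z + B y' z.
Proof.
rewrite cov_form.unlock -ExD; try exact: intg_dotrM.
by congr Ex; apply/funext => w; rewrite dotrDr mulrDl.
Qed.

Lemma cov_formZl a y z : B (a *: y) z = a * B y z.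
Proof.
rewrite cov_form.unlock -ExZ; last exact: intg_dotrM.
by congr Ex; apply/funext => w; rewrite dotrZr mulrA.
Qed.

Lemma cov_formDr y z z' : B y (z + z') = B y z + B y z'.
Proof. by rewrite !(cov_formC y) cov_formDl. Qed.

Lemma cov_formZr a y z : B y (a *: z) = a * B y z.
Proof. by rewrite !(cov_formC y) cov_formZl. Qed.

(** The form against a fixed vector is a dot product, so a sign condition on a covariance can be
    requested as a condition on [dotr]. *)
Lemma cov_formE y z : B y z = dotr y (\row_i B (delta_mx ord0 i) z).
Proof.
rewrite {1}(matrix_sum_delta y) big_ord1.
rewrite /dotr; under [RHS]eq_bigr do rewrite mxE.
elim: (index_enum _) => [|i s IH].
  by rewrite !big_nil -(scale0r 0) cov_formZl mul0r.
by rewrite !big_cons cov_formDl cov_formZl IH.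
Qed.

Lemma sqr_norm2 z : N z ^+ 2 = B z z.
Proof.
rewrite -powR_mulrn ?Lp_norm_ge0// Lp_norm_powR ?ler1n// cov_form.unlock.
congr Ex; apply/funext => w; by rewrite powR_mulrn// real_normK ?num_real// expr2.
Qed.

Lemma sqr_norm2D y z : N (y + z) ^+ 2 = N y ^+ 2 + 2 * B y z + N z ^+ 2.
Proof. by rewrite !sqr_norm2 cov_formDl !cov_formDr (cov_formC z y); ring. Qed.

Lemma norm2Z a z : N (a *: z) = `|a| * N z.
Proof.
apply/eqP; rewrite -(eqrXn2 (n := 2)) ?mulr_ge0 ?Lp_norm_ge0//.
by rewrite exprMn !sqr_norm2 cov_formZl cov_formZr real_normK ?num_real// mulrA expr2.
Qed.

Lemma norm2N z : N (- z) = N z.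
Proof. by rewrite -scaleN1r norm2Z normrN1 mul1r. Qed.

Lemma norm2_0 : N 0 = 0.
Proof. by rewrite -(scale0r 0) norm2Z normr0 mul0r. Qed.

Lemma cov_form_CS y z : B y z <= N y * N z.
Proof.
(* A null vector y makes the square of N (a y + z) affine in a; unless the slope vanishes, the
   chosen a makes it equal to -1. *)
have [y0|y0] := eqVneq (N y) 0.
  rewrite y0 mul0r leNgt; apply/negP => B0.
  pose a := - (N z ^+ 2 + 1) / (2 * B y z).
  have := sqr_ge0 (N (a *: y + z)).
  rewrite sqr_norm2D norm2Z y0 mulr0 cov_formZl expr0n /= add0r mulrA.
  have -> : 2 * a * B y z = - (N z ^+ 2 + 1) by rewrite /a; field; lra.
  lra.
have y_gt0 : 0 < N y by rewrite lt_def y0 Lp_norm_ge0.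
have [z0|z0] := eqVneq (N z) 0.
  rewrite z0 mulr0 leNgt; apply/negP => B0.
  pose a := - (N y ^+ 2 + 1) / (2 * B y z).
  have := sqr_ge0 (N (y + a *: z)).
  rewrite sqr_norm2D norm2Z z0 mulr0 cov_formZr expr0n /= addr0 mulrA.
  have -> : 2 * a * B y z = - (N y ^+ 2 + 1) by rewrite /a; field; lra.
  lra.
have z_gt0 : 0 < N z by rewrite lt_def z0 Lp_norm_ge0.
have := sqr_ge0 (N ((N z) *: y + (- N y) *: z)).
rewrite sqr_norm2D !norm2Z cov_formZl cov_formZr normrN !ger0_norm ?Lp_norm_ge0//.
have : 0 < N y * N z by rewrite mulr_gt0.
nra.
Qed.

Lemma norm2_triangle y z : N (y + z) <= N y + N z.
Proof.
rewrite -(ler_pXn2r (n := 2)) ?nnegrE ?addr_ge0 ?Lp_norm_ge0//.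
rewrite sqr_norm2D sqrrD; have := cov_form_CS y z; rewrite -mulr_natl; lra.
Qed.

Lemma norm2_triangleB y z : N (y - z) <= N y + N z.
Proof. by rewrite -(norm2N z) norm2_triangle. Qed.

Lemma norm2_bound : exists2 c, 0 < c & forall z, N z <= c * `|z|.
Proof.
exists (1 + \sum_i N (delta_mx ord0 i)).
  by rewrite ltr_pwDl// sumr_ge0// => i _; exact: Lp_norm_ge0.
move=> z; apply: (@le_trans _ _ (\sum_i N (delta_mx ord0 i) * `|z|)); last first.
  by rewrite -mulr_suml ler_wpM2r// lerDr.
rewrite [z in N z](matrix_sum_delta z) big_ord1.
apply: (@le_trans _ _ (\sum_i N (z ord0 i *: delta_mx ord0 i))).
  elim: (index_enum _) => [|i s IH]; first by rewrite !big_nil norm2_0.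
  by rewrite !big_cons (le_trans (norm2_triangle _ _))// lerD2l.
apply: ler_sum => i _; rewrite norm2Z mulrC ler_wpM2l ?Lp_norm_ge0//.
exact: le_coord_norm.
Qed.

Lemma norm2_dist y z : `|N y - N z| <= N (y - z).
Proof.
have h1 := norm2_triangle (y - z) z; have h2 := norm2_triangle (z - y) y.
rewrite !subrK -(opprB y z) norm2N in h1 h2.
by rewrite ler_norml; apply/andP; split; lra.
Qed.

Lemma norm2_continuous : continuous N.
Proof.
have [c c0 hc] := norm2_bound.
apply: (lipschitz_continuous (c := c)) => y z.
exact: le_trans (norm2_dist _ _) (hc _).
Qed.

Lemma measurable_norm2 : measurable_fun [set: T] (fun w => N (X w)).
Proof.
apply: (measurable_of_closed_le hX) => a; apply: closed_le_fun; exact: norm2_continuous.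
Qed.

Lemma norm_coord_sum z : `|z| <= \sum_i `|z ord0 i|.
Proof.
apply: norm_le_coord => [|i]; first exact: sumr_ge0.
by rewrite (bigD1 i)//= lerDl sumr_ge0.
Qed.

Lemma intg_lipschitz (f : 'rV[R]_n -> R) c : measurable_fun [set: T] (fun w => f (X w)) ->
  (forall x, `|f x| <= c * `|x|) -> intg P (fun w => f (X w)).
Proof.
move=> mf hf; apply: (@intg_le _ _ _ _ _ (fun w => `|c| * \sum_i `|dotr (X w) (delta_mx ord0 i)|)) => //.
  by apply: intgZ; apply: intg_sum => i; exact: intg_norm_dotr.
move=> w; apply: (le_trans (hf _)).
apply: (@le_trans _ _ (`|c| * `|X w|)); first by rewrite ler_wpM2r// ler_norm.
rewrite ler_wpM2l//; under eq_bigr do rewrite dotr_delta.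
exact: norm_coord_sum.
Qed.

Lemma intg_norm2 : intg P (fun w => N (X w)).
Proof.
have [c c0 hc] := norm2_bound.
apply: intg_lipschitz; first exact: measurable_norm2.
by move=> x; rewrite ger0_norm ?Lp_norm_ge0.
Qed.

Lemma Lp_norm_le_tail p th t : 1 <= p -> 0 < t -> pr P (tail th t) <= expR (- (5 * p)) ->
  Np p th <= 2 * t.
Proof.
move=> p1 t0 ht; have p0 : 0 < p by lra.
have [_ h] := moment_bound hX hL p1 t0 ht.
have -> : 2 * t = ((2 * t) `^ p) `^ p^-1.
  by rewrite -powRrM mulfV ?powRr1 ?gt_eqF//; lra.
rewrite Lp_norm.unlock; apply: ge0_ler_powR => //; rewrite ?nnegrE ?powR_ge0 ?invr_ge0 ?(ltW p0)//.
by apply: Ex_ge0 => w; exact: powR_ge0.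
Qed.

Lemma tail_gt p th t : 1 <= p -> 0 < t -> 2 * t < Np p th ->
  expR (- (5 * p)) < pr P (tail th t).
Proof.
move=> p1 t0; apply: contraTT; rewrite -!leNgt; exact: Lp_norm_le_tail.
Qed.

Lemma chebyshev_dotr th t : 0 < t -> pr P (tail th t) <= (N th / t) ^+ 2.
Proof.
move=> t0.
have := pr_markov (intg_dotr2 hX hL th) (fun w => sqr_ge0 _) (exprn_gt0 2 t0).
rewrite (_ : [set w | _] = tail th t); last first.
  apply/seteqP; split => w /=.
    by rewrite -(real_normK (num_real (dotr _ _))) ler_pXn2r ?nnegrE// ltW.
  by move=> h; rewrite -(real_normK (num_real (dotr _ _))) ler_pXn2r ?nnegrE// ltW.
by rewrite exprMn exprVn sqr_norm2 cov_form.unlock.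
Qed.

(** Chebyshev at level e^3 N gives a tail e^-6, and [borell] with b = 6, s = 2 q brings it below
    exp(-5 q), as [moment_bound] demands. The slack e keeps the level positive when the norm is
    0. *)
Lemma Lp_norm_le_norm2 q th : 1 <= q -> Np q th <= 4 * expR 3 * q * N th.
Proof.
move=> q1; apply/ler_addgt0Pr => e e0.
have c0 : 0 < 4 * expR 3 * q :> R by rewrite !mulr_gt0 ?expR_gt0//; lra.
pose s := N th + e / (4 * expR 3 * q).
have s0 : 0 < s by rewrite ltr_wpDl ?Lp_norm_ge0// divr_gt0.
have -> : 4 * expR 3 * q * N th + e = 2 * ((2 * q) * (expR 3 * s)).
  by rewrite /s; field; apply/andP; split; rewrite gt_eqF ?expR_gt0//; lra.
have t0 : 0 < expR 3 * s by rewrite mulr_gt0 ?expR_gt0.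
apply: Lp_norm_le_tail => //; first by rewrite !mulr_gt0 ?expR_gt0//; lra.
have h : pr P (tail th (expR 3 * s)) <= expR (- 6).
  apply: (le_trans (chebyshev_dotr _ t0)).
  apply: (@le_trans _ _ ((expR (-3)) ^+ 2)); last by rewrite -expRM_natr ler_expR; lra.
  rewrite ler_pXn2r ?nnegrE ?expR_ge0 ?divr_ge0 ?Lp_norm_ge0 ?(ltW t0)//.
  rewrite ler_pdivrMr// mulrA -expRD addNr expR0 mul1r lerDl.
  by rewrite divr_ge0// ltW.
have := @borell _ _ _ _ _ _ hX hL th (expR 3 * s) 6 (2 * q).
have -> : 1 <= 6 :> R by rewrite ler1n.
move=> /(_ isT) /(_ ltac:(lra)) /(_ h) /le_trans; apply.
rewrite ler_expR; lra.
Qed.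

(** Markov at level e^10 times the mean gives the tail e^-10 = exp(-5 * 2) that the second moment
    requires. *)
Lemma norm2_le_L1 th : N th <= 2 * expR 10 * Ex P (fun w => `|dotr (X w) th|).
Proof.
apply/ler_addgt0Pr => e e0.
have c0 : 0 < 2 * expR 10 :> R by rewrite !mulr_gt0 ?expR_gt0.
set b := Ex P _.
have b0 : 0 <= b by exact: Ex_ge0.
pose s := b + e / (2 * expR 10).
have s0 : 0 < s by rewrite ltr_wpDl// divr_gt0.
have -> : 2 * expR 10 * b + e = 2 * (expR 10 * s).
  by rewrite /s; field; rewrite gt_eqF ?expR_gt0.
have t0 : 0 < expR 10 * s by rewrite mulr_gt0 ?expR_gt0.
apply: Lp_norm_le_tail => //; first by rewrite ler1n.
apply: le_trans (pr_markov (intg_norm_dotr hX hL th) (fun w => normr_ge0 _) t0) _.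
rewrite ler_pdivrMr// mulrA -expRD (_ : _ + _ = 0) ?expR0 ?mul1r; last by ring.
by rewrite -/b lerDl divr_ge0// ltW.
Qed.

(** Chebyshev at level e^10 N gives the tail e^-20 = exp(-5 * 4) that the fourth moment requires. *)
Lemma fourth_moment th : intg P (fun w => dotr (X w) th ^+ 4) /\
  Ex P (fun w => dotr (X w) th ^+ 4) <= (2 * expR 10) ^+ 4 * N th ^+ 4.
Proof.
have E4 : (fun w => dotr (X w) th ^+ 4) = (fun w => `|dotr (X w) th| `^ 4).
  apply/funext => w; rewrite powR_mulrn//.
  by rewrite (exprM _ 2 2) (exprM _ 2 2) real_normK ?num_real.
have i4 : (1 : R) <= 4 by rewrite ler1n.
split; first by rewrite E4; exact: intg_powR.
rewrite E4 -Lp_norm_powR// powR_mulrn ?Lp_norm_ge0// -exprMn ler_pXn2r ?nnegrE ?mulr_ge0 ?expR_ge0 ?Lp_norm_ge0//.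
apply/ler_addgt0Pr => e e0.
have c0 : 0 < 2 * expR 10 :> R by rewrite !mulr_gt0 ?expR_gt0.
pose s := N th + e / (2 * expR 10).
have s0 : 0 < s by rewrite ltr_wpDl ?Lp_norm_ge0// divr_gt0.
have -> : 2 * expR 10 * N th + e = 2 * (expR 10 * s).
  by rewrite /s; field; rewrite gt_eqF ?expR_gt0.
have t0 : 0 < expR 10 * s by rewrite mulr_gt0 ?expR_gt0.
apply: Lp_norm_le_tail => //.
apply: (le_trans (chebyshev_dotr _ t0)).
apply: (@le_trans _ _ ((expR (-10)) ^+ 2)); last by rewrite -expRM_natr ler_expR; lra.
rewrite ler_pXn2r ?nnegrE ?expR_ge0 ?divr_ge0 ?Lp_norm_ge0 ?(ltW t0)//.
rewrite ler_pdivrMr// mulrA -expRD addNr expR0 mul1r lerDl.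
by rewrite divr_ge0// ltW.
Qed.

End Moments.

(** * Small ball and half-space estimates *)

Definition slab (R : realType) (n : nat) (th : 'rV[R]_n) (a b : R) : set 'rV[R]_n :=
  [set x | a <= dotr x th <= b].

Section SmallBall.
Context (d : measure_display) (T : measurableType d) (R : realType).
Variables (P : probability T R) (n : nat) (X : T -> 'rV[R]_n).
Hypotheses (hX : random_vector X) (hL : log_concave P X).
Implicit Types (th y z : 'rV[R]_n) (t s b p q : R).

Local Notation tail := (tail X).
Local Notation N := (Lp_norm P X 2).

Lemma closed_slab th a b : closed (slab th a b).
Proof.
rewrite (_ : slab th a b = [set x | a <= dotr x th] `&` [set x | dotr x th <= b]).
  by apply: closedI; [apply: closed_ge_fun|apply: closed_le_fun]; exact: dotr_continuous.
by apply/seteqP; split => [x /andP[]//|x [/= h1 h2]]; apply/andP.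
Qed.

Lemma measurable_slab th a b : measurable (X @^-1` slab th a b).
Proof. by apply: measurable_preimage_closed => //; exact: closed_slab. Qed.

Definition slab_ratio : nat := (Num.truncn (expR 6 : R)).+1.

Lemma slab_ratio_gt : expR 6 < slab_ratio%:R :> R.
Proof. by have /truncn_itv/andP[] := expR_ge0 (6 : R). Qed.

Lemma slab_ratio_gt0 : 0 < slab_ratio%:R :> R.
Proof. by rewrite ltr0n. Qed.

(** At level N / 4 the two-sided tail exceeds e^-10, at level [slab_ratio] times N it is at most
    e^-12 by Chebyshev. What lies between has mass more than 3 e^-12, split among two signs. *)
Lemma slab_mass th : 0 < N th ->
  expR (-12) <= pr P (X @^-1` slab th (N th / 4) (slab_ratio%:R * N th)) \/
  expR (-12) <= pr P (X @^-1` slab (- th) (N th / 4) (slab_ratio%:R * N th)).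
Proof.
move=> s0; set s := N th in s0 *.
have K0 := slab_ratio_gt0.
have h1 : expR (- 10) < pr P (tail th (s / 4)).
  have -> : - 10 = - (5 * 2) :> R by ring.
  by apply: (tail_gt hX hL); rewrite ?ler1n// -?/s; lra.
have h2 : pr P (tail th (slab_ratio%:R * s)) <= expR (- 12).
  have Ks0 : 0 < slab_ratio%:R * s by rewrite mulr_gt0.
  apply: (@le_trans _ _ ((N th / (slab_ratio%:R * s)) ^+ 2)); first exact: (chebyshev_dotr hX hL).
  have -> : -12 = -6 * 2%:R :> R by ring.
  rewrite expRM_natr ler_pXn2r ?nnegrE ?divr_ge0 ?mulr_ge0 ?expR_ge0 ?(ltW K0) ?(ltW s0)//.
  rewrite -/s invfM mulrCA divff ?gt_eqF// mulr1 expRN lef_pV2 ?posrE ?expR_gt0//.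
  exact: ltW slab_ratio_gt.
have mt := measurable_tail hX th (slab_ratio%:R * s).
have m1 := measurable_slab th (s / 4) (slab_ratio%:R * s).
have m2 := measurable_slab (- th) (s / 4) (slab_ratio%:R * s).
have h3 : pr P (tail th (s / 4)) <= pr P (tail th (slab_ratio%:R * s)) +
    (pr P (X @^-1` slab th (s / 4) (slab_ratio%:R * s)) + pr P (X @^-1` slab (- th) (s / 4) (slab_ratio%:R * s))).
  apply: le_trans (le_trans (prU P mt (measurableU _ _ m1 m2)) _); last by rewrite lerD2l prU.
  apply: pr_le => [||w /= hw]; [exact: measurable_tail|by do 2!apply: measurableU => //|].
  have [hk|hk] := leP (slab_ratio%:R * s) `|dotr (X w) th|; first by left.
  right; have [hp|hn] := leP 0 (dotr (X w) th).
    left; rewrite /slab /=.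
    by move: hw hk; rewrite /tail /= ger0_norm// => -> /ltW ->.
  right; rewrite /slab /= dotrNr.
  by move: hw hk; rewrite /tail /= ltr0_norm// => -> /ltW ->.
have e11 : expR (-12) * 4 <= expR (- 10) :> R.
  have -> : -10 = -12 + 1 * 2%:R :> R by ring.
  rewrite expRD ler_pM2l ?expR_gt0// expRM_natr.
  by have := expR_ge2 R; nra.
have [|hlt] := leP (expR (-12)) (pr P (X @^-1` slab th (s / 4) (slab_ratio%:R * s))); first by left.
right; have := expR_gt0 (-12 : R); lra.
Qed.

(* The intervals (1 - l) I + l J, where I = [-s/(24M), s/(24M)] and J is a short
   interval of mass at least c/M at distance at least s/4, are disjoint for M equally
   spaced l <= 1/2 and have mass at least (P(I) P(J))^(1/2). *)
Lemma small_ball_slab th M : (0 < M)%N -> 0 < N th ->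
  expR (-12) <= pr P (X @^-1` slab th (N th / 4) (slab_ratio%:R * N th)) ->
  pr P (X @^-1` slab th (- (N th / (24 * M%:R))) (N th / (24 * M%:R))) <=
    24 * slab_ratio%:R * expR 12 / M%:R.
Proof.
move=> M0 s0 hk; set s := N th in s0 hk *.
have M0' : 0 < M%:R :> R by rewrite ltr0n.
have M1 : 1 <= M%:R :> R by rewrite ler1n.
have K0 := slab_ratio_gt0.
have K1 : 1 <= slab_ratio%:R :> R by rewrite ler1n.
pose D := s / (24 * M%:R).
have D0 : 0 < D by rewrite divr_gt0// mulr_gt0.
have sD : s = 24 * M%:R * D by rewrite /D; field; rewrite gt_eqF.
rewrite -/D.
set b := pr P _.
pose m0 := (24 * M * slab_ratio)%N.
have m0R : m0%:R = 24 * M%:R * slab_ratio%:R :> R by rewrite !natrM.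
pose J (i : nat) := slab th (s / 4 + i%:R * D) (s / 4 + (i%:R + 1) * D).
(* Pigeonhole: [m0] intervals of length D cover the slab, because m0 D = [slab_ratio] s. *)
have [i hi] : exists i, expR (-12) / m0%:R <= pr P (X @^-1` J i).
  apply/not_existsP => hno.
  have : pr P (X @^-1` slab th (s / 4) (slab_ratio%:R * s)) <= \sum_(i <- iota 0 m0) pr P (X @^-1` J i).
    apply: pr_cover => [|i|w /andP[h1 h2]]; [exact: measurable_slab|exact: measurable_slab|].
    pose i := Num.truncn ((dotr (X w) th - s / 4) / D).
    have /truncn_itv /andP[i1 i2] : 0 <= (dotr (X w) th - s / 4) / D.
      by rewrite divr_ge0 ?(ltW D0)// subr_ge0.
    rewrite -/i in i1 i2.
    have i1' : i%:R * D <= dotr (X w) th - s / 4 by rewrite -ler_pdivlMr.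
    have i2' : dotr (X w) th - s / 4 < i.+1%:R * D by rewrite -ltr_pdivrMr.
    exists i.
      rewrite mem_iota add0n /= -(ltr_nat R) -(ltr_pM2r D0) (le_lt_trans i1')//.
      rewrite m0R; apply: (@lt_le_trans _ _ (slab_ratio%:R * s)); first by lra.
      by rewrite sD le_eqVlt; apply/orP; left; apply/eqP; ring.
    by rewrite /J /slab /=; apply/andP; split; [lra|rewrite natr1; lra].
  apply/negP; rewrite -ltNge; apply: lt_le_trans hk.
  apply: (@lt_le_trans _ _ (\sum_(i <- iota 0 m0) expR (-12) / m0%:R)).
    apply: ltr_sum => [|i _]; first by rewrite has_predT size_iota muln_gt0 muln_gt0 M0.
    by rewrite ltNge; apply/negP; exact: hno.
  by rewrite big_const_seq count_predT size_iota iter_addr_0 -[_ *+ _]mulr_natr divfK// m0R gt_eqF// !mulr_gt0.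
set j := pr P (X @^-1` J i) in hi.
have j0 : 0 < j by apply: lt_le_trans hi; rewrite divr_gt0 ?expR_gt0// m0R !mulr_gt0.
pose c := expR (-12) / (24 * slab_ratio%:R) : R.
have c0 : 0 < c by rewrite divr_gt0 ?expR_gt0// mulr_gt0.
have cM : expR (-12) / m0%:R = c / M%:R by rewrite m0R /c; field; rewrite !gt_eqF.
have cV : 24 * slab_ratio%:R * expR 12 = c^-1 :> R.
  by rewrite /c invf_div -expRN opprK mulrC.
rewrite cV.
have c1 : c <= 1.
  rewrite /c ler_pdivrMr ?mulr_gt0// mul1r.
  have : expR (-12) <= 1 :> R by rewrite expR_le1; lra.
  lra.
have [bc|cb] := leP b (c / M%:R).
  by apply: (le_trans bc); rewrite ler_pM2r ?invr_gt0// (le_trans c1)// invf_ge1.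
have b0 : 0 < b by apply: lt_trans cb; rewrite divr_gt0.
pose u := s / 4 + i%:R * D.
have u0 : s / 4 <= u by rewrite lerDl mulr_ge0// ltW.
pose l (m : 'I_M) : R := m.+1%:R / (2 * M%:R).
pose E (m : 'I_M) := X @^-1` slab th (l m * u - (1 - l m) * D) (l m * u + D).
have l0 m : 0 < l m by rewrite divr_gt0 ?mulr_gt0.
have l12 m : l m <= 2^-1.
  rewrite ler_pdivrMr ?mulr_gt0// mulrA mulVf ?pnatr_eq0// mul1r ler_nat.
  exact: ltn_ord.
have hE m : Num.sqrt (b * (c / M%:R)) <= pr P (E m).
  have hl := l12 m; have hl0 := l0 m.
  have hl01 : 0 < l m < 1 by apply/andP; split => //; lra.
  have := @log_concave_closed _ _ _ _ _ _ hX hL (slab th (- D) D) (J i)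
    (slab th (l m * u - (1 - l m) * D) (l m * u + D)) (l m)
    (@closed_slab _ _ _) (@closed_slab _ _ _) (@measurable_slab _ _ _) hl01.
  have hmap a x : slab th (- D) D a -> J i x ->
     slab th (l m * u - (1 - l m) * D) (l m * u + D) ((1 - l m) *: a + l m *: x).
    rewrite /J /slab /= dotrDl !dotrZl -/u => /andP[a1 a2] /andP[x1 x2].
    have x2' : dotr x th <= u + D by move: x2; rewrite /u; lra.
    have := ler_wpM2l (ltW hl0) x1; have := ler_wpM2l (ltW hl0) x2'.
    have l1 : 0 <= 1 - l m by lra.
    have := ler_wpM2l l1 a1; have := ler_wpM2l l1 a2.
    by move=> ????; apply/andP; split; lra.
  move=> /(_ hmap); apply: le_trans.
  rewrite -/b -/j -powR12_sqrt ?mulr_ge0 ?(ltW b0) ?divr_ge0 ?(ltW c0)//.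
  have cM0 : 0 < c / M%:R by rewrite divr_gt0.
  apply: (@le_trans _ _ (b `^ (1 - l m) * (c / M%:R) `^ (l m))); last first.
    rewrite ler_wpM2l ?powR_ge0//; apply: ge0_ler_powR; rewrite ?nnegrE ?(ltW hl0) ?(ltW j0) ?(ltW cM0)//.
    by rewrite -cM.
  rewrite powRM ?(ltW b0) ?(ltW cM0)//.
  have -> : 1 - l m = 2^-1 + (2^-1 - l m) by lra.
  rewrite (powRD (x := b)); last by rewrite (gt_eqF b0) implybT.
  have -> : (c / M%:R) `^ 2^-1 = (c / M%:R) `^ (2^-1 - l m) * (c / M%:R) `^ l m.
    by rewrite -powRD ?subrK// (gt_eqF cM0) implybT.
  rewrite mulrA ler_wpM2r ?powR_ge0// ler_wpM2l ?powR_ge0//.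
  by apply: ge0_ler_powR; rewrite ?nnegrE ?(ltW b0) ?(ltW cM0) ?(ltW cb)//; lra.
have hsum : \sum_(m < M) 1 * pr P (E m) <= 1.
  apply: overlap_bound => [m|w]; first exact: measurable_slab.
  case: (pselect (exists m, E m w)) => [[m Em]|hno]; last first.
    by rewrite big1// => m _; rewrite indicE memNset ?mulr0// => Em; apply: hno; exists m.
  rewrite (bigD1 m)//= big1 ?addr0 ?mul1r ?indicE ?mem_set// => m' m'm.
  rewrite indicE memNset ?mulr0// => Em'.
  have key (a a' : 'I_M) : (a < a')%N -> E a w -> E a' w -> False.
    move=> aa' /andP[_ h2] /andP[h1 _].
    have step : l a + (2 * M%:R)^-1 <= l a'.
      rewrite /l -[X in _ + X]mul1r -mulrDl ler_pM2r ?invr_gt0 ?mulr_gt0//.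
      by rewrite natr1 ler_nat.
    (* Centres of consecutive intervals are at least s / (8 M) = 3 D apart, while each reaches at
       most D to either side: this fixes the constant 24. *)
    have Mu : (2 * M%:R)^-1 * (s / 4) = 3 * D by rewrite sD; field; rewrite gt_eqF.
    have MV : 0 < (2 * M%:R)^-1 :> R by rewrite invr_gt0 mulr_gt0.
    have : (2 * M%:R)^-1 * (s / 4) <= (l a' - l a) * u.
      apply: ler_pM; [exact: (ltW MV)|lra|lra|exact: u0].
    have : 0 <= l a' * D by exact: ltW (mulr_gt0 (l0 a') D0).
    lra.
  have : val m' != val m by [].
  by rewrite neq_ltn => /orP[lt|gt]; [exact: key lt Em' Em|exact: key gt Em Em'].
have {}hsum : M%:R * Num.sqrt (b * (c / M%:R)) <= 1.
  apply: le_trans hsum; rewrite mulr_natl -{2}(card_ord M) -sumr_const.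
  by apply: ler_sum => m _; rewrite mul1r.
have : (M%:R * Num.sqrt (b * (c / M%:R))) ^+ 2 <= 1.
  by rewrite exprn_ile1// mulr_ge0 ?sqrtr_ge0.
rewrite exprMn sqr_sqrtr ?mulr_ge0 ?(ltW b0) ?divr_ge0 ?(ltW c0)// => h.
rewrite -[c^-1 / _]invfM -div1r (ler_pdivlMr _ _ (mulr_gt0 c0 M0')).
by apply: le_trans h; rewrite le_eqVlt; apply/orP; left; apply/eqP; field; rewrite gt_eqF.
Qed.

Definition small_ball_const : R := 24 * slab_ratio%:R * expR 12.

Lemma small_ball th M : (0 < M)%N -> 0 < N th ->
  pr P (X @^-1` [set x | `|dotr x th| <= N th / (24 * M%:R)]) <= small_ball_const / M%:R.
Proof.
move=> M0 s0.
have e (z : 'rV[R]_n) a : [set x | `|dotr x z| <= a] = slab z (- a) a.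
  by apply/seteqP; split => x; rewrite /slab /= ler_norml.
have [h|h] := slab_mass s0; first by rewrite e; exact: small_ball_slab.
have NN : N (- th) = N th by exact: norm2N.
rewrite -NN in s0 h *.
rewrite (_ : [set x | _] = [set x | `|dotr x (- th)| <= N (- th) / (24 * M%:R)]); last first.
  by apply/seteqP; split => x /=; rewrite dotrNr normrN.
by rewrite e; exact: small_ball_slab.
Qed.

Hypothesis hC : centered P X.

Lemma Ex_dotr th : Ex P (fun w => dotr (X w) th) = 0.
Proof.
rewrite /dotr Ex_sum => [|i]; last first.
  have := intgZ (th ord0 i) (intg_coord hX hL i).
  by congr intg; apply/funext => w; rewrite mulrC.
apply: big1 => i _.
rewrite (_ : (fun w => _) = (fun w => th ord0 i * X w ord0 i)); last by apply/funext => w; rewrite mulrC.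
rewrite ExZ; last exact: intg_coord.
by have := hC i; rewrite unlock Ex.unlock => ->; rewrite mulr0.
Qed.

(** As X is centered, the positive part of the functional has mean b / 2. It is at most K b on the
    half-space plus xi^2 / (K b); the second moment is at most 4 e^20 b^2, so with K = 64 e^20 the
    last term contributes at most b / 4. *)
Lemma halfspace_mass th : 0 < N th ->
  (256 * expR 20)^-1 <= pr P (X @^-1` [set x | 0 <= dotr x th]).
Proof.
move=> s0; set b := Ex P (fun w => `|dotr (X w) th|).
have hb := norm2_le_L1 hX hL th; rewrite -/b in hb.
have b0 : 0 < b.
  rewrite ltNge; apply/negP => b0.
  have : 2 * expR 10 * b <= 0 by rewrite mulr_ge0_le0 ?mulr_ge0 ?expR_ge0.
  lra.
pose K : R := 64 * expR 20.
have K0 : 0 < K by rewrite mulr_gt0 ?expR_gt0.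
have cH : closed [set x : 'rV[R]_n | 0 <= dotr x th] by apply: closed_ge_fun; exact: dotr_continuous.
have mH := measurable_preimage_closed hX cH.
set H := X @^-1` _ in mH *.
have pw w : 2^-1 * (dotr (X w) th + `|dotr (X w) th|) <=
    K * b * \1_H w + (K * b)^-1 * dotr (X w) th ^+ 2.
  have Kb : 0 < K * b by rewrite mulr_gt0.
  rewrite indicE; have [h|h] := leP 0 (dotr (X w) th); last first.
    rewrite ltr0_norm// addrN mulr0.
    by apply: addr_ge0; apply: mulr_ge0; rewrite ?invr_ge0 ?sqr_ge0 ?(ltW Kb).
  rewrite ger0_norm// mem_set// mulr1.
  have [h2|h2] := leP (dotr (X w) th) (K * b).
    have : 0 <= (K * b)^-1 * dotr (X w) th ^+ 2 by rewrite mulr_ge0 ?invr_ge0 ?sqr_ge0 ?(ltW Kb).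
    lra.
  have : dotr (X w) th <= (K * b)^-1 * dotr (X w) th ^+ 2.
    by rewrite ler_pdivlMl// expr2 ler_wpM2r// ltW.
  lra.
have i1 := intg_dotr hX hL th; have i2 := intg_norm_dotr hX hL th.
have i3 := intg_indic P mH; have i4 := intg_dotr2 hX hL th.
have := Ex_le (intgZ 2^-1 (intgD i1 i2)) (intgD (intgZ (K * b) i3) (intgZ (K * b)^-1 i4)) pw.
rewrite ExZ; last exact: intgD.
rewrite ExD// Ex_dotr add0r ExD; [|exact: intgZ|exact: intgZ].
rewrite !ExZ// Ex_indic// -/b.
have -> : Ex P (fun w => dotr (X w) th ^+ 2) = N th ^+ 2 by rewrite sqr_norm2// cov_form.unlock.
have hs : (K * b)^-1 * N th ^+ 2 <= 4^-1 * b.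
  rewrite ler_pdivrMl ?mulr_gt0//.
  apply: (@le_trans _ _ ((2 * expR 10 * b) ^+ 2)).
    by rewrite ler_pXn2r ?nnegrE ?mulr_ge0 ?expR_ge0 ?(ltW b0) ?(ltW s0).
  have e20 : expR 20 = expR 10 ^+ 2 :> R by rewrite -expRM_natr; congr expR; ring.
  rewrite /K e20; have := sqr_ge0 (expR 10 * b).
  rewrite !exprMn; lra.
move=> h.
have : 4^-1 * b <= K * b * pr P H by lra.
have -> : K * b * pr P H = K * pr P H * b by ring.
rewrite ler_pM2r// => h4.
have -> : (256 * expR 20)^-1 = K^-1 * 4^-1 :> R by rewrite /K; field; rewrite gt_eqF ?expR_gt0.
by rewrite ler_pdivrMl.
Qed.

End SmallBall.

(** * Random rows separating far apart pairs *)

Section ProductExpectation.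
Context (d1 d2 : measure_display) (T1 : measurableType d1) (T2 : measurableType d2).
Context (R : realType) (P1 : probability T1 R) (P2 : probability T2 R).
Variables (f : T1 * T2 -> R) (M : R).
Hypotheses (mf : measurable_fun [set: T1 * T2] f) (f0 : forall z, 0 <= f z)
  (fM : forall z, f z <= M).

Let mfx x : measurable_fun [set: T2] (fun y => f (x, y)).
Proof. exact: measurableT_comp. Qed.

Let mfy y : measurable_fun [set: T1] (fun x => f (x, y)).
Proof. exact: measurableT_comp. Qed.

Lemma intg_prod1 x : intg P2 (fun y => f (x, y)).
Proof. by apply: (@intg_bounded _ _ _ _ _ M) => // y; rewrite ger0_norm. Qed.

Lemma intg_prod2 y : intg P1 (fun x => f (x, y)).
Proof. by apply: (@intg_bounded _ _ _ _ _ M) => // x; rewrite ger0_norm. Qed.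

Lemma Ex_prod1_bound x : `|Ex P2 (fun y => f (x, y))| <= M.
Proof.
rewrite ger0_norm ?Ex_ge0// -[leRHS](Ex_cst P2); apply: Ex_le => //; [exact: intg_prod1|exact: intg_cst].
Qed.

Lemma Ex_prod2_bound y : `|Ex P1 (fun x => f (x, y))| <= M.
Proof.
rewrite ger0_norm ?Ex_ge0// -[leRHS](Ex_cst P1); apply: Ex_le => //; [exact: intg_prod2|exact: intg_cst].
Qed.

Let mEf : measurable_fun [set: T1 * T2] (EFin \o f). Proof. exact/measurable_EFinP. Qed.
Let Ef0 z : (0 <= (EFin \o f) z)%E. Proof. by rewrite lee_fin. Qed.

Lemma intg_Ex_prod1 : intg P1 (fun x => Ex P2 (fun y => f (x, y))).
Proof.
apply: (@intg_bounded _ _ _ _ _ M) => [|x]; last exact: Ex_prod1_bound.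
apply/measurable_EFinP.
have := @measurable_fun_fubini_tonelli_F _ _ _ _ _ P2 (EFin \o f) mEf Ef0.
congr measurable_fun; apply/funext => x /=; rewrite ExEFin//; exact: intg_prod1.
Qed.

Lemma intg_Ex_prod2 : intg P2 (fun y => Ex P1 (fun x => f (x, y))).
Proof.
apply: (@intg_bounded _ _ _ _ _ M) => [|x]; last exact: Ex_prod2_bound.
apply/measurable_EFinP.
have := @measurable_fun_fubini_tonelli_G _ _ _ _ _ P1 (EFin \o f) mEf Ef0.
congr measurable_fun; apply/funext => x /=; rewrite ExEFin//; exact: intg_prod2.
Qed.

Lemma Ex_prodC :
  Ex P1 (fun x => Ex P2 (fun y => f (x, y))) = Ex P2 (fun y => Ex P1 (fun x => f (x, y))).
Proof.
apply: EFin_inj; rewrite !ExEFin; [|exact: intg_Ex_prod2|exact: intg_Ex_prod1].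
under eq_integral => x _ do rewrite (ExEFin (intg_prod1 x)).
under [RHS]eq_integral => y _ do rewrite (ExEFin (intg_prod2 y)).
exact: (@fubini_tonelli _ _ _ _ _ P1 P2 (EFin \o f) mEf Ef0).
Qed.

Lemma Ex_prodE :
  Ex (P1 \x P2)%E f = Ex P1 (fun x => Ex P2 (fun y => f (x, y))).
Proof.
apply: EFin_inj; rewrite !ExEFin; [|exact: intg_Ex_prod1|]; last first.
  by apply: (@intg_bounded _ _ _ _ _ M) => // y; rewrite ger0_norm.
under [RHS]eq_integral => x _ do rewrite (ExEFin (intg_prod1 x)).
exact: (@fubini_tonelli1 _ _ _ _ _ P1 P2 (EFin \o f) mEf Ef0).
Qed.

End ProductExpectation.

Section GeometricSum.
Context (R : realType).
Implicit Types (u : R).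

(** The bound is uniform in the number of grid points; it supplies the 6 of [cell_count]. *)
Lemma geometric_sum_le m u : \sum_(j < m) expR (- `|u - j%:R|) <= 6.
Proof.
(* Removing j = 0 shifts u by 1. The bounds by sign of u leave just enough room for the removed
   term, because e >= 2. *)
suff : (u <= 0 -> \sum_(j < m) expR (- `|u - j%:R|) <= 2 * expR u) /\
       (0 < u -> \sum_(j < m) expR (- `|u - j%:R|) <= 6 - 2 * expR (- u)).
  move=> [h1 h2]; have [u0|u0] := leP u 0.
    apply: le_trans (h1 u0) _; have : expR u <= 1 by rewrite expR_le1.
    lra.
  by apply: le_trans (h2 u0) _; have := expR_gt0 (- u); lra.
have e2 := expR_ge2 R; have eN := expRN1_le R.
elim: m u => [|m IH] u.
  rewrite big_ord0; split => u0; first by rewrite mulr_ge0 ?expR_ge0.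
  have : expR (- u) <= 1 by rewrite expR_le1; lra.
  lra.
rewrite big_ord_recl subr0.
under eq_bigr do rewrite lift0 -natr1 opprD addrA addrAC.
have [IH1 IH2] := IH (u - 1).
split => u0.
  have /IH1 : u - 1 <= 0 by lra.
  rewrite ler0_norm// opprK expRD; have := expR_gt0 u; nra.
rewrite gtr0_norm//.
have [u1|u1] := leP (u - 1) 0.
  have h1 := IH1 u1.
  have : expR (u - 1) <= 1 by rewrite expR_le1.
  have : expR (- u) <= 1 by rewrite expR_le1; lra.
  lra.
have := IH2 u1.
have -> : - (u - 1) = - u + 1 by ring.
rewrite expRD; have := expR_gt0 (- u); nra.
Qed.

End GeometricSum.

(** * Random rows detect pairs that are far apart *)

Section Separation.
Context (d : measure_display) (T : measurableType d) (R : realType).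
Variables (P : probability T R) (n : nat) (X : T -> 'rV[R]_n).
Hypotheses (hX : random_vector X) (hL : log_concave P X).
Implicit Types (th x y z : 'rV[R]_n) (t s b p q eps : R).

Local Notation N := (Lp_norm P X 2).
Local Notation I := (Ex P (fun w => N (X w))).
Hypothesis hI : 0 < I.

(** At this scale the small ball has mass at most eps / 2. Outside it, a vector of norm at least
    [row_radius] I has a dot product of at least (2 / eps) I, whose exponential weight is at most
    eps / 2 as well. *)
Definition row_scale eps : nat := (Num.truncn (2 * small_ball_const R / eps)).+1.
Definition row_radius eps : R := 24 * (row_scale eps)%:R * (2 / eps).

Lemma row_radius_gt0 eps : 0 < eps -> 0 < row_radius eps.
Proof. by move=> e0; rewrite !mulr_gt0// ?invr_gt0 ?ltr0n. Qed.

Lemma measurable_expdot z : measurable_fun [set: T] (fun w => expR (- (`|dotr (X w) z| / I))).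
Proof.
apply: measurableT_comp => //; apply: measurableT_comp => //; apply: measurable_funM => //.
by apply: measurableT_comp => //; exact: measurable_dotr.
Qed.

Lemma expdot_le1 a : 0 <= a -> expR (- (a / I)) <= 1.
Proof. by move=> a0; rewrite expR_le1 oppr_le0 divr_ge0// ltW. Qed.

Lemma Ex_expdot z eps : 0 < eps -> row_radius eps * I <= N z ->
  Ex P (fun w => expR (- (`|dotr (X w) z| / I))) <= eps.
Proof.
move=> e0 hz.
have M0 : (0 < row_scale eps)%N by [].
have M0' : 0 < (row_scale eps)%:R :> R by rewrite ltr0n.
have Nz0 : 0 < N z by apply: lt_le_trans hz; rewrite mulr_gt0 ?row_radius_gt0.
have hsb := small_ball hX hL M0 Nz0.
set a := N z / _ in hsb.
have cA : closed [set x : 'rV[R]_n | `|dotr x z| <= a].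
  by apply: closed_le_fun; exact: norm_dotr_continuous.
have mA := measurable_preimage_closed hX cA.
set A := X @^-1` _ in hsb mA.
have hA : pr P A <= eps / 2.
  apply: (le_trans hsb); rewrite ler_pdivrMr// mulrC -ler_pdivrMr ?divr_gt0//.
  have /truncn_itv/andP[_] : 0 <= 2 * small_ball_const R / eps.
    by rewrite divr_ge0 ?(ltW e0)// !mulr_ge0 ?expR_ge0.
  rewrite -/(row_scale eps) => /ltW; apply: le_trans.
  by rewrite invf_div mulrA [_ * 2]mulrC.
have ha : expR (- (a / I)) <= eps / 2.
  have aI : 2 / eps <= a / I.
    rewrite ler_pdivlMr// /a ler_pdivlMr ?mulr_gt0//.
    by apply: le_trans hz; rewrite /row_radius le_eqVlt; apply/orP; left; apply/eqP; ring.
  have h2 : 2 / eps <= expR (a / I) by have := expR_ge1Dx (a / I); lra.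
  have e20 : 0 < 2 / eps by rewrite divr_gt0.
  by rewrite expRN -[leRHS]invf_div lef_pV2 ?posrE ?expR_gt0.
have -> : eps = Ex P (fun w => eps / 2 + (eps / 2) * 1) by rewrite Ex_cst; lra.
apply: (@le_trans _ _ (Ex P (fun w => 1 * \1_A w + expR (- (a / I))))).
  apply: Ex_le.
  - apply: (@intg_bounded _ _ _ _ _ 1) => [|w]; first exact: measurable_expdot.
    by rewrite ger0_norm ?expR_ge0// expdot_le1.
  - by apply: intgD; [apply: intgZ; exact: intg_indic|exact: intg_cst].
  - move=> w; rewrite mul1r indicE; case: (boolP (w \in A)) => wA.
      by rewrite (le_trans (expdot_le1 _))// lerDl expR_ge0.
    rewrite add0r ler_expR lerN2 ler_pM2r ?invr_gt0//.
    by move: wA; rewrite notin_setE /A /= => /negP; rewrite -ltNge => /ltW.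
rewrite ExD; [|apply: intgZ; exact: intg_indic|exact: intg_cst].
by rewrite ExZ ?Ex_indic ?Ex_cst//; [lra|exact: intg_indic].
Qed.

Let PP := (P \x P)%E.
Definition pairX (w : T * T) : 'rV[R]_n := X w.1 - X w.2.

Lemma random_vector_pair : random_vector pairX.
Proof.
move=> i; rewrite (_ : (fun w => _) = (fun w : T * T => X w.1 ord0 i - X w.2 ord0 i)); last first.
  by apply/funext => w; rewrite !mxE.
by apply: measurable_funB; apply: measurableT_comp (hX i) _.
Qed.

Definition rowfactor x (w : T * T) : R := expR (- (`|dotr (pairX w) x| / I)).

Lemma measurable_rowfactor x : measurable_fun [set: T * T] (rowfactor x).
Proof.
apply: measurableT_comp => //; apply: measurableT_comp => //; apply: measurable_funM => //.
by apply: measurableT_comp => //; exact: measurable_dotr random_vector_pair x.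
Qed.

(** By Fubini and [Ex_expdot] a random row multiplies the weight g by at most eps on average. Rows
    with N x <= 4 I have mass at least 3/4, so one of them is within 4/3 of the average. *)
Lemma row_step (g : T * T -> R) eps : 0 < eps -> measurable_fun [set: T * T] g ->
  (forall w, 0 <= g w) -> (forall w, g w <= 1) ->
  (forall w, g w != 0 -> row_radius eps * I <= N (pairX w)) ->
  exists2 x, N x <= 4 * I & Ex PP (fun w => g w * rowfactor x w) <= 2 * eps * Ex PP g.
Proof.
move=> e0 mg g0 g1 hg.
have cO : closed [set x | N x <= 4 * I].
  by apply: closed_le_fun; exact: norm2_continuous.
have mO := measurable_preimage_closed hX cO.
set O := X @^-1` _ in mO.
have hO : 3 / 4 <= pr P O.
  have I4 : 0 < 4 * I by rewrite mulr_gt0.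
  have := pr_markov (intg_norm2 hX hL) (fun w => Lp_norm_ge0 P X 2 (X w)) I4.
  rewrite invfM mulrCA divff ?gt_eqF// mulr1.
  set B := [set w | _] => hB.
  have mB : measurable B by apply: measurable_ge; exact: measurable_norm2.
  have : pr P (~` B) <= pr P O.
    apply: pr_le => //; first exact: measurableC.
    by move=> w /negP; rewrite -ltNge => /ltW.
  rewrite prC//; lra.
have ig : intg PP g by apply: (@intg_bounded _ _ _ _ _ 1) => // w; rewrite ger0_norm.
have Eg0 : 0 <= Ex PP g by exact: Ex_ge0.
apply: contrapT => hno.
have {}hno w : O w -> 2 * eps * Ex PP g < Ex PP (fun w' => g w' * rowfactor (X w) w').
  move=> Ow; rewrite ltNge; apply/negP => h; apply: hno.
  by exists (X w).
pose h (z : T * (T * T)) : R := \1_O z.1 * (g z.2 * expR (- (`|dotr (X z.1) (pairX z.2)| / I))).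
have mh : measurable_fun [set: T * (T * T)] h.
  apply: measurable_funM; first by apply: measurableT_comp => //; exact: measurable_indic.
  apply: measurable_funM; first exact: measurableT_comp.
  apply: measurableT_comp => //; apply: measurableT_comp => //; apply: measurable_funM => //.
  apply: measurableT_comp => //; apply: measurable_sum => i; apply: measurable_funM.
    exact: (measurableT_comp (hX i)).
  exact: (measurableT_comp (random_vector_pair i)).
have hh0 (z : T * (T * T)) : 0 <= h z by rewrite /h indicE !mulr_ge0 ?expR_ge0.
have hh1 (z : T * (T * T)) : h z <= 1.
  rewrite /h indicE; apply: mulr_ile1; rewrite ?mulr_ge0 ?expR_ge0 ?lern1 ?leq_b1//.
  by apply: mulr_ile1; rewrite ?expR_ge0// expdot_le1.
have hE := @Ex_prodC _ _ _ _ R P PP h 1 mh hh0 hh1.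
have le1 : 3 / 4 * (2 * eps * Ex PP g) <= Ex P (fun w => Ex PP (fun w' => h (w, w'))).
  apply: (@le_trans _ _ (Ex P (fun w => (2 * eps * Ex PP g) * \1_O w))).
    rewrite ExZ ?Ex_indic//; last exact: intg_indic.
    by rewrite [leRHS]mulrC ler_wpM2r// !mulr_ge0// ltW.
  apply: Ex_le; first by apply: intgZ; exact: intg_indic.
    exact: (@intg_Ex_prod1 _ _ _ _ R P PP h 1).
  move=> w; rewrite /h /= indicE; case: (boolP (w \in O)) => [|_].
    rewrite inE => Ow; rewrite mulr1; apply: le_trans (ltW (hno w Ow)) _.
    rewrite le_eqVlt; apply/orP; left; apply/eqP; congr Ex; apply/funext => w'.
    by rewrite mul1r /rowfactor dotrC.
  by rewrite mulr0; apply: Ex_ge0 => w'; rewrite mul0r.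
have le2 : Ex PP (fun w' => Ex P (fun w => h (w, w'))) <= eps * Ex PP g.
  rewrite -ExZ//; apply: Ex_le; [exact: (@intg_Ex_prod2 _ _ _ _ R P PP h 1)|exact: intgZ|].
  move=> w'; have [gw|gw] := eqVneq (g w') 0.
    rewrite gw mulr0 (_ : (fun w => _) = (fun=> 0)) ?Ex_cst//.
    by apply/funext => w; rewrite /h /= gw mul0r mulr0.
  apply: (@le_trans _ _ (Ex P (fun w => g w' * expR (- (`|dotr (X w) (pairX w')| / I))))).
    have ie : intg P (fun w => expR (- (`|dotr (X w) (pairX w')| / I))).
      apply: (@intg_bounded _ _ _ _ _ 1) => [|w]; first exact: measurable_expdot.
      by rewrite ger0_norm ?expR_ge0// expdot_le1.
    apply: Ex_le; [exact: (@intg_prod2 _ _ _ _ R P h 1)|exact: intgZ|].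
    move=> w; rewrite /h /= indicE ler_piMl ?mulr_ge0 ?expR_ge0//.
    by case: (_ \in _).
  rewrite ExZ; last first.
    apply: (@intg_bounded _ _ _ _ _ 1) => [|w]; first exact: measurable_expdot.
    by rewrite ger0_norm ?expR_ge0// expdot_le1.
  by rewrite mulrC ler_wpM2r// Ex_expdot// hg.
(* If every admissible row failed, 3/4 * 2 eps times the mean of g would be at most eps times it.
   The mean is then 0, and no row can fail strictly. *)
have eg : Ex PP g = 0.
  apply/eqP; rewrite eq_le Eg0 andbT.
  move: le1; rewrite hE => /le_trans /(_ le2).
  rewrite leNgt => h1; rewrite leNgt; apply: contra h1 => Eg.
  have : 0 < eps * Ex PP g by rewrite mulr_gt0.
  lra.
have [w Ow] : O !=set0.
  apply/set0P/negP => /eqP O0; move: hO; rewrite O0 pr_set0; lra.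
have := hno w Ow; rewrite eg mulr0 ltNge => /negP; apply.
rewrite -eg; apply: Ex_le => //.
  apply: (@intg_bounded _ _ _ _ _ 1); first by apply: measurable_funM => //; exact: measurable_rowfactor.
  move=> w'; rewrite ger0_norm ?mulr_ge0 ?expR_ge0// mulr_ile1 ?expR_ge0//.
  by rewrite expdot_le1.
by move=> w'; rewrite ler_piMr// expdot_le1.
Qed.

(* The rows are drawn one at a time: by the small ball estimate a random row multiplies the weight of
   the pairs that are still far apart by at most [2 * eps] on average. *)
Lemma rows eps k : 0 < eps -> exists xs : 'I_k -> 'rV[R]_n,
  (forall i, N (xs i) <= 4 * I) /\
  Ex PP (fun w => \1_[set w' | row_radius eps * I <= N (pairX w')] w * \prod_i rowfactor (xs i) w) <= (2 * eps) ^+ k.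
Proof.
move=> e0; set F := [set w' | _].
have mF : measurable F.
  apply: measurable_ge; apply: (measurable_of_closed_le random_vector_pair (f := N)) => a.
  by apply: closed_le_fun; exact: norm2_continuous.
have mfac m (xs : 'I_m -> 'rV[R]_n) : measurable_fun [set: T * T] (fun w => \prod_i rowfactor (xs i) w).
  by apply: measurable_prod => i _; exact: measurable_rowfactor.
elim: k => [|k [xs [hxs IH]]].
  exists (fun=> 0); split => [[]//|]; rewrite expr0.
  rewrite (_ : (fun w => _) = \1_F) ?Ex_indic ?pr_le1//.
  by apply/funext => w; rewrite big_ord0 mulr1.
pose g w : R := \1_F w * \prod_i rowfactor (xs i) w.
have fac01 w : 0 <= \prod_i rowfactor (xs i) w <= 1.
  elim/big_ind: _ => [|y z /andP[y0 y1] /andP[z0 z1]|i _].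
  - by rewrite ler01 lexx.
  - by rewrite mulr_ge0// mulr_ile1.
  - by rewrite expR_ge0 expdot_le1.
have [|w|w|w|x hx1 hx2] := @row_step g eps e0.
- by apply: measurable_funM => //; exact: measurable_indic.
- by have /andP[h _] := fac01 w; rewrite mulr_ge0// indicE.
- by have /andP[h h'] := fac01 w; rewrite mulr_ile1// indicE; case: (_ \in _).
- rewrite /g indicE; case: (boolP (w \in F)); last by rewrite mul0r eqxx.
  by rewrite inE.
exists (fun i => if unlift ord0 i is Some j then xs j else x); split.
  by move=> i; case: unliftP => [j _|_].
rewrite exprS; apply: le_trans (le_trans hx2 _); last by rewrite ler_wpM2l// mulr_ge0// ltW.
rewrite le_eqVlt; apply/orP; left; apply/eqP; congr Ex; apply/funext => w.
rewrite /g -mulrA; congr (_ * _); rewrite big_ord_recl unlift_none mulrC; congr (_ * _).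
by apply: eq_bigr => i _; rewrite liftK.
Qed.

End Separation.

(** * Dense pieces of small diameter *)

Section Cells.
Context (d : measure_display) (T : measurableType d) (R : realType).
Variables (P : probability T R) (n : nat) (X : T -> 'rV[R]_n).
Hypotheses (hX : random_vector X) (hL : log_concave P X).
Implicit Types (th x y z : 'rV[R]_n) (t s b p q eps : R).

Local Notation N := (Lp_norm P X 2).
Local Notation I := (Ex P (fun w => N (X w))).
Hypothesis hI : 0 < I.

(** Per row: a point lies in at most 6 e^9 enlarged cells (weighted count); a set of mass e^-6 keeps
    a cell of mass [cell_density]; [row_error] is such that e * 2 * [row_error] is half the square
    of that; a quarter of the cell survives in [piece_density]. *)
Definition cell_count : R := 6 * expR 9.
Definition cell_density : R := expR (-12) / (16 * cell_count ^+ 2).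
Definition row_error : R := cell_density ^+ 2 / (4 * expR 1).
Definition piece_density : R := cell_density / 4.
Definition piece_radius : R := row_radius row_error.

Lemma cell_count_gt0 : 0 < cell_count. Proof. by rewrite mulr_gt0 ?expR_gt0. Qed.

Lemma cell_count_ge1 : 1 <= cell_count.
Proof. by rewrite /cell_count; have := expR_ge1Dx (9 : R); lra. Qed.

Lemma cell_density_gt0 : 0 < cell_density.
Proof. by rewrite divr_gt0 ?expR_gt0// mulr_gt0 ?exprn_gt0 ?cell_count_gt0. Qed.

Lemma cell_density_le1 : cell_density <= 1.
Proof.
have D2 : 1 <= cell_count ^+ 2 by rewrite exprn_ege1 ?cell_count_ge1.
rewrite ler_pdivrMr; last by lra.
have : expR (-12) <= 1 :> R by rewrite expR_le1; lra.
lra.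
Qed.

Lemma row_error_gt0 : 0 < row_error.
Proof. by apply: divr_gt0; [exact: exprn_gt0 cell_density_gt0|rewrite mulr_gt0 ?expR_gt0]. Qed.

Lemma piece_density_gt0 : 0 < piece_density. Proof. by rewrite divr_gt0 ?cell_density_gt0. Qed.

Lemma piece_density_le : piece_density <= 4^-1.
Proof. by rewrite /piece_density; have := cell_density_le1; lra. Qed.

Lemma piece_radius_gt0 : 0 < piece_radius. Proof. exact: row_radius_gt0 row_error_gt0. Qed.

Lemma closed_forall (K : Type) (C : K -> set 'rV[R]_n) : (forall i, closed (C i)) ->
  closed [set x | forall i, C i x].
Proof.
move=> hC; rewrite (_ : mkset _ = \bigcap_(i in [set: K]) C i).
  by apply: closed_bigI => i _; exact: hC.
by apply/seteqP; split => [x h i _|x h i]; exact: h.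
Qed.

Lemma closed_slab_div x a b : closed [set y : 'rV[R]_n | a <= dotr y x / I <= b].
Proof.
rewrite (_ : mkset _ = slab x (a * I) (b * I)); first exact: closed_slab.
by apply/seteqP; split => y; rewrite /slab /= ler_pdivlMr// ler_pdivrMr.
Qed.

Lemma l1_affine_continuous k (xs : 'I_k -> 'rV[R]_n) (a : R) (c : 'I_k -> R) :
  continuous (fun x : 'rV[R]_n => \sum_i `|a * (dotr x (xs i) / I) - c i|).
Proof.
apply: (lipschitz_continuous (c := \sum_i `|a| * (l1norm (xs i) / I))) => x y.
rewrite -sumrB mulr_suml; apply: le_trans (ler_norm_sum _ _ _) _.
apply: ler_sum => i _; apply: le_trans (ler_dist_dist _ _) _.
rewrite (_ : _ - _ = a * (dotr (x - y) (xs i) / I)); last by rewrite dotrBl; ring.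
rewrite !normrM -mulrA ler_wpM2l// (@gtr0_norm _ I^-1) ?invr_gt0//.
rewrite mulrAC ler_wpM2r ?invr_ge0 ?(ltW hI)// mulrC.
exact: dotr_le_norm.
Qed.

(* The mixtures of [A] with the bulk set [B0] have bounded overlap and, by log-concavity, mass at
   least (pr C)^(1/2) / 2 for each cell C of [A]; hence some cell has mass comparable to (pr A)^2. *)
Lemma cell_mass k (xs : 'I_k -> 'rV[R]_n) (A : set 'rV[R]_n) M : (0 < k)%N ->
  (forall i, N (xs i) <= 4 * I) -> closed A -> A `<=` [set x | `|x| <= M] ->
  0 < pr P (X @^-1` A) ->
  exists C, [/\ closed C, C `<=` A,
    (forall x y, C x -> C y -> forall i, `|dotr (x - y) (xs i)| / I <= 1) &
    pr P (X @^-1` A) ^+ 2 / (16 * cell_count ^+ (2 * k)) <= pr P (X @^-1` C)].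
Proof.
move=> k0 hxs cA AM a0; set a := pr P _ in a0 *.
have mX K : closed K -> measurable (X @^-1` K) by exact: measurable_preimage_closed.
have k0' : 0 < k%:R :> R by rewrite ltr0n.
pose S (x : 'rV[R]_n) : R := \sum_i `|1 * (dotr x (xs i) / I) - 0|.
have SE x : S x = \sum_i `|dotr x (xs i)| / I.
  by apply: eq_bigr => i _; rewrite mul1r subr0 normrM (@gtr0_norm _ I^-1) ?invr_gt0.
(* E S <= 4 k because each row has norm at most 4 I, so Markov keeps half of the mass. Only 1/4 is
   recorded, its square root being 1/2. *)
pose B0 := [set x | S x <= 8 * k%:R].
have cB0 : closed B0 by apply: closed_le_fun; exact: l1_affine_continuous.
have hB0 : 4^-1 <= pr P (X @^-1` B0).
  have iS : intg P (fun w => S (X w)).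
    rewrite (_ : (fun w => _) = (fun w => \sum_i I^-1 * `|dotr (X w) (xs i)|)).
      by apply: intg_sum => i; apply: intgZ; exact: intg_norm_dotr.
    by apply/funext => w; rewrite SE; apply: eq_bigr => i _; rewrite mulrC.
  have ES : Ex P (fun w => S (X w)) <= 4 * k%:R.
    rewrite (_ : (fun w => _) = (fun w => \sum_i I^-1 * `|dotr (X w) (xs i)|)); last first.
      by apply/funext => w; rewrite SE; apply: eq_bigr => i _; rewrite mulrC.
    rewrite Ex_sum => [|i]; last by apply: intgZ; exact: intg_norm_dotr.
    apply: (@le_trans _ _ (\sum_(i < k) 4)).
      apply: ler_sum => i _; rewrite ExZ; last exact: intg_norm_dotr.
      rewrite ler_pdivrMl// [leRHS]mulrC.
      apply: le_trans (hxs i).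
      have := @Lp_norm_mono _ _ _ _ _ _ hX hL 2 1 (xs i) (lexx _); rewrite ler1n => /(_ isT).
      apply: le_trans; rewrite Lp_norm.unlock invr1 powRr1; last by apply: Ex_ge0 => w; exact: powR_ge0.
      by rewrite le_eqVlt; apply/orP; left; apply/eqP; congr Ex; apply/funext => w; rewrite powRr1.
    by rewrite sumr_const card_ord -(mulr_natr 4 k).
  have k8 : 0 < 8 * k%:R :> R by rewrite mulr_gt0.
  have S0 w : 0 <= S (X w) by exact: sumr_ge0.
  have := pr_markov iS S0 k8.
  set B := [set w | _] => hB.
  have mB : measurable B by apply: measurable_ge; exact: intg_meas iS.
  have hB2 : Ex P (fun w => S (X w)) / (8 * k%:R) <= 2^-1.
    by rewrite ler_pdivrMr//; lra.
  have : pr P (~` B) <= pr P (X @^-1` B0).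
    apply: pr_le; [exact: measurableC|exact: mX|].
    by move=> w /negP; rewrite -ltNge => /ltW.
  rewrite prC//; lra.
have [L hL'] : exists L : nat, forall x, A x -> forall i, `|dotr x (xs i)| / I < L%:R.
  exists (Num.truncn (\sum_i `|M| * l1norm (xs i) / I)).+1 => x Ax i.
  have /truncn_itv/andP[_] : 0 <= \sum_i `|M| * l1norm (xs i) / I.
    by apply: sumr_ge0 => j _; rewrite !mulr_ge0 ?l1norm_ge0 ?invr_ge0 ?(ltW hI).
  apply: le_lt_trans; rewrite (bigD1 i)//= ler_wpDr//.
    by apply: sumr_ge0 => j _; rewrite !mulr_ge0 ?l1norm_ge0 ?invr_ge0 ?(ltW hI).
  rewrite ler_wpM2r ?invr_ge0 ?(ltW hI)//; apply: le_trans (dotr_le_norm _ _) _.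
  by rewrite ler_wpM2r ?l1norm_ge0// (le_trans (AM _ Ax))// ler_norm.
pose J := {ffun 'I_k -> 'I_(2 * L)}.
pose cj (j : J) i : R := (j i)%:R - L%:R.
pose C (j : J) := A `&` [set x | forall i, [set y | cj j i <= dotr y (xs i) / I <= cj j i + 1] x].
have cC j : closed (C j).
  by apply: closedI => //; apply: closed_forall => i; exact: closed_slab_div.
(* Twice the midpoint of a point of [C j] and one of [B0] is within k + 8 k of the corner of the
   cell, in the l1 sense. *)
pose E (j : J) := [set x | \sum_i `|2 * (dotr x (xs i) / I) - cj j i| <= 9 * k%:R].
have cE j : closed (E j) by apply: closed_le_fun; exact: l1_affine_continuous.
have hE j : Num.sqrt (pr P (X @^-1` C j)) <= 2 * pr P (X @^-1` E j).
  have l12 : 0 < (2^-1 : R) < 1 by rewrite invr_gt0 ltr0n invf_lt1 ?ltr1n ?ltr0n.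
  have := @log_concave_closed _ _ _ _ _ _ hX hL (C j) B0 (E j) 2^-1 (cC j) cB0 (mX _ (cE j)) l12.
  have hmap x y : C j x -> B0 y -> E j ((1 - 2^-1) *: x + 2^-1 *: y).
    move=> [_ hx]; rewrite /B0 /E /= SE => hy.
    apply: (@le_trans _ _ (\sum_i (1 + `|dotr y (xs i)| / I))); last first.
      by rewrite big_split /= sumr_const card_ord -[1 *+ k]/(k%:R); lra.
    apply: ler_sum => i _; rewrite dotrDl !dotrZl.
    have -> : 2 * (((1 - 2^-1) * dotr x (xs i) + 2^-1 * dotr y (xs i)) / I) - cj j i =
      (dotr x (xs i) / I - cj j i) + dotr y (xs i) / I by field; rewrite gt_eqF.
    apply: le_trans (ler_normD _ _) _; apply: lerD.
      by have /andP[h1 h2] := hx i; rewrite ger0_norm; lra.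
    by rewrite normrM (@gtr0_norm _ I^-1) ?invr_gt0.
  move=> /(_ hmap).
  have -> : 1 - 2^-1 = 2^-1 :> R by lra.
  rewrite !powR12_sqrt ?pr_ge0//.
  have : 2^-1 <= Num.sqrt (pr P (X @^-1` B0)).
    have -> : 2^-1 = Num.sqrt (2^-1 ^+ 2) :> R by rewrite sqrtr_sqr ger0_norm// invr_ge0.
    by rewrite ler_sqrt ?pr_ge0//; apply: le_trans hB0; rewrite expr2; lra.
  have := sqrtr_ge0 (pr P (X @^-1` C j)).
  nra.
have hsum : \sum_(j : J) 1 * pr P (X @^-1` E j) <= cell_count ^+ k.
  apply: overlap_bound => [j|w]; first exact: mX.
  pose u i := 2 * (dotr (X w) (xs i) / I) + L%:R.
  (* The indicator of [E j] is at most exp(9 k - sum of distances), a product over the rows; the sum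
     over all j therefore factors into one-dimensional geometric sums. *)
  apply: (@le_trans _ _ (\sum_(j : J) expR 9 ^+ k * \prod_i expR (- `|u i - (j i)%:R|))).
    apply: ler_sum => j _; rewrite mul1r indicE; case: (boolP (w \in _)) => [|_]; last first.
      by rewrite mulr_ge0 ?exprn_ge0 ?expR_ge0// prodr_ge0// => i _; exact: expR_ge0.
    rewrite inE /E /= => hw.
    rewrite -expRM_natr -expR_sum -expRD sumrN; apply: le_trans (expR_ge1Dx _).
    rewrite lerDl subr_ge0; apply: le_trans hw.
    by rewrite le_eqVlt; apply/orP; left; apply/eqP; apply: eq_bigr => i _; congr `|_|; rewrite /u /cj; ring.
  rewrite -mulr_sumr -(bigA_distr_bigA (fun i (m : 'I_(2 * L)) => expR (- `|u i - m%:R|))).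
  rewrite /cell_count [6 * _]mulrC exprMn ler_wpM2l ?exprn_ge0 ?expR_ge0//.
  have -> : 6 ^+ k = \prod_(i < k) 6 :> R by rewrite prodr_const card_ord.
  apply: ler_prod => i _; rewrite geometric_sum_le andbT.
  by apply: sumr_ge0 => m _; exact: expR_ge0.
have hcover : a <= \sum_(j : J) pr P (X @^-1` C j).
  apply: pr_cover => [|j|w Aw]; [exact: mX|exact: mX|].
  pose v i := dotr (X w) (xs i) / I + L%:R.
  have hv i : 0 <= v i < (2 * L)%:R.
    have := hL' _ Aw i; rewrite -[X in _ * X](@gtr0_norm _ I^-1) ?invr_gt0// -normrM.
    by rewrite ltr_norml natrM /v => /andP[h1 h2]; apply/andP; split; lra.
  have hv2 i : (Num.truncn (v i) < 2 * L)%N.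
    have /andP[v0 v1] := hv i; have /truncn_itv/andP[h1 _] := v0.
    by rewrite -(ltr_nat R) (le_lt_trans h1).
  exists [ffun i => Ordinal (hv2 i)]; first exact: mem_index_enum.
  split => // i; rewrite /= /cj ffunE /=.
  have /andP[v0 _] := hv i; have /truncn_itv/andP[h1] := v0.
  by rewrite -natr1 /v in h1 * => h2; apply/andP; split; lra.
have D0 := cell_count_gt0.
(* If all cells had mass below al^2, then a <= sum of al (pr C)^(1/2) <= 2 al [cell_count]^k = a /
   2. *)
pose al := a / (4 * cell_count ^+ k).
have al0 : 0 < al by rewrite divr_gt0// mulr_gt0// exprn_gt0.
have alE : a ^+ 2 / (16 * cell_count ^+ (2 * k)) = al ^+ 2.
  by rewrite /al mulnC exprM; field; rewrite gt_eqF ?exprn_gt0.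
rewrite alE; apply: contrapT => hno.
have {}hno j : pr P (X @^-1` C j) < al ^+ 2.
  rewrite ltNge; apply/negP => h; apply: hno; exists (C j); split => //.
    by move=> x [].
  move=> x y [_ hx] [_ hy] i; have /andP[h1 h2] := hx i; have /andP[h3 h4] := hy i.
  rewrite -[X in _ * X](@gtr0_norm _ I^-1) ?invr_gt0// -normrM dotrBl mulrBl.
  by rewrite ler_norml; apply/andP; split; lra.
have : a <= \sum_(j : J) al * (2 * pr P (X @^-1` E j)).
  apply: le_trans hcover _; apply: ler_sum => j _.
  apply: (@le_trans _ _ (al * Num.sqrt (pr P (X @^-1` C j)))); last by rewrite ler_pM2l.
  rewrite -{1}(sqr_sqrtr (pr_ge0 P (X @^-1` C j))) expr2 ler_wpM2r ?sqrtr_ge0//.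
  rewrite -[leRHS](gtr0_norm al0) -sqrtr_sqr ler_sqrt ?sqr_ge0//.
  exact: ltW (hno j).
rewrite -mulr_sumr -mulr_sumr => h.
have h2 : al * (2 * \sum_(j : J) pr P (X @^-1` E j)) <= al * (2 * cell_count ^+ k).
  rewrite ler_pM2l// ler_pM2l//; apply: le_trans hsum.
  by rewrite le_eqVlt; apply/orP; left; apply/eqP; apply: eq_bigr => j _; rewrite mul1r.
have : al * (2 * cell_count ^+ k) = a / 2.
  by rewrite /al; field; rewrite gt_eqF ?exprn_gt0.
lra.
Qed.

Let PP := (P \x P)%E.

(** Inside a cell C of mass c all row factors are at least 1/e, so by [rows] its far apart pairs
    have mass at most (2 e [row_error])^k <= c^2 / 2. If each point of C had less than c / 4 of C
    near it, they would have at least 3 c^2 / 4. *)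
Lemma dense_ball (A : set 'rV[R]_n) M k : (0 < k)%N -> closed A -> A `<=` [set x | `|x| <= M] ->
  expR (- 6) ^+ k <= pr P (X @^-1` A) ->
  exists A', [/\ compact A', A' `<=` A, (forall x y, A' x -> A' y -> N (x - y) <= 2 * piece_radius * I) &
    piece_density ^+ k <= pr P (X @^-1` A')].
Proof.
move=> k0 cA AM hA.
have mX K : closed K -> measurable (X @^-1` K) by exact: measurable_preimage_closed.
have [xs [hxs hrows]] := rows hX hL hI k row_error_gt0.
set F := [set w' | _] in hrows.
have mF : measurable F.
  apply: measurable_ge; apply: (measurable_of_closed_le (random_vector_pair hX) (f := N)) => a.
  by apply: closed_le_fun; exact: norm2_continuous.
have e6 : 0 < expR (- 6) ^+ k :> R by rewrite exprn_gt0 ?expR_gt0.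
have [C [cC CA hC hpC]] := cell_mass k0 hxs cA AM (lt_le_trans e6 hA).
set c := pr P (X @^-1` C) in hpC.
have D0 := cell_count_gt0; have b0 := cell_density_gt0.
have bc : cell_density ^+ k <= c.
  apply: le_trans hpC.
  have -> : cell_density ^+ k = (expR (-6) ^+ k) ^+ 2 / (16 ^+ k * cell_count ^+ (2 * k)).
    rewrite /cell_density exprMn exprVn [cell_count ^+ (2 * k)]exprM -exprMn; congr (_ / _).
    rewrite -!expRM_natr; congr expR; ring.
  apply: ler_pM; rewrite ?exprn_ge0 ?expR_ge0 ?invr_ge0 ?mulr_ge0 ?exprn_ge0 ?(ltW D0)//.
    by rewrite ler_pXn2r ?nnegrE ?exprn_ge0 ?expR_ge0 ?pr_ge0.
  rewrite lef_pV2 ?posrE ?mulr_gt0 ?exprn_gt0// ler_wpM2r ?exprn_ge0 ?(ltW D0)//.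
  by rewrite -{1}[16]expr1 ler_weXn2l// ler1n.
have bk0 : 0 < cell_density ^+ k by rewrite exprn_gt0.
have c0 : 0 < c by exact: lt_le_trans bc.
have mC := mX _ cC; set C' := X @^-1` C in mC.
pose f (w : T * T) : R := \1_C' w.1 * (\1_C' w.2 * \1_F w).
have mf : measurable_fun [set: T * T] f.
  apply: measurable_funM; first by apply: measurableT_comp => //; exact: measurable_indic.
  apply: measurable_funM; last exact: measurable_indic.
  by apply: measurableT_comp => //; exact: measurable_indic.
have f0 w : 0 <= f w by rewrite /f !indicE !mulr_ge0.
have f1 w : f w <= 1 by rewrite /f !indicE !mulr_ile1 ?mulr_ge0 ?lern1 ?leq_b1.
have ig : intg PP (fun w => \1_F w * \prod_i rowfactor P X (xs i) w).
  apply: (@intg_bounded _ _ _ _ _ 1).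
    apply: measurable_funM; first exact: measurable_indic.
    by apply: measurable_prod => i _; exact: measurable_rowfactor.
  move=> w; have fac01 : 0 <= \prod_i rowfactor P X (xs i) w <= 1.
    elim/big_ind: _ => [|y z /andP[y0 y1] /andP[z0 z1]|i _].
    - by rewrite ler01 lexx.
    - by rewrite mulr_ge0// mulr_ile1.
    - by rewrite expR_ge0 expdot_le1.
  have /andP[h h'] := fac01.
  by rewrite ger0_norm ?mulr_ge0// ?mulr_ile1// indicE; case: (_ \in _).
have Ef : Ex PP f <= c ^+ 2 / 2.
  apply: (@le_trans _ _ (expR 1 ^+ k * (2 * row_error) ^+ k)); last first.
    rewrite -exprMn (_ : expR 1 * _ = cell_density ^+ 2 * 2^-1); last first.
      by rewrite /row_error; field; rewrite gt_eqF ?expR_gt0.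
    rewrite exprMn exprAC; apply: ler_pM; rewrite ?exprn_ge0 ?invr_ge0 ?(ltW b0)//.
      by rewrite ler_pXn2r ?nnegrE ?(ltW bk0) ?(ltW c0).
    by rewrite -[leRHS]expr1 ler_wiXn2l//; lra.
  apply: le_trans (ler_wpM2l _ hrows); last by rewrite exprn_ge0 ?expR_ge0.
  rewrite -ExZ; last exact: ig.
  apply: Ex_le.
  - by apply: (@intg_bounded _ _ _ _ _ 1) => // w; rewrite ger0_norm.
  - exact: intgZ.
  - move=> w; have fac0 : 0 <= \prod_i rowfactor P X (xs i) w.
      by apply: prodr_ge0 => i _; exact: expR_ge0.
    rewrite /f !indicE; case: (boolP (w.1 \in C')) => w1; last by rewrite mul0r !mulr_ge0 ?exprn_ge0 ?expR_ge0.
    case: (boolP (w.2 \in C')) => w2; last by rewrite mul0r mulr0 !mulr_ge0 ?exprn_ge0 ?expR_ge0.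
    case: (boolP (w \in F)) => wF; last by rewrite !mulr0 mul0r mulr0.
    have -> : expR 1 ^+ k = \prod_(i < k) expR 1 :> R by rewrite prodr_const card_ord.
    rewrite !mul1r -big_split /=.
    rewrite inE in w1; rewrite inE in w2.
    elim/big_ind: _ => [//|y z y1 z1|i _]; first by rewrite -[1]mulr1 ler_pM.
    rewrite /rowfactor -expRD; apply: le_trans (expR_ge1Dx _).
    by rewrite lerDl subr_ge0; exact: hC.
have := Ef; rewrite (Ex_prodE P P mf f0 f1) => Ef2.
have [w Cw hw] : exists2 w, C' w & c / 4 <= pr P (X @^-1` (C `&` [set x | N (X w - x) <= piece_radius * I])).
  apply: contrapT => hno.
  have cS w : closed (C `&` [set x | N (X w - x) <= piece_radius * I]).
    apply: closedI => //; apply: closed_le_fun.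
    have [c' c'0 hc'] := norm2_bound hX hL.
    apply: (lipschitz_continuous (c := c')) => y z.
    apply: le_trans (norm2_dist hX hL _ _) _.
    by rewrite opprB addrC addrA subrK -(norm2N hX hL) opprB.
  have : 3 / 4 * c * c <= Ex P (fun v => Ex P (fun v' => f (v, v'))).
    rewrite -[X in _ * X](Ex_indic P mC) -ExZ; last exact: intg_indic.
    apply: Ex_le; [by apply: intgZ; exact: intg_indic|exact: (intg_Ex_prod1 P P mf f0 f1)|].
    move=> w; rewrite indicE; case: (boolP (w \in C')) => [|_]; last first.
      by rewrite mulr0; apply: Ex_ge0 => v'.
    rewrite inE => Cw.
    set S := C `&` [set x | N (X w - x) <= piece_radius * I].
    have mS : measurable (X @^-1` S) := mX _ (cS w).
    have iS := intg_indic P mS; have iC := intg_indic P mC.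
    have hS : pr P (X @^-1` S) < c / 4.
      by rewrite ltNge; apply/negP => h; apply: hno; exists w.
    apply: (@le_trans _ _ (Ex P (fun v => \1_C' v + (-1) * \1_(X @^-1` S) v))).
      rewrite ExD//; last exact: intgZ.
      by move: hS; rewrite (ExZ _ iS) (Ex_indic P mC) (Ex_indic P mS) -/c /= mulr1; lra.
    apply: Ex_le; [|exact: (intg_prod1 P mf f0 f1)|].
      by apply: intgD => //; exact: intgZ.
    have wC : w \in C' by apply/mem_set.
    move=> y; rewrite /f !indicE /= wC mul1r.
    case: (boolP (y \in C')) => yC; last by rewrite mul0r mulN1r subr_le0.
    rewrite mul1r mulN1r; case: (boolP (y \in X @^-1` S)) => yS; first by rewrite subrr.
    rewrite mem_set ?subr0//; move: yS; rewrite notin_setE /S /= => yS.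
    rewrite /F /pairX /=; case: (leP (piece_radius * I) (N (X w - X y))) => // /ltW h.
    by exfalso; apply: yS; split => //; rewrite inE in yC.
  have : 0 < c ^+ 2 by rewrite exprn_gt0.
  rewrite expr2; lra.
exists (C `&` [set x | N (X w - x) <= piece_radius * I]); split.
- apply: (@compact_in_ball _ _ _ M) => [|x [/CA /AM]//].
  apply: closedI => //; apply: closed_le_fun.
  have [c' c'0 hc'] := norm2_bound hX hL.
  apply: (lipschitz_continuous (c := c')) => y z.
  apply: le_trans (norm2_dist hX hL _ _) _.
  by rewrite opprB addrC addrA subrK -(norm2N hX hL) opprB.
- by move=> x [/CA].
- move=> x y [_ /= hx] [_ /= hy].
  have -> : x - y = (X w - y) - (X w - x) by apply/rowP => i; rewrite !mxE; ring.
  by apply: le_trans (norm2_triangleB hX hL _ _) _; lra.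
- apply: le_trans hw; rewrite /piece_density exprMn exprVn.
  apply: ler_pM; rewrite ?exprn_ge0 ?invr_ge0 ?exprn_ge0 ?(ltW b0)//.
  by rewrite lef_pV2 ?posrE ?exprn_gt0// -{1}[4]expr1 ler_weXn2l// ler1n.
Qed.

End Cells.

(** * Approximating points of the centroid body by differences of samples *)

Section Approximation.
Context (d : measure_display) (T : measurableType d) (R : realType).
Variables (P : probability T R) (n : nat) (X : T -> 'rV[R]_n).
Hypotheses (hX : random_vector X) (hL : log_concave P X) (hC : centered P X).
Implicit Types (th x y z g : 'rV[R]_n) (t s b p q eps : R).

Local Notation N := (Lp_norm P X 2).
Local Notation I := (Ex P (fun w => N (X w))).
Hypotheses (hI : 0 < I) (hN : forall z, z != 0 -> 0 < N z).

Definition half_mass : R := (256 * expR 20)^-1.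
(** Chosen so that the k-th power is below both masses that occur, [piece_density]^(2 k) and
    [half_mass] / 2. The radius adds the diameter of a dense piece to two balls of radius 4 /
    [half_mass] around the origin. *)
Definition pair_density : R := piece_density R ^+ 2 * half_mass / 4.
Definition pair_radius : R := 2 * piece_radius R + 8 / half_mass.

Lemma half_mass_gt0 : 0 < half_mass.
Proof. by rewrite invr_gt0 mulr_gt0 ?expR_gt0. Qed.

Lemma half_mass_le1 : half_mass <= 1.
Proof.
rewrite invf_le1 ?mulr_gt0 ?expR_gt0//.
by have := expR_ge1Dx (20 : R); lra.
Qed.

Lemma pair_density_gt0 : 0 < pair_density.
Proof.
have k0 := piece_density_gt0 R; have c0 := half_mass_gt0.
by apply: divr_gt0 => //; apply: mulr_gt0 => //; exact: exprn_gt0.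
Qed.

Lemma pair_density_le : pair_density <= 4^-1.
Proof.
rewrite /pair_density; have := piece_density_le R; have := piece_density_gt0 R; have := half_mass_gt0; have := half_mass_le1.
move=> h1 h2 h3 h4; rewrite ler_pdivrMr// mulVf//.
apply: mulr_ile1 => //; rewrite ?exprn_ge0 ?(ltW h2) ?(ltW h3)//.
by rewrite exprn_ile1 ?(ltW h3)//; lra.
Qed.

Lemma pair_radius_gt0 : 0 < pair_radius.
Proof. have l0 := piece_radius_gt0 R; have c0 := half_mass_gt0.
by apply: addr_gt0; [exact: mulr_gt0|exact: divr_gt0]. Qed.

Lemma pr_gt0_nonempty (A : set 'rV[R]_n) : 0 < pr P (X @^-1` A) -> A !=set0.
Proof.
move=> h; apply: contrapT => /nonemptyPn A0; move: h.
by rewrite A0 preimage_set0 pr_set0 ltxx.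
Qed.

Lemma halfspace_mass0 g : half_mass <= pr P (X @^-1` [set x | 0 <= dotr x g]).
Proof.
have [->|g0] := eqVneq g 0; last by apply: halfspace_mass => //; exact: hN.
rewrite (_ : mkset _ = setT); first by rewrite preimage_setT prT half_mass_le1.
by apply/seteqP; split => x //= _; rewrite dotr0r.
Qed.

(** Of the half-space, Markov removes a quarter of [half_mass] and truncation another. The radius M
    does not depend on g. *)
Lemma origin_set : exists2 M : R, 0 < M & forall g, exists B,
  [/\ compact B, B `<=` [set x | `|x| <= M],
    (forall x, B x -> N x <= 4 / half_mass * I), (forall x, B x -> 0 <= dotr x g)
    & half_mass / 2 <= pr P (X @^-1` B)].
Proof.
have c0 := half_mass_gt0; have c04 : 0 < half_mass / 4 by rewrite divr_gt0.
have [M M0 hM] := exists_trunc P hX c04.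
exists M => // g.
pose A := [set x | 0 <= dotr x g] `&` [set x : 'rV[R]_n | N x <= 4 / half_mass * I].
have cN : closed [set x : 'rV[R]_n | N x <= 4 / half_mass * I].
  by apply: closed_le_fun; exact: norm2_continuous.
have cH : closed [set x | 0 <= dotr x g].
  by apply: closed_ge_fun; exact: dotr_continuous.
have cA : closed A by exact: closedI.
exists (A `&` [set x | `|x| <= M]); split.
- apply: (@compact_in_ball _ _ _ M) => [|x []//].
  by apply: closedI => //; exact: closed_ball_norm.
- by move=> x [].
- by move=> x [[]].
- by move=> x [[]].
apply: le_trans (hM _ cA).
have mX K : closed K -> measurable (X @^-1` K) by exact: measurable_preimage_closed.
have := prI_ge P (mX _ cH) (mX _ cN); rewrite -preimage_setI -/A.
have := halfspace_mass0 g.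
have t0 : 0 < 4 / half_mass * I by rewrite mulr_gt0// divr_gt0.
have := pr_markov (intg_norm2 hX hL) (fun w => Lp_norm_ge0 P X 2 (X w)) t0.
have -> : I / (4 / half_mass * I) = half_mass / 4 by field; rewrite !gt_eqF.
move=> hm.
set F := [set w | _] in hm.
have mF : measurable F by apply: measurable_ge; exact: measurable_norm2.
have : pr P (~` F) <= pr P (X @^-1` [set x : 'rV[R]_n | N x <= 4 / half_mass * I]).
  apply: pr_le; [exact: measurableC|exact: mX|].
  by move=> w /negP; rewrite -ltNge => /ltW.
rewrite prC//; lra.
Qed.

(** The choice of a sign halves the mass e^(-5 k) and truncation takes half of the rest. What
    remains is at least e^(-12 k), the mass that [dense_ball] asks for with 2 k rows. M is uniform
    in the direction and the level. *)
Lemma dense_halfspace k : (0 < k)%N -> exists2 M : R, 0 < M & forall th t,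
  expR (- 5) ^+ k < pr P (tail X th t) -> exists A',
  [/\ compact A', A' `<=` [set x | `|x| <= M],
    (forall x y, A' x -> A' y -> N (x - y) <= 2 * piece_radius R * I),
    (forall x, A' x -> t <= dotr x th) \/ (forall x, A' x -> t <= dotr x (- th))
    & piece_density R ^+ (2 * k) <= pr P (X @^-1` A')].
Proof.
move=> k0; set a := expR (- 5) ^+ k.
have a0 : 0 < a by rewrite exprn_gt0 ?expR_gt0.
have a04 : 0 < a / 4 by rewrite divr_gt0.
have [M M0 hM] := exists_trunc P hX a04.
exists M => // th t ht.
have cH y : closed [set x | t <= dotr x y].
  by apply: closed_ge_fun; exact: dotr_continuous.
have mX K : closed K -> measurable (X @^-1` K) by exact: measurable_preimage_closed.
have hcase y : a / 2 <= pr P (X @^-1` [set x | t <= dotr x y]) -> exists A',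
    [/\ compact A', A' `<=` [set x | `|x| <= M],
    (forall x y, A' x -> A' y -> N (x - y) <= 2 * piece_radius R * I),
    (forall x, A' x -> t <= dotr x y)
    & piece_density R ^+ (2 * k) <= pr P (X @^-1` A')].
  move=> hy.
  have k20 : (0 < 2 * k)%N by rewrite muln_gt0.
  pose A := [set x | t <= dotr x y] `&` [set x : 'rV[R]_n | `|x| <= M].
  have cA : closed A by apply: closedI => //; exact: closed_ball_norm.
  have AM : A `<=` [set x | `|x| <= M] by move=> x [].
  have hA : expR (-6) ^+ (2 * k) <= pr P (X @^-1` A).
    apply: le_trans (hM _ (cH y)).
    apply: (@le_trans _ _ (a / 4)); last by move: hy; lra.
    have -> : expR (-6) ^+ (2 * k) = a * expR (-7) ^+ k :> R.
      rewrite exprM /a -exprMn; congr (_ ^+ k).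
      by rewrite expr2 -!expRD; congr expR; lra.
    rewrite ler_pM2l//; apply: (@le_trans _ _ (expR (-7))).
      by rewrite -[leRHS]expr1 ler_wiXn2l ?expR_ge0// expR_le1; lra.
    rewrite expRN lef_pV2 ?posrE ?expR_gt0//.
    by have := expR_ge1Dx (7 : R); lra.
  have [A' [h1 h2 h3 h4]] := dense_ball hX hL hI k20 cA AM hA.
  exists A'; split => //; first by move=> x /h2 [].
  by move=> x /h2 [].
have : pr P (tail X th t) <= pr P (X @^-1` [set x | t <= dotr x th]) +
    pr P (X @^-1` [set x | t <= dotr x (- th)]).
  apply: le_trans (prU P (mX _ (cH _)) (mX _ (cH _))).
  apply: pr_le; [exact: measurable_tail|by apply: measurableU; exact: mX|].
  move=> w; rewrite /tail /= dotrNr => h.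
  have [h1|h1] := leP 0 (dotr (X w) th); [left|right].
    by rewrite -(ger0_norm h1).
  by rewrite -(ltr0_norm h1).
move=> h.
have [h1|h1] := leP (a / 2) (pr P (X @^-1` [set x | t <= dotr x th])).
  have [A' [? ? ? ? ?]] := hcase _ h1.
  by exists A'; split => //; left.
have [|A' [? ? ? ? ?]] := hcase (- th); first by lra.
by exists A'; split => //; right.
Qed.

(** The level t is kept apart from [dotr z g]: the pairs (z, t) then form a convex set, on which
    Frank-Wolfe runs in n + 1 dimensions. *)
Definition approx g m (z : 'rV[R]_n) t := exists B B',
  [/\ compact B, compact B', m <= pr P (X @^-1` B), m <= pr P (X @^-1` B') &
    forall x y, B x -> B' y -> N (x - y - z) <= pair_radius * I /\ t <= dotr (x - y) g].

Lemma approxN g m z t : approx g m z t -> approx (- g) m (- z) t.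
Proof.
move=> [B [B' [cB cB' hB hB' h]]]; exists B', B; split => // x y Bx By.
have [h1 h2] := h y x By Bx; split.
  rewrite -(norm2N hX hL) (_ : - _ = y - x - z)//.
  by apply/rowP => i; rewrite !mxE; ring.
by rewrite dotrNr -dotrNl opprB.
Qed.

(** Log-concavity of sets that both have mass at least m loses nothing, so any number of averages is
    allowed. *)
Lemma approx_convex g m z t z' t' l : 0 < m -> 0 < l < 1 ->
  approx g m z t -> approx g m z' t' ->
  approx g m ((1 - l) *: z + l *: z') ((1 - l) * t + l * t').
Proof.
move=> m0 l01 [B [B' [cB cB' hB hB' h]]] [D [D' [cD cD' hD hD' h']]].
have /andP[l0 l1] := l01; have l1' : 0 < 1 - l by rewrite subr_gt0.
have mean A E : compact A -> compact E -> m <= pr P (X @^-1` A) -> m <= pr P (X @^-1` E) ->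
    m <= pr P (X @^-1` [set (1 - l) *: a + l *: b | a in A & b in E]).
  move=> cA cE hA hE; apply: le_trans (log_concave_compact hX hL cA cE l01 _ _); last 2 first.
    exact: pr_gt0_nonempty (lt_le_trans m0 hA).
    exact: pr_gt0_nonempty (lt_le_trans m0 hE).
  have -> : m = m `^ (1 - l) * m `^ l.
    by rewrite -powRD ?subrK ?powRr1 ?(ltW m0)//; apply/implyP => _; rewrite gt_eqF.
  by apply: ler_pM; rewrite ?powR_ge0// ge0_ler_powR ?nnegrE ?pr_ge0 ?(ltW m0) ?(ltW l0) ?(ltW l1').
exists [set (1 - l) *: a + l *: b | a in B & b in D].
exists [set (1 - l) *: a + l *: b | a in B' & b in D'].
split; [exact: compact_mean|exact: compact_mean|exact: mean|exact: mean|].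
move=> _ _ [x Bx [y Dy <-]] [x' Bx' [y' Dy' <-]].
have [h1 h2] := h _ _ Bx Bx'; have [h3 h4] := h' _ _ Dy Dy'.
split.
  have -> : (1 - l) *: x + l *: y - ((1 - l) *: x' + l *: y') - ((1 - l) *: z + l *: z') =
    (1 - l) *: (x - x' - z) + l *: (y - y' - z') by apply/rowP => i; rewrite !mxE; ring.
  apply: le_trans (norm2_triangle hX hL _ _) _; rewrite !(norm2Z hX hL) !gtr0_norm//.
  have := ler_wpM2l (ltW l1') h1; have := ler_wpM2l (ltW l0) h3; lra.
have -> : (1 - l) *: x + l *: y - ((1 - l) *: x' + l *: y') =
    (1 - l) *: (x - x') + l *: (y - y') by apply/rowP => i; rewrite !mxE; ring.
rewrite dotrDl !dotrZl.
have := ler_wpM2l (ltW l1') h2; have := ler_wpM2l (ltW l0) h4; lra.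
Qed.


(** The second set is an [origin_set] for - g, so subtracting its points cannot lower the product
    with g. With y the minimizer of that product on A, the level reached is exactly [dotr y g]. *)
Lemma approx_halfspace k (A : set 'rV[R]_n) g : (0 < k)%N -> compact A ->
  (forall x y, A x -> A y -> N (x - y) <= 2 * piece_radius R * I) ->
  piece_density R ^+ (2 * k) <= pr P (X @^-1` A) ->
  exists2 y, A y & approx g (pair_density ^+ k) y (dotr y g).
Proof.
move=> k0 cA hA hm.
have kp := piece_density_gt0 R; have c0 := half_mass_gt0; have c11 := half_mass_le1.
have k1 : pair_density ^+ k <= piece_density R ^+ (2 * k).
  rewrite exprM ler_pXn2r ?nnegrE ?exprn_ge0 ?(ltW kp) ?(ltW pair_density_gt0)//.
  rewrite /pair_density -mulrA ger_pMr ?exprn_gt0//; lra.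
have k2 : pair_density ^+ k <= half_mass / 2.
  apply: (@le_trans _ _ pair_density).
    rewrite -[leRHS]expr1 ler_wiXn2l ?(ltW pair_density_gt0)//; have := pair_density_le; lra.
  have : piece_density R ^+ 2 <= 1 by rewrite exprn_ile1 ?(ltW kp)//; have := piece_density_le R; lra.
  rewrite /pair_density => h; have := ler_wpM2r (ltW c0) h; lra.
have A0 : A !=set0 by apply: pr_gt0_nonempty; exact: lt_le_trans (exprn_gt0 _ kp) hm.
have cg : {within A, continuous (fun x => dotr x g)}.
  by apply: continuous_subspaceT; exact: dotr_continuous.
have [y] := EVT_min_rV A0 cA cg.
rewrite inE => Ay hy; exists y => //.
have [M M0 hM] := origin_set; have [B' [cB' _ hN' hg hB']] := hM (- g).
exists A, B'; split => //; [exact: le_trans hm|exact: le_trans hB'|].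
move=> x x' Ax Bx'; split.
  have -> : x - x' - y = (x - y) - x' by rewrite addrAC.
  apply: le_trans (norm2_triangleB hX hL _ _) _.
  have := hA _ _ Ax Ay; have := hN' _ Bx'; rewrite /pair_radius.
  have : 0 <= 4 / half_mass * I by rewrite mulr_ge0 ?divr_ge0 ?(ltW c0) ?(ltW hI).
  have -> : 8 / half_mass = 4 / half_mass + 4 / half_mass by ring.
  rewrite mulrDl mulrDl; lra.
have := hg _ Bx'; have := hy x; rewrite mem_set// => /(_ isT).
by rewrite dotrBl dotrNr; lra.
Qed.

Lemma approx0 k g : (0 < k)%N -> approx g (pair_density ^+ k) 0 0.
Proof.
move=> k0; have kp := piece_density_gt0 R; have c0 := half_mass_gt0; have c11 := half_mass_le1.
have k2 : pair_density ^+ k <= half_mass / 2.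
  apply: (@le_trans _ _ pair_density).
    rewrite -[leRHS]expr1 ler_wiXn2l ?(ltW pair_density_gt0)//; have := pair_density_le; lra.
  have : piece_density R ^+ 2 <= 1 by rewrite exprn_ile1 ?(ltW kp)//; have := piece_density_le R; lra.
  rewrite /pair_density => h; have := ler_wpM2r (ltW c0) h; lra.
have [M M0 hM] := origin_set.
have [B [cB _ hNB hg hB]] := hM g; have [B' [cB' _ hN' hg' hB']] := hM (- g).
exists B, B'; split => //; [exact: le_trans hB|exact: le_trans hB'|].
move=> x x' Bx Bx'; split.
  rewrite subr0; apply: le_trans (norm2_triangleB hX hL _ _) _.
  have := hNB _ Bx; have := hN' _ Bx'; rewrite /pair_radius.
  have : 0 <= 2 * piece_radius R * I by apply: mulr_ge0; [apply: mulr_ge0 => //; exact: ltW (piece_radius_gt0 R)|exact: ltW].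
  have -> : 8 / half_mass = 4 / half_mass + 4 / half_mass by ring.
  rewrite mulrDl mulrDl; lra.
by have := hg _ Bx; have := hg' _ Bx'; rewrite dotrBl dotrNr; lra.
Qed.

(* The minimizer [y] of <., g> on a dense piece of the half-space {<., th + s g> >= <z, th + s g>}
   serves both signs of [s]. *)
Lemma approx_direction p k z g : (0 < k)%N -> 1 <= p -> p <= k%:R ->
  (forall th, dotr z th <= Lp_norm P X p th / 4) ->
  exists b, forall th s, exists y t, [/\ approx g (pair_density ^+ k) y t,
    0 <= dotr (y - z) th + s * (t - dotr z g) &
    dotr (y - z) (y - z) + (t - dotr z g) ^+ 2 <= b].
Proof.
move=> k0 p1 pk hz; have [M M0 hM] := dense_halfspace k0.
pose b1 := \sum_(i < n) (M + `|z|) ^+ 2; pose b2 := (M * l1norm g + `|z| * l1norm g) ^+ 2.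
have hb y : `|y| <= M -> dotr (y - z) (y - z) + (dotr y g - dotr z g) ^+ 2 <= b1 + b2.
  move=> yM; apply: lerD.
    apply: ler_sum => i _; rewrite -expr2 -(real_normK (num_real _)).
    rewrite ler_pXn2r ?nnegrE ?addr_ge0 ?(ltW M0)//.
    apply: le_trans (le_coord_norm _ _) _; apply: le_trans (ler_normB _ _) _.
    by rewrite lerD2r.
  have nn : 0 <= M * l1norm g + `|z| * l1norm g.
    by rewrite addr_ge0 ?mulr_ge0 ?l1norm_ge0 ?(ltW M0).
  rewrite -(real_normK (num_real _)) ler_pXn2r ?nnegrE//.
  apply: le_trans (ler_normB _ _) _; apply: lerD; last exact: dotr_le_norm.
  by apply: le_trans (dotr_le_norm _ _) _; rewrite ler_wpM2r ?l1norm_ge0.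
exists (b1 + b2) => th s.
have vE y : dotr (y - z) th + s * (dotr y g - dotr z g) = dotr y (th + s *: g) - dotr z (th + s *: g).
  by rewrite !dotrDr !dotrZr dotrBl; ring.
(* Here the required level is not positive and the tail estimate says nothing, but the origin is
   already far enough in this direction. *)
have [h0|h0] := leP (dotr z (th + s *: g)) 0.
  exists 0, 0; have := hb 0; have := vE 0; rewrite !dotr0l normr0 => -> hb0; split.
  - exact: approx0.
  - by rewrite subr_ge0.
  - exact: hb0 (ltW M0).
have [] := hM (th + s *: g) (dotr z (th + s *: g)).
  apply: (@le_lt_trans _ _ (expR (- (5 * p)))).
    rewrite -expRM_natr ler_expR mulNr lerN2; lra.
  apply: (tail_gt hX hL p1 h0); have := hz (th + s *: g); lra.
move=> A [cA AM hA [hp|hp] hm].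
  have [y Ay hy] := approx_halfspace g k0 cA hA hm.
  exists y, (dotr y g); split => //; last exact: hb (AM _ Ay).
  by rewrite vE subr_ge0; exact: hp.
(* The dense piece lies in the opposite half-space. Treating it with - g and exchanging the two sets
   gives - y for g. *)
have [y Ay /approxN] := approx_halfspace (- g) k0 cA hA hm.
rewrite opprK dotrNr -dotrNl => hy.
exists (- y), (dotr (- y) g); split => //.
  by rewrite vE subr_ge0 dotrNl -dotrNr; exact: hp.
by apply: hb; rewrite normrN; exact: AM.
Qed.

(* Frank-Wolfe iteration: averaging the points returned by a linear-optimization oracle, queried at
   the current error, decreases the squared error like 1/m. *)
Lemma frank_wolfe (K : 'rV[R]_n -> R -> Prop) z c b e :
  (forall z t z' t' l, 0 < l < 1 -> K z t -> K z' t' ->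
    K ((1 - l) *: z + l *: z') ((1 - l) * t + l * t')) ->
  (forall th s, exists y t, [/\ K y t, 0 <= dotr (y - z) th + s * (t - c) &
    dotr (y - z) (y - z) + (t - c) ^+ 2 <= b]) -> 0 < e ->
  exists y t, K y t /\ dotr (y - z) (y - z) + (t - c) ^+ 2 <= e.
Proof.
move=> hK hd e0.
have step m : exists y t, K y t /\ m.+1%:R * (dotr (y - z) (y - z) + (t - c) ^+ 2) <= b.
  elim: m => [|m [y [t [Ky hy]]]].
    by have [y [t [Ky _ hy]]] := hd 0 0; exists y, t; rewrite mul1r.
  (* The query at minus the error makes the cross term nonpositive. With weight 1 / (m + 2) the
     iterates are plain averages, and (number of points) * (squared error) stays below b. *)
  have [y' [t' [Ky' hd' hy']]] := hd (- (y - z)) (- (t - c)).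
  pose l : R := m.+2%:R^-1.
  have l01 : 0 < l < 1 by rewrite invr_gt0 ltr0n invf_lt1 ?ltr0n// ltr1n.
  exists ((1 - l) *: y + l *: y'), ((1 - l) * t + l * t'); split; first exact: hK.
  have m20 : 0 < m.+2%:R :> R by rewrite ltr0n.
  have lE : l * m.+2%:R = 1 by rewrite mulVf// gt_eqF.
  have lE' : l * (m.+1%:R + 1) = 1 by rewrite natr1.
  have zE a : a = l * (m.+1%:R * a + a) by rewrite -[X in _ + X]mul1r -mulrDl mulrA lE' mul1r.
  have l1E : 1 - l = m.+1%:R * l by lra.
  have -> : (1 - l) *: y + l *: y' - z = l *: (m.+1%:R *: (y - z) + (y' - z)).
    rewrite l1E; apply/rowP => i; rewrite !mxE {1}(zE (z ord0 i)); ring.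
  have -> : (1 - l) * t + l * t' - c = l * (m.+1%:R * (t - c) + (t' - c)).
    by rewrite l1E {1}(zE c); ring.
  rewrite dotrNr in hd'; move: hd' hy hy'; move: (y - z) (y' - z) => v v' hd' hy hy'.
  rewrite !(dotrZl, dotrZr, dotrDl, dotrDr) (dotrC v v').
  set A := dotr v v in hy *; set B := dotr v' v in hd' *; set D := dotr v' v' in hy' *.
  rewrite (_ : _ * _ = l * (l * m.+2%:R) * (m.+1%:R * (m.+1%:R * (A + (t - c) ^+ 2)) +
    2 * m.+1%:R * (B + (t - c) * (t' - c)) + (D + (t' - c) ^+ 2))); last by ring.
  rewrite lE mulr1 ler_pdivrMl// -[in leRHS](natr1 m.+1) mulrDl mul1r.
  have m1 : 0 <= m.+1%:R :> R by [].
  have := ler_wpM2l m1 hy.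
  have : 2 * m.+1%:R * (B + (t - c) * (t' - c)) <= 0 by rewrite mulr_ge0_le0 ?mulr_ge0//; lra.
  lra.
have [y [t [Ky hy]]] := step (Num.truncn (b / e)).
exists y, t; split => //.
have [b0|b0] := leP 0 b.
  have /truncn_itv/andP[_] : 0 <= b / e by rewrite divr_ge0// ltW.
  rewrite ltr_pdivrMr// => h; have := le_lt_trans hy h.
  by rewrite ltr_pM2l ?ltr0n// => /ltW.
rewrite leNgt; apply/negP => h; have : 0 < (Num.truncn (b / e)).+1%:R * (dotr (y - z) (y - z) + (t - c) ^+ 2).
  by rewrite mulr_gt0 ?ltr0n// (lt_trans e0).
lra.
Qed.

(** Frank-Wolfe is stopped at an error e: e <= I / c makes it cost at most I in the norm N, and e <=
    eps at most eps in the product with g. *)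
Lemma key_pair p k z g eps : (0 < k)%N -> 1 <= p -> p <= k%:R ->
  (forall th, dotr z th <= Lp_norm P X p th / 4) -> 0 < eps ->
  exists B B', [/\ compact B, compact B', pair_density ^+ k <= pr P (X @^-1` B),
    pair_density ^+ k <= pr P (X @^-1` B') & forall x y, B x -> B' y ->
    N (x - y - z) <= (pair_radius + 1) * I /\ - eps <= dotr (x - y - z) g].
Proof.
move=> k0 p1 pk hz eps0.
have [c c0 hc] := norm2_bound hX hL.
pose e := Num.min (I / c) eps.
have e0 : 0 < e by rewrite lt_min eps0 divr_gt0.
have [b hb] := approx_direction g k0 p1 pk hz.
have m0 : 0 < pair_density ^+ k by rewrite exprn_gt0 ?pair_density_gt0.
have [||y [t [[B [B' [cB cB' hB hB' h]]] hy]]] := @frank_wolfe (approx g (pair_density ^+ k)) z (dotr z g) b (e ^+ 2) _ hb.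
- by move=> *; exact: approx_convex.
- by rewrite exprn_gt0.
have sq a : a ^+ 2 <= e ^+ 2 -> `|a| <= e.
  by rewrite -(real_normK (num_real a)) ler_pXn2r ?nnegrE ?(ltW e0).
have D0 : 0 <= dotr (y - z) (y - z) by apply: sumr_ge0 => i _; rewrite -expr2 sqr_ge0.
have hyz : `|y - z| <= e.
  apply: norm_le_coord => [|i]; first exact: ltW.
  apply: sq; apply: le_trans hy; apply: (@le_trans _ _ (dotr (y - z) (y - z))); last first.
    by rewrite lerDl sqr_ge0.
  rewrite /dotr (bigD1 i)//= -expr2 lerDl.
  by apply: sumr_ge0 => j _; rewrite -expr2 sqr_ge0.
have /sq : (t - dotr z g) ^+ 2 <= e ^+ 2 by apply: le_trans hy; rewrite lerDr.
rewrite ler_norml => /andP[h1 _].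
have he : e <= eps by rewrite ge_min lexx orbT.
exists B, B'; split => // x x' Bx Bx'; have [h2 h3] := h _ _ Bx Bx'; split.
  have -> : x - x' - z = (x - x' - y) + (y - z) by rewrite addrA subrK.
  apply: le_trans (norm2_triangle hX hL _ _) _; rewrite mulrDl mul1r; apply: lerD => //.
  apply: le_trans (hc _) _; apply: (@le_trans _ _ (c * e)); first by rewrite ler_pM2l.
  by rewrite mulrC -ler_pdivlMr// ge_min lexx.
rewrite dotrBl; lra.
Qed.

End Approximation.

(** * Counting separated points *)

Section Counting.
Context (d : measure_display) (T : measurableType d) (R : realType).
Variables (P : probability T R).

(** The mean number of sets that contain a random sample is at least m times the length of the list;
    the maximal count is at least the mean. *)
Lemma pigeonhole (J : eqType) (s : seq J) (E : J -> set T) m :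
  (forall i, measurable (E i)) -> (forall i, i \in s -> m <= pr P (E i)) ->
  exists w, m * (size s)%:R <= (size [seq i <- s | `[< E i w >]])%:R.
Proof.
move=> mE hE; pose c w := size [seq i <- s | `[< E i w >]].
have [w0 _] : exists w : T, True.
  apply: contrapT => h; have := prT P; rewrite (_ : setT = set0) ?pr_set0.
    by move/esym/eqP; rewrite oner_eq0.
  by apply/seteqP; split => // w _; apply: h; exists w.
have ex : exists j, `[< exists w, c w = j >] by exists (c w0); apply/asboolP; exists w0.
have ub j : `[< exists w, c w = j >] -> (j <= size s)%N.
  by move=> /asboolP [w <-]; rewrite /c size_filter count_size.
have [_ /asboolP [w <-] hw] := ex_maxnP ex ub; exists w.
have := @overlap_bound _ _ _ P J s (fun i => i \in s) (fun=> 1) E (c w)%:R mE.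
move=> h; apply: le_trans (h _).
  have -> : m * (size s)%:R = \sum_(i <- s) m.
    by rewrite big_const_seq count_predT iter_addr_0 mulr_natr.
  by rewrite big_seq; apply: ler_sum => i /hE; rewrite mul1r.
move=> v; rewrite -big_seq; apply: (@le_trans _ _ (c v)%:R); last first.
  by rewrite ler_nat; apply: hw; apply/asboolP; exists v.
rewrite /c; elim: (s) => [|i s' IH]; first by rewrite big_nil.
rewrite big_cons /= mul1r indicE.
case: ifP => [/asboolP h'|/asboolP h'].
  by rewrite (mem_set h') /= -[leRHS]natr1 addrC lerD2r.
by rewrite memNset// add0r.
Qed.

End Counting.

(** * The common walk, the mixed step and the resulting count *)

Section Walk.
Context (d : measure_display) (T : measurableType d) (R : realType).
Variables (P : probability T R) (n : nat) (X : T -> 'rV[R]_n).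
Hypotheses (hX : random_vector X) (hL : log_concave P X) (hC : centered P X).
Implicit Types (th x y z g : 'rV[R]_n) (t s b p q eps : R).

Local Notation N := (Lp_norm P X 2).
Local Notation I := (Ex P (fun w => N (X w))).
Hypotheses (hI : 0 < I) (hN : forall z, z != 0 -> 0 < N z).

Local Notation kp := (pair_density R).
Local Notation rho := ((pair_radius R + 1) * I).

Let rho0 : 0 < rho.
Proof. by rewrite mulr_gt0// addr_gt0// pair_radius_gt0. Qed.

(** Two successive pigeonholes, the second among the survivors of the first: one common pair (x, x')
    keeps a proportion m^2 of the list. *)
Lemma select_pair (J : eqType) (s : seq J) (B B' : J -> set 'rV[R]_n) m : 0 <= m ->
  (forall i, compact (B i)) -> (forall i, compact (B' i)) ->
  (forall i, i \in s -> m <= pr P (X @^-1` B i)) ->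
  (forall i, i \in s -> m <= pr P (X @^-1` B' i)) ->
  exists x x' (s' : seq J), [/\ subseq s' s, m ^+ 2 * (size s)%:R <= (size s')%:R &
    forall i, i \in s' -> B i x /\ B' i x'].
Proof.
move=> m0 cB cB' hB hB'.
have mX K : compact K -> measurable (X @^-1` K).
  move=> cK; apply: measurable_preimage_closed => //.
  by apply: compact_closed => //; exact: norm_hausdorff.
have [w hw] := pigeonhole (fun i => mX _ (cB i)) hB.
set s1 := [seq i <- s | _] in hw.
have [|w' hw'] := @pigeonhole _ _ _ P _ s1 _ m (fun i => mX _ (cB' i)).
  by move=> i; rewrite mem_filter => /andP[_]; exact: hB'.
set s2 := [seq i <- s1 | _] in hw'.
exists (X w), (X w'), s2; split.
- by apply: subseq_trans (filter_subseq _ _) (filter_subseq _ _).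
- apply: le_trans hw'; rewrite expr2 -mulrA; exact: ler_wpM2l.
- by move=> i; rewrite !mem_filter => /andP[/asboolP h1 /andP[/asboolP h2 _]].
Qed.

Definition in_body p z : Prop := forall th, dotr z th <= Lp_norm P X p th.

(* The common walk [v] sums differences [x - x'] of sample points: a point [z] stays in the list as
   long as every step lies in its own pair of sets, chosen so as not to be positively correlated
   with the current error [v - j z]. *)
Lemma walk p k (S : seq 'rV[R]_n) m : (0 < k)%N -> 1 <= p -> p <= k%:R ->
  (forall z, z \in S -> in_body p (4 *: z)) ->
  exists v S', [/\ subseq S' S, kp ^+ (2 * k * m) * (size S)%:R <= (size S')%:R &
    forall z, z \in S' -> N (v - m%:R *: z) ^+ 2 <= 2 * m%:R * rho ^+ 2].
Proof.
move=> k0 p1 pk hS; elim: m => [|m [v [S' [sub hs hv]]]].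
  exists 0, S; split => //; first by rewrite muln0 expr0 mul1r.
  by move=> z _; rewrite scale0r subr0 norm2_0// expr0n mulr0 mul0r.
(* [dotr] with [g z] is the covariance with the current error of z. The tolerance rho^2 / 2 makes
   twice the cross term at most rho^2, so a step adds at most 2 rho^2 to the squared error. *)
pose g z := \row_i cov_form P X (delta_mx ord0 i) (v - m%:R *: z).
have /choice[B hB] : forall z, exists B : set 'rV[R]_n * set 'rV[R]_n,
    [/\ compact B.1, compact B.2 & z \in S' ->
    [/\ kp ^+ k <= pr P (X @^-1` B.1), kp ^+ k <= pr P (X @^-1` B.2) &
     forall x y, B.1 x -> B.2 y -> N (x - y - z) <= rho /\ - (rho ^+ 2 / 2) <= dotr (x - y - z) (- g z)]].
  move=> z; case: (boolP (z \in S')) => zS; last first.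
    by exists (set0, set0); split => //; exact: compact0.
  have e0 : 0 < rho ^+ 2 / 2 by rewrite divr_gt0// exprn_gt0.
  have hz th : dotr z th <= Lp_norm P X p th / 4.
    have := hS z (mem_subseq sub zS) th; rewrite dotrZl => h.
    by rewrite ler_pdivlMr// mulrC.
  have [B [B' [? ? ? ? ?]]] := key_pair hX hL hC hI hN (- g z) k0 p1 pk hz e0.
  by exists (B, B').
have [|||||x [x' [s' [sub' hs' hx]]]] :=
  @select_pair _ S' (fun z => (B z).1) (fun z => (B z).2) (kp ^+ k).
- by rewrite exprn_ge0// ltW// pair_density_gt0.
- by move=> i; have [] := hB i.
- by move=> i; have [] := hB i.
- by move=> i; have [_ _ h] := hB i => /h [].
- by move=> i; have [_ _ h] := hB i => /h [].
exists (v + (x - x')), s'; split.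
- exact: subseq_trans sub' sub.
- apply: le_trans hs'; rewrite mulnS exprD -exprM (mulnC k) -mulrA ler_wpM2l//.
  by rewrite exprn_ge0// ltW// pair_density_gt0.
move=> z zs'; have zS := mem_subseq sub' zs'.
have [_ _ /(_ zS) [_ _ h]] := hB z; have [h1 h2] := hx z zs'.
have {h h1 h2} [h1 h2] := h _ _ h1 h2.
have -> : v + (x - x') - m.+1%:R *: z = (v - m%:R *: z) + (x - x' - z).
  by apply/rowP => i; rewrite !mxE -natr1; ring.
rewrite (sqr_norm2D hX hL) (cov_formC P X) (cov_formE hX hL) -/(g z).
have := hv z zS; rewrite dotrNr in h2.
have : N (x - x' - z) ^+ 2 <= rho ^+ 2 by rewrite ler_pXn2r ?nnegrE ?Lp_norm_ge0 ?(ltW rho0).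
rewrite -(natr1 m); lra.
Qed.

Lemma size_le1 (J : eqType) (s : seq J) : uniq s -> (forall i j, i \in s -> j \in s -> i = j) ->
  (size s <= 1)%N.
Proof.
case: s => [|i [|j s]]//= /andP[+ _] h.
by rewrite inE (h i j) ?inE ?eqxx ?orbT.
Qed.

(** Two survivors share v, so by the parallelogram law m^2 N(z - z')^2 <= 2 (2 m rho^2 + 2 m rho^2)
    = 8 m rho^2. The separation forbids this, and at most one point survives. *)
Lemma count_walk p k m (S : seq 'rV[R]_n) : (0 < k)%N -> (0 < m)%N -> 1 <= p -> p <= k%:R ->
  uniq S -> (forall z, z \in S -> in_body p (4 *: z)) ->
  (forall z z', z \in S -> z' \in S -> z <> z' -> 8 * rho ^+ 2 / m%:R < N (z - z') ^+ 2) ->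
  kp ^+ (2 * k * m) * (size S)%:R <= 1.
Proof.
move=> k0 m0 p1 pk uS hS hsep.
have [v [S' [sub hs hv]]] := walk m k0 p1 pk hS.
apply: le_trans hs _; rewrite -[1]/(1%:R) ler_nat; apply: size_le1 => [|z z' zS zS'].
  exact: subseq_uniq uS.
apply: contrapT => /(hsep _ _ (mem_subseq sub zS) (mem_subseq sub zS')).
have m0' : 0 < m%:R :> R by rewrite ltr0n.
rewrite ltr_pdivrMr//; apply/negP; rewrite -leNgt -(ler_pM2l m0').
have -> : m%:R * (N (z - z') ^+ 2 * m%:R) = N (m%:R *: (z - z')) ^+ 2.
  by rewrite (norm2Z hX hL) ger0_norm//; ring.
have -> : m%:R *: (z - z') = (v - m%:R *: z') + - (v - m%:R *: z).
  by apply/rowP => i; rewrite !mxE; ring.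
have h1 := hv _ zS; have h2 := hv _ zS'.
move: h1 h2; move: (v - m%:R *: z) (v - m%:R *: z') => D D' h1 h2.
have := sqr_norm2D hX hL D' D; have := sqr_norm2D hX hL D' (- D).
rewrite -(scaleN1r D) (cov_formZr hX hL) (norm2Z hX hL) normrN1 mul1r mulN1r.
have := sqr_ge0 (N (D' + D)).
lra.
Qed.

(* Mixing each pair of sets with the bulk ball raises the mass from [m] to about [m `^ l]. *)
Lemma count_mix p k l (S : seq 'rV[R]_n) : (0 < k)%N -> 0 < l < 1 -> 1 <= p -> p <= k%:R ->
  uniq S -> (forall z, z \in S -> in_body p (4 *: z)) ->
  (forall z z', z \in S -> z' \in S -> z <> z' -> 2 * (32 * I + rho) / l < N (z - z')) ->
  (7 / 8 * (kp ^+ k) `^ l) ^+ 2 * (size S)%:R <= 1.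
Proof.
move=> k0 l01 p1 pk uS hS hsep.
have /andP[l0 l1] := l01; have l1' : 0 < 1 - l by rewrite subr_gt0.
have mX K : closed K -> measurable (X @^-1` K) by exact: measurable_preimage_closed.
have kp0 : 0 < kp ^+ k by rewrite exprn_gt0// pair_density_gt0.
(* Markov at 16 I and truncation each lose 1/16 and leave 7/8; the mass of the bulk must be close to
   1 for its power not to matter. *)
have e0 : (0 : R) < 16^-1 by rewrite invr_gt0.
have [M M0 hM] := exists_trunc P hX e0.
pose B0 := [set x : 'rV[R]_n | N x <= 16 * I] `&` [set x | `|x| <= M].
have cN : closed [set x : 'rV[R]_n | N x <= 16 * I] by apply: closed_le_fun; exact: norm2_continuous.
have cB0 : compact B0.
  apply: (@compact_in_ball _ _ _ M) => [|x []//].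
  by apply: closedI => //; exact: closed_ball_norm.
have hB0 : 7 / 8 <= pr P (X @^-1` B0).
  apply: le_trans (hM _ cN).
  have t0 : 0 < 16 * I by rewrite mulr_gt0.
  have := pr_markov (intg_norm2 hX hL) (fun w => Lp_norm_ge0 P X 2 (X w)) t0.
  have -> : I / (16 * I) = 16^-1 by field; rewrite gt_eqF.
  set F := [set w | _] => hm.
  have mF : measurable F by apply: measurable_ge; exact: measurable_norm2.
  have : pr P (~` F) <= pr P (X @^-1` [set x : 'rV[R]_n | N x <= 16 * I]).
    apply: pr_le; [exact: measurableC|exact: mX|].
    by move=> w /negP; rewrite -ltNge => /ltW.
  rewrite prC//; lra.
pose mix (B : set 'rV[R]_n) := [set (1 - l) *: a + l *: b | a in B0 & b in B].
have hmix B : compact B -> kp ^+ k <= pr P (X @^-1` B) ->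
    compact (mix B) /\ 7 / 8 * (kp ^+ k) `^ l <= pr P (X @^-1` mix B).
  move=> cB hB; split; first exact: compact_mean.
  apply: le_trans (log_concave_compact hX hL cB0 cB l01 _ _); last 2 first.
  - by apply: (@pr_gt0_nonempty _ _ _ P _ X); apply: lt_le_trans hB0; rewrite divr_gt0.
  - by apply: (@pr_gt0_nonempty _ _ _ P _ X); apply: lt_le_trans hB.
  apply: ler_pM; rewrite ?powR_ge0//.
    apply: (@le_trans _ _ ((7 / 8) `^ (1 - l))).
      rewrite -[leLHS]powRr1//; apply: ger_powR; last by rewrite gerBl ltW.
      by rewrite divr_gt0//= ler_pdivrMr// mul1r ler_nat.
    by rewrite ge0_ler_powR ?nnegrE ?pr_ge0 ?(ltW l1')// divr_ge0.
  by rewrite ge0_ler_powR ?nnegrE ?pr_ge0 ?(ltW l0) ?(ltW kp0).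
have /choice[B hB] : forall z, exists B : set 'rV[R]_n * set 'rV[R]_n,
    [/\ compact B.1, compact B.2 & z \in S ->
    [/\ kp ^+ k <= pr P (X @^-1` B.1), kp ^+ k <= pr P (X @^-1` B.2) &
     forall x y, B.1 x -> B.2 y -> N (x - y - z) <= rho]].
  move=> z; case: (boolP (z \in S)) => zS; last first.
    by exists (set0, set0); split => //; exact: compact0.
  have hz th : dotr z th <= Lp_norm P X p th / 4.
    have := hS z zS th; rewrite dotrZl => h.
    by rewrite ler_pdivlMr// mulrC.
  have [B [B' [? ? ? ? h]]] := key_pair hX hL hC hI hN 0 k0 p1 pk hz (@ltr01 R).
  by exists (B, B'); split => // _; split => // x y Bx By; have [] := h _ _ Bx By.
have [|||||x [x' [S' [sub hs hx]]]] :=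
  @select_pair _ S (fun z => mix (B z).1) (fun z => mix (B z).2) (7 / 8 * (kp ^+ k) `^ l).
- by rewrite mulr_ge0 ?powR_ge0.
- by move=> z; have [h _ _] := hB z; apply: compact_mean.
- by move=> z; have [_ h _] := hB z; apply: compact_mean.
- by move=> z zS; have [h _ /(_ zS) [h1 _ _]] := hB z; have [] := hmix _ h h1.
- by move=> z zS; have [_ h /(_ zS) [_ h1 _]] := hB z; have [] := hmix _ h h1.
apply: le_trans hs _; rewrite -[1]/(1%:R) ler_nat; apply: size_le1 => [|z z' zS zS'].
  exact: subseq_uniq uS.
apply: contrapT => /(hsep _ _ (mem_subseq sub zS) (mem_subseq sub zS')).
rewrite ltr_pdivrMr//; apply/negP; rewrite -leNgt.
have near u : u \in S' -> N (x - x' - l *: u) <= 32 * I + rho.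
  move=> uS'; have [[a [a1 _] [b Bb <-]] [a' [a1' _] [b' Bb' <-]]] := hx _ uS'.
  have [_ _ /(_ (mem_subseq sub uS')) [_ _ h]] := hB u; have {}h := h _ _ Bb Bb'.
  have -> : (1 - l) *: a + l *: b - ((1 - l) *: a' + l *: b') - l *: u =
    (1 - l) *: (a - a') + l *: (b - b' - u) by apply/rowP => i; rewrite !mxE; ring.
  apply: le_trans (norm2_triangle hX hL _ _) _; rewrite !(norm2Z hX hL) !gtr0_norm//.
  apply: lerD.
    apply: (@le_trans _ _ (N (a - a'))).
      by rewrite ler_piMl ?Lp_norm_ge0// gerBl ltW.
    apply: le_trans (norm2_triangleB hX hL _ _) _; move: a1 a1' => /=; lra.
  by apply: le_trans h; rewrite ler_piMl ?Lp_norm_ge0// ltW.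
have -> : N (z - z') * l = N ((x - x' - l *: z') - (x - x' - l *: z)).
  rewrite mulrC -[X in X * _](gtr0_norm l0) -(norm2Z hX hL); congr (N _).
  by apply/rowP => i; rewrite !mxE; ring.
apply: le_trans (norm2_triangleB hX hL _ _) _.
have := near _ zS; have := near _ zS'; lra.
Qed.

(** After scaling by 1/4 the separation is 4 (33 + [pair_radius]) t I, enough for both counts since
    32 I + rho = (33 + [pair_radius]) I. The 8 of [log_const] is 2 k m <= 2 (2 p) (2 / t^2). *)
Definition sep_const : R := 16 * (33 + pair_radius R).
Definition log_const : R := - (8 * ln kp).

Lemma sep_const_gt0 : 0 < sep_const.
Proof. by rewrite mulr_gt0// addr_gt0// pair_radius_gt0. Qed.

Lemma log_const_ge0 : 0 <= log_const.
Proof.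
rewrite oppr_ge0 pmulr_rle0//; apply: ln_le0.
apply: le_trans (pair_density_le R) _; lra.
Qed.

Lemma separated_count p t (S : seq 'rV[R]_n) : 1 <= p -> 0 < t -> uniq S ->
  (forall z, z \in S -> in_body p z) ->
  (forall z z', z \in S -> z' \in S -> z <> z' -> sep_const * t * I < N (z - z')) ->
  ln (size S)%:R <= log_const * p * (t^-1 ^+ 2 + t^-1).
Proof.
move=> p1 t0 uS hS hsep.
have kp0 := pair_density_gt0 R; have L0 := log_const_ge0; have R0 := pair_radius_gt0 R.
have lE : ln kp = - (log_const / 8) by rewrite /log_const; field.
have [s1|s2] := leqP (size S) 1.
  have -> : ln (size S)%:R = 0 :> R.
    by case: (size S) s1 => [|[|]]// _; [rewrite ln0|rewrite ln1].
  by rewrite !mulr_ge0 ?addr_ge0 ?invr_ge0 ?exprn_ge0 ?invr_ge0 ?(ltW t0)//; lra.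
have sz0 : 0 < (size S)%:R :> R by rewrite ltr0n (ltn_trans _ s2).
pose k := (Num.truncn p).+1.
have /truncn_itv/andP[k1 k2] : 0 <= p by lra.
rewrite -/k in k2; have k3 : k%:R <= 2 * p by rewrite /k -[leLHS]natr1; lra.
pose S4 := [seq 4^-1 *: z | z <- S].
have inj4 : injective (fun z : 'rV[R]_n => 4^-1 *: z).
  by apply: scalerI; rewrite invr_eq0 pnatr_eq0.
have uS4 : uniq S4 by rewrite map_inj_uniq.
have sS4 : size S4 = size S by rewrite size_map.
have hS4 z : z \in S4 -> in_body p (4 *: z).
  by move=> /mapP [y yS ->]; rewrite scalerA mulfV ?pnatr_eq0// scale1r; exact: hS.
have hsep4 z z' : z \in S4 -> z' \in S4 -> z <> z' -> sep_const / 4 * t * I < N (z - z').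
  move=> /mapP [y yS ->] /mapP [y' yS' ->] hne.
  rewrite -scalerBr (norm2Z hX hL) gtr0_norm ?invr_gt0//.
  have := hsep y y' yS yS' (fun e => hne (congr1 _ e)); lra.
have tI : 0 < t * I by rewrite mulr_gt0.
have [t1|t1] := leP t 1.
  (* The least convenient number of steps with m t^2 > 1; it is at most 2 / t^2 because t <= 1. *)
  pose m := (Num.truncn (t^-1 ^+ 2)).+1.
  have ti1 : 1 <= t^-1 ^+ 2 by rewrite exprn_ege1// invf_ge1.
  have /truncn_itv/andP[m1 m2] : 0 <= t^-1 ^+ 2 by lra.
  rewrite -/m in m2; have m3 : m%:R <= 2 * t^-1 ^+ 2 by rewrite /m -[leLHS]natr1; lra.
  have := @count_walk p k m S4 isT isT p1 (ltW k2) uS4 hS4.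
  have m0 : 0 < m%:R :> R by rewrite ltr0n.
  have tm : 1 < t ^+ 2 * m%:R.
    by move: m2; rewrite exprVn -ltr_pdivrMl ?exprn_gt0// mulr1.
  have hh z z' : z \in S4 -> z' \in S4 -> z <> z' -> 8 * rho ^+ 2 / m%:R < N (z - z') ^+ 2.
    move=> zS zS' hne; rewrite ltr_pdivrMr//.
    apply: (@lt_trans _ _ ((sep_const / 4 * t * I) ^+ 2 * m%:R)); last first.
      have Cp : 0 < sep_const by rewrite mulr_gt0// addr_gt0.
      rewrite ltr_pM2r// ltr_pXn2r ?nnegrE ?Lp_norm_ge0//; first exact: hsep4.
      by rewrite -mulrA mulr_ge0 ?(ltW tI) ?divr_ge0 ?(ltW Cp).
    have -> : (sep_const / 4 * t * I) ^+ 2 * m%:R = 16 * ((33 + pair_radius R) * I) ^+ 2 * (t ^+ 2 * m%:R).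
      by rewrite /sep_const; field.
    apply: (@le_lt_trans _ _ (16 * ((33 + pair_radius R) * I) ^+ 2)); last first.
      by rewrite ltr_pMr// mulr_gt0// exprn_gt0// mulr_gt0// addr_gt0.
    apply: ler_pM => //; [exact: sqr_ge0|by rewrite ler_nat|].
    have r33 : 0 < 33 + pair_radius R by exact: addr_gt0.
    rewrite ler_pXn2r ?nnegrE ?(ltW rho0) ?mulr_ge0 ?(ltW hI) ?(ltW r33)//.
    by rewrite ler_pM2r//; lra.
  move=> /(_ hh); rewrite sS4 => h.
  have : ln (kp ^+ (2 * k * m) * (size S)%:R) <= 0 by apply: ln_le0.
  rewrite lnM ?posrE ?exprn_gt0// lnXn// lE -(mulr_natr (- _)) !natrM => h'.
  apply: (@le_trans _ _ (log_const * p * t^-1 ^+ 2)); last first.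
    by rewrite ler_wpM2l ?lerDl ?invr_ge0 ?(ltW t0)// mulr_ge0//; lra.
  apply: (@le_trans _ _ (log_const / 8 * (2 * k%:R * m%:R))); first by lra.
  apply: (@le_trans _ _ (log_const / 8 * (2 * (2 * p) * (2 * t^-1 ^+ 2)))); last by lra.
  rewrite ler_wpM2l ?divr_ge0//; apply: ler_pM; rewrite ?mulr_ge0//.
  by rewrite ler_pM2l.
(* For t > 1 a single step of the walk would already cost a multiple of p, not of p / t; the mixing
   weight 1 / t puts the right exponent on the mass. *)
have l01 : 0 < t^-1 < 1 by rewrite invr_gt0 t0 invf_lt1.
have := @count_mix p k t^-1 S4 isT l01 p1 (ltW k2) uS4 hS4.
have hh z z' : z \in S4 -> z' \in S4 -> z <> z' -> 2 * (32 * I + rho) / t^-1 < N (z - z').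
  move=> zS zS' hne; apply: le_lt_trans (hsep4 _ _ zS zS' hne).
  have -> : 2 * (32 * I + rho) / t^-1 = 2 * (33 + pair_radius R) * (t * I) by rewrite invrK; ring.
  have -> : sep_const / 4 * t * I = 4 * (33 + pair_radius R) * (t * I) by rewrite /sep_const; field.
  by rewrite ler_pM2r//; lra.
move=> /(_ hh); rewrite sS4 => h.
have q0 : 0 < (kp ^+ k) `^ t^-1 by rewrite powR_gt0// exprn_gt0.
have f0 : (0 : R) < 7 / 8 by rewrite divr_gt0.
have : ln ((7 / 8 * (kp ^+ k) `^ t^-1) ^+ 2 * (size S)%:R) <= 0 by apply: ln_le0.
rewrite lnM ?posrE ?exprn_gt0 ?mulr_gt0// lnXn ?mulr_gt0// lnM ?posrE// ln_powR lnXn// lE => h'.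
(* The factor (7/8)^2 leaves an additive constant that p / t cannot absorb. Since (7/8)^4 >= 1/2 and
   the list has at least two points, it is at most half of ln (size S). *)
have h2 : ln 2 <= ln (size S)%:R :> R by rewrite ler_ln ?posrE// ler_nat.
have h78 : - ln 2 <= 4 * ln (7 / 8) :> R.
  rewrite -lnV ?posrE// [4 * _]mulr_natl -lnXn//.
  rewrite ler_ln ?posrE ?invr_gt0 ?exprn_gt0//.
  by rewrite expr_div_n ler_pdivlMr ?exprn_gt0//; lra.
apply: (@le_trans _ _ (log_const * p * t^-1)); last first.
  by rewrite ler_wpM2l ?lerDr ?exprn_ge0 ?invr_ge0 ?(ltW t0)// mulr_ge0//; lra.
apply: (@le_trans _ _ (log_const / 2 * (t^-1 * k%:R))).
  move: h'; rewrite -(mulr_natr (- _)); lra.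
have -> : log_const * p * t^-1 = log_const / 2 * (t^-1 * (2 * p)) by field; rewrite gt_eqF.
by rewrite ler_wpM2l ?divr_ge0// ler_wpM2l ?invr_ge0 ?(ltW t0).
Qed.

End Walk.

(** * Centroid bodies *)

(** Only finite lists have to be bounded: an infinite separated set would contain lists longer than
    b. *)
Lemma packing_le (R : realType) (n : nat) (A B : set 'rV[R]_n) (b : R) :
  (forall s : seq 'rV[R]_n, uniq s -> (forall x, x \in s -> A x) ->
    (forall x y, x \in s -> y \in s -> x <> y -> ~ B (x - y)) -> (size s)%:R <= b) ->
  (packing A B <= b%:E)%E.
Proof.
move=> h; apply: ge_ereal_sup => _ [S [SA hS] <-].
have hs s : uniq s -> (forall x, x \in s -> S x) -> (size s)%:R <= b.
  move=> us sS; apply: h => // [x /sS /SA//|x y /sS Sx /sS Sy]; exact: hS.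
rewrite /counting; case: asboolP => [fS|iS].
  rewrite lee_fin; apply: hs; first exact: mathcomp.finmap.finmap.fset_uniq.
  by move=> x; rewrite in_fset_set// => /set_mem.
have [s [us sS sz]] : exists s : seq 'rV[R]_n,
    [/\ uniq s, (forall x, x \in s -> S x) & size s = (Num.truncn b).+1].
  elim: (Num.truncn b).+1 => [|m [s [us sS sz]]]; first by exists [::].
  have : infinite_set (S `\` [set` s]) by apply: infinite_setD => //; exact: finite_seq.
  move=> /infinite_setN0 [x [Sx /= xs]]; exists (x :: s); split => /=.
  - by rewrite us andbT; apply/negP.
  - by move=> y; rewrite inE => /orP [/eqP ->//|]; exact: sS.
  - by rewrite sz.
have := hs _ us sS; rewrite sz => hb.
have b0 : 0 <= b by apply: le_trans hb.
by have /truncn_itv/andP[_] := b0; rewrite ltNge hb.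
Qed.

Lemma lne_le (R : realType) (x : \bar R) (c : R) : (x <= (expR c)%:E)%E -> (lne x <= c%:E)%E.
Proof.
case: x => [x||]// h /=; last exact: leNye.
rewrite lee_fin in h.
by case: ifPn => [_|]; [exact: leNye|rewrite -ltNge => x0; rewrite lee_fin -ler_expR lnK].
Qed.

Lemma support_fun_ub (R : realType) (n : nat) (K : set 'rV[R]_n) x y :
  compact K -> K y -> dotr x y <= support_fun K x.
Proof.
move=> /compact_in_some_ball [a a0 Ka] Ky; apply: ub_le_sup; last by exists y.
exists (a * l1norm x) => _ [z Kz <-].
apply: le_trans (ler_norm _) _; rewrite dotrC; apply: le_trans (dotr_le_norm _ _) _.
by rewrite ler_wpM2r ?l1norm_ge0//; exact: Ka.
Qed.

Section Centroid.
Context (d : measure_display) (T : measurableType d) (R : realType).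
Variables (P : probability T R) (n : nat) (X : T -> 'rV[R]_n).
Hypotheses (hX : random_vector X) (hL : log_concave P X).
Implicit Types (th x y z g : 'rV[R]_n) (t b p q eps : R).

Local Notation N := (Lp_norm P X 2).
Local Notation Np p := (Lp_norm P X p).

Lemma Lnorm_Lp_norm p th : 1 <= p ->
  ('N[P]_(p%:E)[(fun w => (dotr (X w) th)%:E)] = (Np p th)%:E)%E.
Proof.
move=> p1; rewrite Lnorm.unlock Lp_norm.unlock -poweR_EFin ExEFin; last exact: intg_powR.
by congr (_ `^ _)%E; apply: eq_integral => w _; rewrite -poweR_EFin.
Qed.

Lemma centroid_support p Z th : 1 <= p -> is_Lp_centroid P X p Z ->
  support_fun Z th = Np p th.
Proof.
by move=> p1 [_ _ _ _ /(_ th)]; rewrite Lnorm_Lp_norm// => -[].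
Qed.

Lemma Lp_centroid_sub p : 1 <= p -> Lp_centroid P X p `<=` in_body P X p.
Proof.
(* In the second case of [xgetP] the body is the default [set0]. *)
move=> p1; rewrite /Lp_centroid; case: xgetP => [Z -> hZ|_]//.
move=> z Zz th; rewrite -(centroid_support th p1 hZ) dotrC.
by have [cZ _ _ _ _] := hZ; exact: support_fun_ub.
Qed.

Lemma Lp_normN p th : Np p (- th) = Np p th.
Proof.
rewrite Lp_norm.unlock; congr (_ `^ _); congr Ex; apply/funext => w.
by rewrite dotrNr normrN.
Qed.

Lemma young a b p : 0 <= a -> 0 <= b -> 1 < p -> a * b `^ (p - 1) <= a `^ p / p + (1 - p^-1) * b `^ p.
Proof.
move=> a0 b0 p1.
have p0 : 0 < p by lra.
have q0 : 0 < p / (p - 1) by rewrite divr_gt0//; lra.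
have pq : p^-1 + (p / (p - 1))^-1 = 1 by field; apply/andP; split; apply: lt0r_neq0; lra.
have := @conjugate_powR R a (b `^ (p - 1)) p (p / (p - 1)) a0 (powR_ge0 _ _) p0 q0 pq.
rewrite -powRrM (_ : (p - 1) * _ = p); last by field; apply: lt0r_neq0; lra.
by rewrite -(_ : (p / (p - 1))^-1 = 1 - p^-1) 1?mulrC//; lra.
Qed.

(* The point [z] is the gradient of the norm [Np p] at [th]. *)
Lemma in_body_attained p th : 1 < p -> exists2 z, in_body P X p z & dotr z th = Np p th.
Proof.
move=> p1; have p1' := ltW p1; set L := Np p th.
have [L0|L0] := eqVneq L 0.
  by exists 0; [move=> y; rewrite dotr0l Lp_norm_ge0|rewrite dotr0l].
have {}L0 : 0 < L by rewrite lt_def L0 Lp_norm_ge0.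
pose xi w := dotr (X w) th.
pose v w := `|xi w| / L.
(* This is sign(xi) (|xi| / L)^(p - 1), written without the sign; where xi = 0 the first factor
   makes it vanish. *)
pose f w := xi w / L * v w `^ (p - 2).
have v0 w : 0 <= v w by rewrite divr_ge0 ?(ltW L0).
have p0 : 0 < p by lra.
have mxi : measurable_fun [set: T] xi by exact: measurable_dotr.
have mv : measurable_fun [set: T] v.
  by apply: measurable_funM => //; apply: measurableT_comp.
have mf : measurable_fun [set: T] f.
  apply: measurable_funM; first exact: measurable_funM.
  exact: (@measurableT_comp _ _ _ _ _ _ (@powR R ^~ (p - 2))).
have vE w q : q != 0 -> v w * v w `^ (q - 1) = v w `^ q.
  move=> q0; have [->|vn0] := eqVneq (v w) 0; first by rewrite mul0r powR0.
  rewrite -{1}(powRr1 (v0 w)) -powRD; first by congr (_ `^ _); ring.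
  by rewrite vn0 implybT.
have fb w : `|f w| = v w `^ (p - 1).
  rewrite !normrM (ger0_norm (powR_ge0 _ _)) (@gtr0_norm _ L^-1) ?invr_gt0//.
  rewrite -(vE w (p - 1)); last by rewrite gt_eqF//; lra.
  by rewrite (_ : p - 1 - 1 = p - 2)//; ring.
have vpE w : v w `^ p = L `^ (- p) * `|xi w| `^ p.
  by rewrite powRM ?invr_ge0 ?(ltW L0)// -powR_inv1 ?(ltW L0)// -powRrM mulN1r mulrC.
have ilp : intg P (fun w => v w `^ p).
  by rewrite (funext vpE); apply: intgZ; exact: intg_powR.
have Elp : Ex P (fun w => v w `^ p) = 1.
  rewrite (funext vpE) ExZ; last exact: intg_powR.
  by rewrite -(Lp_norm_powR P X)// -/L powRN mulVf// gt_eqF// powR_gt0.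
(* Hoelder's inequality through [young] after division by M, which is positive even if y has norm 0;
   M then tends to the norm. *)
have key y M : Np p y < M -> intg P (fun w => dotr (X w) y * f w) /\
   Ex P (fun w => dotr (X w) y * f w) <= M.
  move=> hM; have M0 : 0 < M by apply: le_lt_trans hM; exact: Lp_norm_ge0.
  pose G w := M * (M `^ (- p) / p * `|dotr (X w) y| `^ p + (1 - p^-1) * v w `^ p).
  have iG1 : intg P (fun w => M `^ (- p) / p * `|dotr (X w) y| `^ p).
    by apply: intgZ; exact: intg_powR.
  have iG2 : intg P (fun w => (1 - p^-1) * v w `^ p) by exact: intgZ.
  have iG : intg P G by apply: intgZ; exact: intgD.
  have hG w : `|dotr (X w) y * f w| <= G w.
    rewrite normrM fb /G -ler_pdivrMl// mulrA.
    have := @young (M^-1 * `|dotr (X w) y|) (v w) p.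
    rewrite mulr_ge0 ?invr_ge0 ?(ltW M0)// => /(_ isT (v0 w) p1) /le_trans; apply.
    rewrite powRM ?invr_ge0 ?(ltW M0)// -(powR_inv1 (ltW M0)) -powRrM mulN1r.
    by rewrite -!mulrA (mulrC p^-1).
  have ig : intg P (fun w => dotr (X w) y * f w).
    by apply: intg_le iG hG; apply: measurable_funM => //; exact: measurable_dotr.
  split => //.
  apply: (@le_trans _ _ (Ex P G)).
    by apply: Ex_le => // w; apply: le_trans (ler_norm _) (hG w).
  rewrite ExZ ?ExD ?ExZ ?Elp//; [|exact: intg_powR|exact: intgD].
  rewrite -(Lp_norm_powR P X)// -[leRHS]mulr1 ler_pM2l// mulr1.
  have h : M `^ (- p) * Np p y `^ p <= 1.
    rewrite powRN ler_pdivrMl ?powR_gt0// mulr1.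
    by rewrite ge0_ler_powR ?nnegrE ?Lp_norm_ge0 ?(ltW M0) ?(ltW hM) ?(ltW p0).
  have ip0 : 0 <= p^-1 by rewrite invr_ge0 ltW.
  have := ler_wpM2l ip0 h; rewrite mulr1; lra.
pose z := \row_i Ex P (fun w => dotr (X w) (delta_mx ord0 i) * f w) : 'rV[R]_n.
have ig y : intg P (fun w => dotr (X w) y * f w).
  by have [] := @key y (Np p y + 1); rewrite ?ltrDl.
have zE y : dotr z y = Ex P (fun w => dotr (X w) y * f w).
  transitivity (Ex P (fun w => \sum_i y ord0 i * (dotr (X w) (delta_mx ord0 i) * f w))).
    rewrite Ex_sum => [|i]; last exact: intgZ.
    by apply: eq_bigr => i _; rewrite mxE ExZ// mulrC.
  congr Ex; apply/funext => w; rewrite /dotr mulr_suml.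
  apply: eq_bigr => i _; rewrite -/(dotr _ _) dotr_delta; ring.
exists z.
  move=> y; rewrite zE; apply/ler_addgt0Pr => e e0.
  by have [] := @key y (Np p y + e); rewrite ?ltrDl.
rewrite zE (_ : (fun w => _) = (fun w => L * v w `^ p)).
  by rewrite ExZ// Elp mulr1.
apply/funext => w; rewrite -(vE w) ?gt_eqF// -(vE w (p - 1)); last by rewrite gt_eqF//; lra.
rewrite /f (_ : p - 1 - 1 = p - 2); last by ring.
rewrite -/(xi w) !mulrA; congr (_ * _).
rewrite /v; transitivity (`|xi w| ^+ 2 / L); last by field; rewrite gt_eqF.
by rewrite (real_normK (num_real _)) expr2.
Qed.

(** It gives the exact support function of Z_r, which enters both the polar and I_r. For Z_p the
    inclusion [Lp_centroid_sub] is enough. *)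
Lemma in_body_centroid p : 1 < p -> is_Lp_centroid P X p (in_body P X p).
Proof.
move=> p1; have p1' := ltW p1; split.
- apply: (@compact_in_ball _ _ _ (\sum_i (Np p (delta_mx ord0 i)))).
    apply: closed_forall => y; apply: closed_le_fun; exact: dotr_continuous.
  move=> z hz /=; apply: norm_le_coord => [|i]; first by apply: sumr_ge0 => i _; exact: Lp_norm_ge0.
  apply: (@le_trans _ _ (Np p (delta_mx ord0 i))); last first.
    by rewrite (bigD1 i)//= lerDl; apply: sumr_ge0 => j _; exact: Lp_norm_ge0.
  rewrite -dotr_delta ler_norml hz andbT lerNl -dotrNr -(Lp_normN p (delta_mx ord0 i)); exact: hz.
- move=> x y l /set_mem hx /set_mem hy; apply/mem_set => th.
  rewrite -[conv _ _ _]/(l%:num *: (x : 'rV[R]_n) + (1 - l%:num) *: (y : 'rV[R]_n)).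
  rewrite dotrDl !dotrZl.
  have l0 : 0 <= l%:num by [].
  have l1 : 0 <= 1 - l%:num by rewrite subr_ge0 le1.
  have := ler_wpM2l l0 (hx th); have := ler_wpM2l l1 (hy th); lra.
- by exists 0 => th; rewrite dotr0l Lp_norm_ge0.
- by move=> x hx th; rewrite dotrNl -dotrNr -Lp_normN; exact: hx.
move=> th; rewrite Lnorm_Lp_norm//; congr (_%:E).
have [z hz hzE] := in_body_attained th p1.
apply/eqP; rewrite eq_le; apply/andP; split.
  apply: sup_le_ub; first by exists (dotr th z), z.
  by move=> _ [y hy <-]; rewrite dotrC.
rewrite -hzE dotrC; apply: ub_le_sup; last by exists z.
by exists (Np p th) => _ [y hy <-]; rewrite dotrC.
Qed.

Lemma Lp_centroidP p : 1 < p -> is_Lp_centroid P X p (Lp_centroid P X p).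
Proof. by move=> p1; apply: xgetPex; exists (in_body P X p); exact: in_body_centroid. Qed.

Lemma support_Lp_centroid p th : 1 < p -> support_fun (Lp_centroid P X p) th = Np p th.
Proof. by move=> p1; apply: centroid_support (Lp_centroidP p1); exact: ltW. Qed.

Lemma mean_supportE p : 1 < p -> mean_support P X p = Ex P (fun w => Np p (X w)).
Proof.
move=> p1; rewrite /mean_support expectation.unlock Ex.unlock; congr fine.
by apply: eq_integral => w _; rewrite support_Lp_centroid.
Qed.

Lemma intg_Lp_norm p : 1 < p -> intg P (fun w => Np p (X w)).
Proof.
move=> p1; have [c c0 hc] := norm2_bound hX hL.
apply: (@intg_le _ _ _ _ _ (fun w => 4 * expR 3 * p * N (X w))).
- apply: (measurable_of_closed_le hX) => a.
  (* By duality a sublevel set of the norm is an intersection of closed half-spaces, hence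
     closed. *)
  rewrite (_ : mkset _ = [set x | forall z : {z | in_body P X p z}, dotr x (sval z) <= a]).
    by apply: closed_forall => z; apply: closed_le_fun; exact: dotr_continuous.
  apply/seteqP; split => x /=.
    by move=> h [z hz] /=; rewrite dotrC; exact: le_trans (hz x) h.
  have [z hz <-] := in_body_attained x p1.
  by move=> /(_ (exist _ z hz)); rewrite dotrC.
- by apply: intgZ; exact: intg_norm2.
- by move=> w; rewrite ger0_norm ?Lp_norm_ge0//; apply: Lp_norm_le_norm2 => //; exact: ltW.
Qed.

Lemma dilate_polar p c x : 1 < p -> 0 < c -> ~ dilate c (polar (Lp_centroid P X p)) x ->
  c < Np p x.
Proof.
move=> p1 c0; apply: contra_notT; rewrite -leNgt => h.
exists (c^-1 *: x); last by rewrite scalerA mulfV ?scale1r// gt_eqF.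
rewrite /polar /= support_Lp_centroid//.
have [z hz <-] := in_body_attained (c^-1 *: x) p1.
rewrite dotrZr ler_pdivrMl// mulr1; exact: le_trans (hz x) h.
Qed.

Hypothesis hC : centered P X.

Lemma cov_mxE i j : cov_mx P X i j = cov_form P X (delta_mx ord0 i) (delta_mx ord0 j).
Proof.
rewrite mxE covariance.unlock !hC /= expectation.unlock cov_form.unlock Ex.unlock.
congr fine; apply: eq_integral => w _ /=.
by rewrite !dotr_delta mulrfctE /= !subr0.
Qed.

Lemma cov_form_mulmx z j : cov_form P X z (delta_mx ord0 j) = (z *m cov_mx P X) ord0 j.
Proof.
rewrite (cov_formE hX hL) mxE; apply: eq_bigr => i _.
by rewrite cov_mxE mxE.
Qed.

Hypothesis hD : nondegenerate_law P X.

Lemma norm2_gt0 z : z != 0 -> 0 < N z.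
Proof.
move=> z0; rewrite lt_def Lp_norm_ge0 andbT; apply: contra z0 => /eqP Nz.
have h : z *m cov_mx P X = 0.
  apply/rowP => j; rewrite -cov_form_mulmx [RHS]mxE; apply/eqP; rewrite eq_le.
  have h1 := cov_form_CS hX hL z (delta_mx ord0 j).
  have h2 := cov_form_CS hX hL (- z) (delta_mx ord0 j).
  rewrite Nz mul0r in h1; rewrite (norm2N hX hL) Nz mul0r -scaleN1r (cov_formZl hX hL) in h2.
  by apply/andP; split; lra.
by rewrite -(mulmxK hD z) h mul0mx.
Qed.

(** With y the image of a basis vector e under the inverse covariance, <X,e> is the covariance form
    of y and X, at most N(y) N(X). A vanishing mean would force E|<X,e>| = 0, hence N(e) = 0 by
    [norm2_le_L1]. *)
Lemma mean_norm2_gt0 : (0 < n)%N -> 0 < Ex P (fun w => N (X w)).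
Proof.
move=> n0; set I := Ex P _.
pose e := delta_mx ord0 (Ordinal n0) : 'rV[R]_n.
have e0 : e != 0.
  apply/eqP => /rowP /(_ (Ordinal n0)); rewrite !mxE !eqxx /= => /eqP.
  by rewrite oner_eq0.
pose y := e *m invmx (cov_mx P X).
have h x : dotr x e = cov_form P X y x.
  rewrite (cov_formC P X) (cov_formE hX hL); congr dotr; apply/rowP => i.
  by rewrite mxE (cov_formC P X) cov_form_mulmx /y mulmxKV.
have h1 := norm2_le_L1 hX hL e.
have h2 : Ex P (fun w => `|dotr (X w) e|) <= N y * I.
  rewrite -ExZ; last exact: intg_norm2.
  apply: Ex_le; [exact: intg_norm_dotr|by apply: intgZ; exact: intg_norm2|] => w.
  rewrite ler_norml lerNl; apply/andP; split; rewrite h; last exact: cov_form_CS.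
  have := cov_form_CS hX hL (- y) (X w).
  by rewrite (norm2N hX hL) -scaleN1r (cov_formZl hX hL) mulN1r.
have := norm2_gt0 e0; rewrite ltNge => /negP h0.
rewrite ltNge; apply/negP => I0; apply: h0; apply: le_trans h1 _.
have h3 : Ex P (fun w => `|dotr (X w) e|) <= 0.
  by apply: le_trans h2 _; rewrite mulr_ge0_le0 ?Lp_norm_ge0.
by rewrite mulr_ge0_le0// mulr_ge0 ?expR_ge0.
Qed.

End Centroid.

(** * The isotropic case *)

Lemma fact_ge (R : realType) k : k%:R ^+ k <= (k`!)%:R * expR 1 ^+ k :> R.
Proof.
elim: k => [|k IH]; first by rewrite !expr0 mulr1.
have [->|k0] := posnP k; first by rewrite !expr1 !mul1r; have := expR_ge1Dx (1 : R); lra.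
have k0' : 0 < k%:R :> R by rewrite ltr0n.
have h : k.+1%:R ^+ k <= expR 1 * k%:R ^+ k :> R.
  have -> : k.+1%:R = (1 + k%:R^-1) * k%:R :> R by rewrite mulrDl mulVf ?gt_eqF// -natr1; ring.
  rewrite exprMn ler_wpM2r ?exprn_ge0//.
  apply: (@le_trans _ _ (expR k%:R^-1 ^+ k)); last by rewrite -expRM_natr mulVf ?gt_eqF.
  by rewrite ler_pXn2r ?nnegrE ?addr_ge0 ?invr_ge0 ?expR_ge0//; exact: expR_ge1Dx.
rewrite factS natrM !exprS -mulrA ler_pM2l ?ltr0n//.
apply: le_trans h _; rewrite mulrCA ler_pM2l ?expR_gt0//.
Qed.

Lemma sqr_sum_le (R : realType) (J : finType) (A : {set J}) (a : J -> R) :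
  (\sum_(i in A) a i) ^+ 2 <= #|A|%:R * \sum_(i in A) a i ^+ 2.
Proof.
have [A0|A0] := posnP #|A|.
  by rewrite (cards0_eq A0) !big_set0 expr0n mulr0.
set s := \sum_(i in A) a i; set c : R := #|A|%:R.
have c0 : 0 < c by rewrite ltr0n.
have : 0 <= \sum_(i in A) (a i - s / c) ^+ 2 by apply: sumr_ge0 => i _; exact: sqr_ge0.
under eq_bigr do rewrite sqrrB.
rewrite big_split /= sumrB sumr_const sumrMnl -mulr_suml -/s -(mulr_natr ((s / c) ^+ 2)) -/c.
rewrite -[X in _ - X]mulr_natr => h.
have := mulr_ge0 (ltW c0) h.
set Q := \sum_(i in A) _ in h *.
have -> : c * (Q - s * (s / c) * 2 + (s / c) ^+ 2 * c) = c * Q - s ^+ 2.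
  by field; rewrite gt_eqF.
by rewrite subr_ge0.
Qed.

(** The count is binom(n + k - 1, k): each of the k factors of its numerator is at most 2 n as k <=
    n, and k! >= (k / e)^k. *)
Lemma card_sorted_le (R : realType) k n : (0 < k <= n)%N ->
  #|[set t : k.-tuple 'I_n | sorted leq (map val t)]%SET|%:R * k%:R ^+ k <=
  (2 * expR 1 * n%:R) ^+ k :> R.
Proof.
move=> /andP[k0]; case: n => [|n kn]; first by rewrite leqNgt k0.
rewrite card_sorted_tuples.
apply: le_trans (ler_wpM2l _ (fact_ge R k)) _; first by rewrite ler0n.
rewrite mulrA -natrM bin_ffact mulrAC exprMn ler_wpM2r ?exprn_ge0 ?expR_ge0//.
rewrite -natrM -natrX ler_nat ffact_prod.
apply: (@leq_trans (\prod_(i < k) (2 * n.+1))%N); last by rewrite prod_nat_const card_ord.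
apply: leq_prod => i _; apply: leq_trans (leq_subr _ _) _.
by rewrite mul2n -addnn leq_add// leqW.
Qed.

Section Isotropic.
Context (d : measure_display) (T : measurableType d) (R : realType).
Variables (P : probability T R) (n : nat) (X : T -> 'rV[R]_n).
Hypotheses (hX : random_vector X) (hL : log_concave P X).
Implicit Types (th x y z : 'rV[R]_n) (t b p q eps : R).

Local Notation N := (Lp_norm P X 2).
Local Notation Np p := (Lp_norm P X p).
Local Notation B := (cov_form P X).
Local Notation e i := (delta_mx ord0 i).

Hypothesis hE : forall i j, B (e i) (e j) = (i == j)%:R.

Lemma cov_form_dotr x y : B x y = dotr x y.
Proof.
rewrite (cov_formE hX hL); apply: eq_bigr => i _; rewrite mxE; congr (_ * _).
rewrite (cov_formC P X) (cov_formE hX hL) /dotr (bigD1 i)//= mxE hE eqxx mulr1 big1 ?addr0//.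
by move=> j ji; rewrite mxE hE (negbTE ji) mulr0.
Qed.

Lemma sqr_norm2_sum x : N x ^+ 2 = \sum_i x ord0 i ^+ 2.
Proof. by rewrite (sqr_norm2 P X) cov_form_dotr; apply: eq_bigr => i _; rewrite expr2. Qed.

Lemma norm2_delta i : N (e i) = 1.
Proof.
apply/eqP; rewrite -(eqrXn2 (n := 2)) ?Lp_norm_ge0//.
by rewrite (sqr_norm2 P X) hE eqxx expr1n.
Qed.

Lemma coord_le_norm2 x i : `|x ord0 i| <= N x.
Proof.
rewrite -(ler_pXn2r (n := 2)) ?nnegrE ?Lp_norm_ge0// (real_normK (num_real _)) sqr_norm2_sum.
by rewrite (bigD1 i)//= lerDl sumr_ge0// => j _; exact: sqr_ge0.
Qed.

Lemma Ex_sqr_norm2 : intg P (fun w => N (X w) ^+ 2) /\ Ex P (fun w => N (X w) ^+ 2) = n%:R.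
Proof.
have E2 : (fun w => N (X w) ^+ 2) = (fun w => \sum_i dotr (X w) (e i) ^+ 2).
  by apply/funext => w; rewrite sqr_norm2_sum; apply: eq_bigr => i _; rewrite dotr_delta.
rewrite E2; split; first by apply: intg_sum => i; exact: intg_dotr2.
rewrite Ex_sum => [|i]; last exact: intg_dotr2.
rewrite (eq_bigr (fun=> 1)) ?sumr_const ?card_ord// => i _.
have := hE i i; rewrite eqxx cov_form.unlock /= mulr1n => <-.
by congr Ex; apply/funext => w; rewrite expr2.
Qed.

Definition moment4_const : R := (2 * expR 10) ^+ 4.

Lemma moment4_const_gt0 : 0 < moment4_const. Proof. by rewrite exprn_gt0// mulr_gt0 ?expR_gt0. Qed.

Lemma Ex_norm2_4 : intg P (fun w => N (X w) ^+ 4) /\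
  Ex P (fun w => N (X w) ^+ 4) <= moment4_const * n%:R ^+ 2.
Proof.
have i4 i : intg P (fun w => dotr (X w) (e i) ^+ 4) by have [] := fourth_moment hX hL (e i).
pose G w := n%:R * \sum_i dotr (X w) (e i) ^+ 4.
have iG : intg P G by apply: intgZ; exact: intg_sum.
have hG w : N (X w) ^+ 4 <= G w.
  rewrite -[4%N]/(2 * 2)%N exprM sqr_norm2_sum.
  have := @sqr_sum_le R _ [set: 'I_n] (fun i => X w ord0 i ^+ 2).
  rewrite cardsT card_ord; under eq_bigl do rewrite inE; under [X in _ * X]eq_bigl do rewrite inE.
  move=> /le_trans; apply; rewrite /G le_eqVlt; apply/orP; left; apply/eqP; congr (_ * _).
  by apply: eq_bigr => i _; rewrite dotr_delta -exprM.
have i4' : intg P (fun w => N (X w) ^+ 4).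
  apply: intg_le iG _; last by move=> w; rewrite ger0_norm ?exprn_ge0 ?Lp_norm_ge0.
  apply: measurable_funX; exact: measurable_norm2.
split => //; apply: le_trans (Ex_le i4' iG hG) _.
rewrite ExZ; last exact: intg_sum.
rewrite Ex_sum// expr2 mulrCA ler_wpM2l//.
apply: (@le_trans _ _ (\sum_(i < n) moment4_const)).
  apply: ler_sum => i _; have [_] := fourth_moment hX hL (e i).
  by rewrite norm2_delta expr1n mulr1.
by rewrite sumr_const card_ord mulr_natr.
Qed.

(** Paley-Zygmund. With a = N(X)^2 and K = [moment4_const], a <= n/2 + a^2 / (4 K n) + K n on D by
    completing a square; in the mean the middle term is at most n / 4. *)
Lemma norm2_large : (0 < n)%N -> (4 * moment4_const)^-1 <= pr P [set w | n%:R / 2 <= N (X w) ^+ 2].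
Proof.
move=> n0; have n0' : 0 < n%:R :> R by rewrite ltr0n.
have [i2 E2] := Ex_sqr_norm2; have [i4 E4] := Ex_norm2_4; have K0 := moment4_const_gt0.
set D := [set w | _].
have mD : measurable D by apply: measurable_ge; exact: intg_meas i2.
have iD := intg_indic P mD.
pose G w := n%:R / 2 + ((4 * moment4_const * n%:R)^-1 * N (X w) ^+ 4 + (moment4_const * n%:R) * \1_D w).
have iG2 : intg P (fun w => (moment4_const * n%:R) * \1_D w) by exact: intgZ.
have iG1 : intg P (fun w => (4 * moment4_const * n%:R)^-1 * N (X w) ^+ 4) by exact: intgZ.
have : Ex P (fun w => N (X w) ^+ 2) <= Ex P G.
  apply: Ex_le => //; first by apply: intgD; [exact: intg_cst|exact: intgD].
  move=> w; rewrite /G indicE; case: (boolP (w \in D)) => [|]; rewrite ?(inE, notin_setE) /D /=.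
    move=> _; rewrite mulr1.
    have -> : N (X w) ^+ 4 = (N (X w) ^+ 2) ^+ 2 by rewrite -exprM.
    set a := N (X w) ^+ 2.
    have : 0 <= (4 * moment4_const * n%:R)^-1 * (a - 2 * moment4_const * n%:R) ^+ 2.
      by rewrite mulr_ge0 ?sqr_ge0// invr_ge0 !mulr_ge0// ltW.
    have -> : (4 * moment4_const * n%:R)^-1 * (a - 2 * moment4_const * n%:R) ^+ 2 =
      (4 * moment4_const * n%:R)^-1 * a ^+ 2 + moment4_const * n%:R - a by field; rewrite !gt_eqF.
    lra.
  move=> /negP; rewrite -ltNge => /ltW h; rewrite mulr0 addr0; apply: ler_wpDr => //.
  by rewrite mulr_ge0 ?exprn_ge0 ?Lp_norm_ge0// invr_ge0 !mulr_ge0// ltW.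
have iG3 := intgD iG1 iG2.
rewrite E2 (ExD (intg_cst P _) iG3) (ExD iG1 iG2) (ExZ _ i4) (ExZ _ iD) Ex_cst (Ex_indic P mD).
have h : (4 * moment4_const * n%:R)^-1 * Ex P (fun w => N (X w) ^+ 4) <= n%:R / 4.
  have -> : n%:R / 4 = (4 * moment4_const * n%:R)^-1 * (moment4_const * n%:R ^+ 2) by field; rewrite !gt_eqF.
  by rewrite ler_wpM2l// invr_ge0 !mulr_ge0// ltW.
move=> h2; have h3 : n%:R * 4^-1 <= n%:R * (moment4_const * pr P D) by lra.
rewrite ler_pM2l// in h3.
by rewrite invfM ler_pdivrMr// mulrC.
Qed.


(** The coordinates of the k-th tensor power of x, whose inner products are the k-th powers of
    [dotr]. *)
Let monom k (x : 'rV[R]_n) (f : {ffun 'I_k -> 'I_n}) : R := \prod_i x ord0 (f i).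

Lemma dotr_exp k x y : dotr x y ^+ k = \sum_f monom x f * monom y (f : {ffun 'I_k -> 'I_n}).
Proof.
have -> : dotr x y ^+ k = \prod_(i < k) dotr x y by rewrite prodr_const card_ord.
rewrite /dotr (bigA_distr_bigA (fun (i : 'I_k) (j : 'I_n) => x ord0 j * y ord0 j)).
by apply: eq_bigr => f _; rewrite -big_split.
Qed.

(** Sorting the indices names the orbit of f under permutations, on which [monom] is constant. *)
Let cl k (f : {ffun 'I_k -> 'I_n}) : k.-tuple 'I_n :=
  [tuple of sort (relpre val leq) [tuple of map f (ord_tuple k)]].

Lemma monom_class k x (f : {ffun 'I_k -> 'I_n}) : monom x f = \prod_(j <- cl f) x ord0 j.
Proof.
rewrite /cl /= (perm_big _ (permEl (perm_sort _ _))) /= big_map big_enum /=.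
by [].
Qed.

Lemma intg_dotr_even th k : intg P (fun w => dotr (X w) th ^+ (2 * k)).
Proof.
have [->|k0] := posnP k; first exact: intg_cst.
have := @intg_powR _ _ _ _ _ _ hX hL th (2 * k)%:R; rewrite ler1n muln_gt0 => /(_ k0).
congr intg; apply/funext => w; rewrite powR_mulrn// !exprM real_normK//; exact: num_real.
Qed.

(* Welch's bound: the Gram matrix of the monomials of degree [k] has rank at most the number of
   sorted [k]-tuples, which bounds its trace by its Hilbert-Schmidt norm. *)
Lemma welch k (D : set T) b M : (0 < k <= n)%N -> measurable D -> 0 <= M ->
  (forall w, D w -> N (X w) <= b) ->
  (forall w, D w -> Ex P (fun w' => dotr (X w') (X w) ^+ (2 * k)) <= M) ->
  Ex P (fun w => \1_D w * N (X w) ^+ (2 * k)) ^+ 2 * k%:R ^+ k <= (2 * expR 1 * n%:R) ^+ k * M.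
Proof.
move=> kn mD M0 hb hM.
pose u (f : {ffun 'I_k -> 'I_n}) w := \1_D w * monom (X w) f.
have mu f : measurable_fun [set: T] (u f).
  apply: measurable_funM; first exact: measurable_indic.
  by apply: measurable_prod => i _; exact: hX.
have ub f w : `|u f w| <= `|b| ^+ k.
  rewrite /u normrM indicE; case: (boolP (w \in D)) => [|_]; last by rewrite normr0 mul0r exprn_ge0.
  rewrite inE => Dw; rewrite normr1 mul1r normr_prod.
  have -> : `|b| ^+ k = \prod_(i < k) `|b| by rewrite prodr_const card_ord.
  apply: ler_prod => i _; rewrite normr_ge0/=; apply: le_trans (coord_le_norm2 _ _) _.
  exact: le_trans (hb _ Dw) (ler_norm _).
have iuu f g : intg P (fun w => u f w * u g w).
  apply: (@intg_bounded _ _ _ _ _ (`|b| ^+ k * `|b| ^+ k)); first exact: measurable_funM.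
  by move=> w; rewrite normrM ler_pM.
pose G f g := Ex P (fun w => u f w * u g w).
have hGw w : \sum_f \sum_g G f g * (u f w * u g w) <= M.
  have [Dw|Dw] := pselect (D w); last first.
    rewrite big1// => f _; rewrite big1// => g _.
    by rewrite /u indicE memNset// mul0r mul0r mulr0.
  apply: le_trans (hM w Dw).
  pose H w' := \sum_f \sum_g (u f w * u g w) * (u f w' * u g w').
  have iH : intg P H by apply: intg_sum => f; apply: intg_sum => g; exact: intgZ.
  have -> : \sum_f \sum_g G f g * (u f w * u g w) = Ex P H.
    rewrite Ex_sum => [|f]; last by apply: intg_sum => g; exact: intgZ.
    apply: eq_bigr => f _; rewrite Ex_sum => [|g]; last exact: intgZ.
    by apply: eq_bigr => g _; rewrite ExZ// mulrC.
  apply: Ex_le => //; first exact: intg_dotr_even.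
  move=> w'; have [Dw'|Dw'] := pselect (D w'); last first.
    apply: (@le_trans _ _ 0); last by rewrite exprM exprn_ge0// sqr_ge0.
    rewrite le_eqVlt; apply/orP; left; apply/eqP; rewrite /H big1// => f _; rewrite big1// => g _.
    by rewrite {3}/u indicE memNset// mul0r mul0r mulr0.
  rewrite mulnC exprM dotr_exp expr2 big_distrlr /=.
  rewrite le_eqVlt; apply/orP; left; apply/eqP; apply: eq_bigr => f _; apply: eq_bigr => g _.
  by rewrite /u !indicE (mem_set Dw) (mem_set Dw') /= !mulr1n; ring.
have hG : \sum_f \sum_g G f g ^+ 2 <= M.
  rewrite -(Ex_cst P M).
  apply: (@le_trans _ _ (Ex P (fun w => \sum_f \sum_g G f g * (u f w * u g w)))).
    rewrite Ex_sum => [|f]; last by apply: intg_sum => g; exact: intgZ.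
    apply: ler_sum => f _; rewrite Ex_sum => [|g]; last exact: intgZ.
    by apply: ler_sum => g _; rewrite ExZ.
  apply: Ex_le => //; last exact: intg_cst.
  by apply: intg_sum => f; apply: intg_sum => g; exact: intgZ.
have clG f g h : cl f = cl g -> G f h = G g h.
  by move=> fg; congr Ex; apply/funext => w; rewrite /u !monom_class fg.
have GC f g : G f g = G g f by congr Ex; apply/funext => w; rewrite mulrC.
pose S := [set t : k.-tuple 'I_n | sorted leq (map val t)]%SET.
have clS f : cl f \in S.
  by rewrite inE sorted_map sort_sorted// => i j; exact: leq_total.
have EA : Ex P (fun w => \1_D w * N (X w) ^+ (2 * k)) = \sum_f G f f.
  rewrite -Ex_sum//; congr Ex; apply/funext => w.
  rewrite exprM (sqr_norm2 P X) cov_form_dotr dotr_exp mulr_sumr; apply: eq_bigr => f _.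
  by rewrite /u indicE; case: (_ \in _); rewrite ?mul1r ?mul0r.
(* In place of a spectral argument: the trace is split over the classes, and Cauchy-Schwarz costs
   their number. On a class G is constant, so the square of its partial trace is the sum of the
   squares of its block. *)
have h1 : Ex P (fun w => \1_D w * N (X w) ^+ (2 * k)) ^+ 2 <= #|S|%:R * M.
  rewrite EA (partition_big (@cl k) (mem S))//=.
  apply: le_trans (sqr_sum_le _ _) _; rewrite ler_wpM2l//.
  apply: le_trans hG.
  rewrite [leRHS](partition_big (@cl k) (mem S))//=.
  apply: ler_sum => c _; rewrite expr2 mulr_suml; apply: ler_sum => f /eqP fc.
  rewrite mulr_sumr [leRHS](bigID (fun g => cl g == c)) /= ler_wpDr//.
    by apply: sumr_ge0 => g _; exact: sqr_ge0.
  apply: ler_sum => g /eqP gc.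
  have fg : cl f = cl g by rewrite fc gc.
  by rewrite expr2 (clG f g f fg) (GC g f) -(clG f g g fg).
apply: le_trans (ler_wpM2r _ h1) _; first by rewrite exprn_ge0.
by rewrite mulrAC ler_wpM2r// card_sorted_le.
Qed.

Lemma mean_norm2_le : Ex P (fun w => N (X w)) ^+ 2 <= n%:R.
Proof.
have [i2 <-] := Ex_sqr_norm2; have i1 := intg_norm2 hX hL.
set m := Ex P _.
have i3 : intg P (fun w => (- (2 * m)) * N (X w) + m ^+ 2) by apply: intgD; [exact: intgZ|exact: intg_cst].
have : 0 <= Ex P (fun w => N (X w) ^+ 2 + ((- (2 * m)) * N (X w) + m ^+ 2)).
  apply: Ex_ge0 => w; rewrite (_ : _ + _ = (N (X w) - m) ^+ 2) ?sqr_ge0//; ring.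
rewrite (ExD i2 i3) (ExD (intgZ _ i1) (intg_cst P _)) (ExZ _ i1) Ex_cst -/m; nra.
Qed.

Definition isotropic_const : R := ((8 * moment4_const)^-1 ^+ 2) / (32 * expR 1 * (8 * moment4_const) ^+ 2).

Lemma isotropic_const_gt0 : 0 < isotropic_const.
Proof.
have K0 := moment4_const_gt0.
by rewrite divr_gt0 ?mulr_gt0 ?exprn_gt0 ?invr_gt0 ?mulr_gt0 ?expR_gt0.
Qed.

Lemma mean_support_ge r : 0 < Ex P (fun w => N (X w)) -> 2 <= r -> r <= n%:R ->
  isotropic_const * (r * n%:R) <= Ex P (fun w => Np r (X w)) ^+ 2.
Proof.
move=> I2 r2 rn; have r1 : 1 < r by lra.
have K0 := moment4_const_gt0; set I := Ex P _.
have K8 : 0 < 8 * moment4_const by rewrite mulr_gt0.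
have ir := intg_Lp_norm hX hL r1.
have n0 : (0 < n)%N by rewrite -(ltr_nat R); lra.
have n0' : 0 < n%:R :> R by rewrite ltr0n.
have I0 : 0 < I.
  apply: lt_le_trans I2 _; apply: Ex_le; [exact: intg_norm2|exact: ir|] => w.
  by apply: (Lp_norm_mono hX hL); rewrite ?ler1n.
(* Thus 2 k <= r <= 4 k, and k >= 1 because r >= 2. *)
pose k := Num.truncn (r / 2).
have /truncn_itv/andP[k1 k2] : 0 <= r / 2 by lra.
rewrite -/k in k1 k2.
have k0 : (0 < k)%N by rewrite lt0n; apply/eqP => k0; rewrite k0 in k2; lra.
have k1' : 1 <= k%:R :> R by rewrite ler1n.
have kr : r <= 4 * k%:R by move: k2; rewrite -(natr1 k); lra.
have kn : (0 < k <= n)%N by rewrite k0 -(ler_nat R); lra.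
have [i2 E2] := Ex_sqr_norm2.
pose D1 := [set w | n%:R / 2 <= N (X w) ^+ 2].
have mD1 : measurable D1 by apply: measurable_ge; exact: intg_meas i2.
have hD1 : (4 * moment4_const)^-1 <= pr P D1 by exact: norm2_large.
(* By Markov, N_r(X) >= t removes at most half of the mass 1 / (4 [moment4_const]) given by
   [norm2_large]. *)
pose t := 8 * moment4_const * I; have t0 : 0 < t by rewrite mulr_gt0.
pose D2 := [set w | t <= Np r (X w)].
have mD2 : measurable D2 by apply: measurable_ge; exact: intg_meas ir.
have hD2 : pr P D2 <= (8 * moment4_const)^-1.
  apply: le_trans (pr_markov ir (fun w => Lp_norm_ge0 P X r (X w)) t0) _.
  by rewrite /t -/I invfM mulrCA mulfV ?mulr1// gt_eqF.
pose D := D1 `&` ~` D2; have mD : measurable D by apply: measurableI => //; exact: measurableC.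
set kp := (8 * moment4_const)^-1 in hD2.
have kp0 : 0 < kp by rewrite invr_gt0.
have hD : kp <= pr P D.
  have := prI_ge P mD1 (measurableC mD2); rewrite -/D prC//.
  have e : (4 * moment4_const)^-1 = 2 * kp by rewrite /kp; field; rewrite gt_eqF.
  rewrite e in hD1; lra.
have hDt w : D w -> Np r (X w) <= t by move=> [_ /negP]; rewrite -ltNge => /ltW.
have hDN w : D w -> N (X w) <= t.
  by move=> /hDt; apply: le_trans; apply: (Lp_norm_mono hX hL); rewrite ?ler1n.
have M0 : 0 <= t ^+ (2 * k) by rewrite exprn_ge0// ltW.
have := welch kn mD M0 hDN.
have hM w : D w -> Ex P (fun w' => dotr (X w') (X w) ^+ (2 * k)) <= t ^+ (2 * k).
  move=> Dw; have k2r : 1 <= (2 * k)%:R :> R by rewrite ler1n muln_gt0.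
  have -> : Ex P (fun w' => dotr (X w') (X w) ^+ (2 * k)) = Np (2 * k)%:R (X w) ^+ (2 * k).
    rewrite -powR_mulrn ?Lp_norm_ge0// Lp_norm_powR//.
    congr Ex; apply/funext => w'; rewrite powR_mulrn// !exprM real_normK//; exact: num_real.
  rewrite ler_pXn2r ?nnegrE ?Lp_norm_ge0 ?(ltW t0) ?muln_gt0//.
  apply: le_trans (hDt _ Dw); apply: (Lp_norm_mono hX hL) => //.
  by rewrite natrM; lra.
move=> /(_ hM).
have hA : (n%:R / 2) ^+ k * kp <= Ex P (fun w => \1_D w * N (X w) ^+ (2 * k)).
  apply: (@le_trans _ _ (Ex P (fun w => (n%:R / 2) ^+ k * \1_D w))).
    rewrite ExZ ?Ex_indic//; last exact: intg_indic.
    by rewrite ler_wpM2l// exprn_ge0// divr_ge0.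
  apply: Ex_le => [||w]; first by apply: intgZ; exact: intg_indic.
    apply: (@intg_bounded _ _ _ _ _ (t ^+ (2 * k))).
      apply: measurable_funM; first exact: measurable_indic.
      by apply: measurable_funX; exact: measurable_norm2.
    move=> w; rewrite ger0_norm ?mulr_ge0 ?exprn_ge0 ?Lp_norm_ge0// indicE.
    case: (boolP (w \in D)) => [|_]; last by rewrite mul0r.
    rewrite inE => Dw; rewrite mul1r ler_pXn2r ?nnegrE ?Lp_norm_ge0 ?(ltW t0) ?muln_gt0//.
    exact: hDN.
  rewrite mulrC indicE; case: (boolP (w \in D)) => [|_]; last by rewrite !mul0r.
  rewrite inE => -[D1w _]; rewrite !mul1r exprM.
  by rewrite ler_pXn2r ?nnegrE ?exprn_ge0 ?Lp_norm_ge0 ?divr_ge0.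
move=> hw.
(* Hence (kp^2)^k <= kp^2, and after the k-th root the mass still enters only as kp^2. *)
have kp1 : kp ^+ 2 <= 1.
  by rewrite exprn_ile1 ?(ltW kp0)// (le_trans hD)// pr_le1.
have h1 : (kp ^+ 2 * (n%:R / 2) ^+ 2 * k%:R) ^+ k <= (2 * expR 1 * n%:R * t ^+ 2) ^+ k.
  rewrite [leRHS]exprMn -[in leRHS]exprM; apply: le_trans hw.
  rewrite [leLHS]exprMn ler_wpM2r ?exprn_ge0//.
  apply: (@le_trans _ _ (((n%:R / 2) ^+ k * kp) ^+ 2)); last first.
    rewrite ler_pXn2r ?nnegrE ?mulr_ge0 ?exprn_ge0 ?divr_ge0 ?(ltW kp0)//.
    by apply: Ex_ge0 => w; rewrite mulr_ge0 ?exprn_ge0 ?Lp_norm_ge0// indicE.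
  rewrite [leRHS]exprMn [leLHS]exprMn mulrC exprAC ler_wpM2l ?exprn_ge0 ?divr_ge0//.
  by rewrite -[leRHS]expr1 ler_wiXn2l ?exprn_ge0 ?(ltW kp0).
have h2 : kp ^+ 2 * (n%:R / 2) ^+ 2 * k%:R <= 2 * expR 1 * n%:R * t ^+ 2.
  have q1 : 0 <= kp ^+ 2 * (n%:R / 2) ^+ 2 * k%:R.
    by apply: mulr_ge0 => //; apply: mulr_ge0; exact: sqr_ge0.
  have q2 : 0 <= 2 * expR 1 * n%:R * t ^+ 2.
    by apply: mulr_ge0; [rewrite mulr_ge0// mulr_ge0// expR_ge0|exact: sqr_ge0].
  by move: h1; rewrite ler_pXn2r.
have h3 : n%:R * (kp ^+ 2 * n%:R * r) <= n%:R * (32 * expR 1 * t ^+ 2).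
  have : kp ^+ 2 * n%:R ^+ 2 * r <= kp ^+ 2 * n%:R ^+ 2 * (4 * k%:R).
    by rewrite ler_wpM2l// mulr_ge0 ?exprn_ge0 ?(ltW kp0).
  lra.
rewrite ler_pM2l// in h3.
rewrite /isotropic_const -/kp mulrAC ler_pdivrMr; last by rewrite !mulr_gt0 ?exprn_gt0 ?expR_gt0.
move: h3; rewrite /t; lra.
Qed.

End Isotropic.

(** * The packing bound *)

Section Main.
Context (d : measure_display) (T : measurableType d) (R : realType).
Variables (P : probability T R) (n : nat) (X : T -> 'rV[R]_n).
Hypotheses (hX : random_vector X) (hL : log_concave P X) (hC : centered P X)
  (hD : nondegenerate_law P X).
Implicit Types (p r u C : R).

Local Notation I := (mean_support P X).
Local Notation Z := (Lp_centroid P X).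

Lemma mean_support_ge0 r : 2 <= r -> 0 <= I r.
Proof.
move=> r2; rewrite (mean_supportE hX hL); last by lra.
by apply: Ex_ge0 => w; exact: Lp_norm_ge0.
Qed.

Lemma mean_support_mono r : 2 <= r -> I 2 <= I r.
Proof.
move=> r2; have r1 : 1 < r by lra.
rewrite !(mean_supportE hX hL) ?ltr1n//.
apply: Ex_le; [exact: intg_norm2|exact: intg_Lp_norm|] => w.
by apply: (Lp_norm_mono hX hL); rewrite ?ler1n.
Qed.

Lemma packing_main C r p u : 2 <= r -> 1 <= p -> 0 < u -> sep_const R * (4 * expR 3) <= C ->
  (packing (Z p) (dilate (C * u * I r) (polar (Z r))) <=
  (expR (log_const R * p * ((r * I 2 / (u * I r)) ^+ 2 + r * I 2 / (u * I r))))%:E)%E.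
Proof.
move=> r2 p1 u0 hCs; have r1 : 1 < r by lra.
have r0 : 0 < r by lra.
apply: packing_le => s us sZ sep.
set b := log_const R * p * _.
have b0 : 0 <= b.
  have a0 : 0 <= r * I 2 / (u * I r).
    apply: divr_ge0; apply: mulr_ge0; rewrite ?mean_support_ge0//; exact: ltW.
  apply: mulr_ge0; last by apply: addr_ge0 => //; exact: exprn_ge0.
  by apply: mulr_ge0; [exact: log_const_ge0|lra].
have sln : ln (size s)%:R <= b -> (size s)%:R <= expR b.
  have [->|s0] := posnP (size s); first by rewrite expR_ge0.
  by move=> h; rewrite -[leLHS]lnK ?posrE ?ltr0n// ler_expR.
have [s1|s2] := leqP (size s) 1.
  by apply: (@le_trans _ _ 1); [rewrite -[1]/(1%:R) ler_nat|have := expR_ge1Dx b; lra].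
(* Two distinct points rule out dimension 0, where I_2 would vanish. *)
have n0 : (0 < n)%N.
  rewrite lt0n; apply/negP => /eqP n0.
  have := size_le1 us; rewrite leqNgt s2 => h; suff : false by [].
  by apply: h => x y _ _; apply/rowP => i; have := ltn_ord i; rewrite {2}n0.
have I2 := mean_norm2_gt0 hX hL hC hD n0.
have I2E : I 2 = Ex P (fun w => Lp_norm P X 2 (X w)) by rewrite (mean_supportE hX hL) ?ltr1n.
have Ir : 0 < I r by apply: lt_le_trans (mean_support_mono r2); rewrite I2E.
have e0 : 0 < 4 * expR 3 :> R by rewrite mulr_gt0 ?expR_gt0.
have Cs0 := sep_const_gt0 R.
have C0 : 0 < C by apply: lt_le_trans hCs; exact: mulr_gt0.
(* Since N_r <= 4 e^3 r N, a difference with N_r > C u I_r has N > [sep_const] t I_2 for this t. *)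
pose t := u * I r / (r * I 2).
have t0 : 0 < t by rewrite divr_gt0// mulr_gt0// I2E.
have tE : t^-1 = r * I 2 / (u * I r) by rewrite /t invfM invrK mulrC.
apply: sln; rewrite /b -tE.
apply: (separated_count hX hL hC I2 (norm2_gt0 hX hL hC hD) p1 t0 us).
  by move=> z /sZ; exact: Lp_centroid_sub.
move=> x y xs ys xy; have := sep x y xs ys xy.
have cp : 0 < C * u * I r by rewrite !mulr_gt0.
move=> /(dilate_polar hX hL r1 cp) h.
have h2 := lt_le_trans h (Lp_norm_le_norm2 hX hL (x - y) (ltW r1)).
rewrite -I2E -(ltr_pM2l (mulr_gt0 e0 r0)); apply: le_lt_trans h2.
have -> : 4 * expR 3 * r * (sep_const R * t * I 2) = sep_const R * (4 * expR 3) * (u * I r).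
  by rewrite /t; field; rewrite !gt_eqF// I2E.
by rewrite -(mulrA C) ler_pM2r// mulr_gt0.
Qed.

Lemma ratio_le r u : 2 <= r -> 0 < u -> r * I 2 / (u * I r) <= r / u.
Proof.
move=> r2 u0; have h := mean_support_mono r2; have h0 := mean_support_ge0 r2.
(* If I_r = 0, the quotient is 0 because the inverse of 0 is 0. *)
have := h0; rewrite le_eqVlt => /orP [/eqP <-|I0].
  by rewrite mulr0 invr0 mulr0 divr_ge0//; lra.
rewrite invfM mulrACA ler_piMr ?divr_ge0//; [by lra|exact: ltW|].
by rewrite ler_pdivrMr// mul1r.
Qed.

Lemma ratio_ge0 r u : 2 <= r -> 0 < u -> 0 <= r * I 2 / (u * I r).
Proof.
move=> r2 u0; have r0 : 0 <= r by lra.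
by apply: divr_ge0; apply: mulr_ge0; rewrite ?mean_support_ge0//; exact: ltW.
Qed.

Lemma ratio_isotropic r u : isotropic P X -> 2 <= r -> r <= n%:R -> 0 < u ->
  (r * I 2 / (u * I r)) ^+ 2 <= (isotropic_const R)^-1 * (r / u ^+ 2).
Proof.
move=> [_ hiso] r2 rn u0.
have r1 : 1 < r by lra.
have hE i j : cov_form P X (delta_mx ord0 i) (delta_mx ord0 j) = (i == j)%:R.
  by rewrite -(cov_mxE hC) hiso mxE.
have n0 : (0 < n)%N by rewrite -(ltr_nat R); lra.
have I2 := mean_norm2_gt0 hX hL hC hD n0.
have I2E : I 2 = Ex P (fun w => Lp_norm P X 2 (X w)) by rewrite (mean_supportE hX hL) ?ltr1n.
have Ir : 0 < I r by apply: lt_le_trans (mean_support_mono r2); rewrite I2E.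
have h1 := mean_support_ge hX hL hE I2 r2 rn; rewrite -(mean_supportE hX hL r1) in h1.
have h2 := mean_norm2_le hX hL hE; rewrite -I2E in h2.
have c0 := isotropic_const_gt0 R.
have -> : (r * I 2 / (u * I r)) ^+ 2 = (r / u ^+ 2) * (r * I 2 ^+ 2 / I r ^+ 2).
  by field; rewrite !gt_eqF.
rewrite mulrC ler_wpM2r//; first by rewrite divr_ge0 ?exprn_ge0 ?(ltW u0)//; lra.
rewrite ler_pdivrMr ?exprn_gt0// ler_pdivlMl//; apply: le_trans h1.
by rewrite ler_pM2l// ler_pM2l//; lra.
Qed.

End Main.

Theorem theorem1p4 (R : realType) :
  exists2 C : R, 1 <= C &
  forall (d : measure_display) (T : measurableType d) (P : probability T R)
    (n : nat) (X : T -> 'rV[R]_n),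
    random_vector X -> log_concave P X -> centered P X -> nondegenerate_law P X ->
    let Z := Lp_centroid P X in
    let I := mean_support P X in
    (forall r p u : R, 2 <= r -> 1 <= p -> 1 <= u ->
      [/\ (lne (packing (Z p) (dilate (C * u * I r) (polar (Z r))))
            <= (C * p * ((r * I 2 / (u * I r)) ^+ 2
                         + r * I 2 / (u * I r)))%:E)%E,
          (lne (packing (Z p) (dilate (C * u * I r) (polar (Z r))))
            <= (C * p * ((r / u) ^+ 2 + r / u))%:E)%E
        & isotropic P X -> r <= n%:R ->
          (lne (packing (Z p) (dilate (C * u * I r) (polar (Z r))))
            <= (C * p * (r / u ^+ 2 + Num.sqrt r / u))%:E)%E]) /\
    (isotropic P X -> forall r p : R, 2 <= r -> r <= n%:R -> 1 <= p ->
      (packing (Z p) (dilate (C * Num.sqrt r * I r) (polar (Z r)))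
        <= (expR (C * p))%:E)%E).
Proof.
have L0 := log_const_ge0 R; have c0 := isotropic_const_gt0 R.
have S0 : 0 <= sep_const R * (4 * expR 3).
  by apply: mulr_ge0; [exact: ltW (sep_const_gt0 R)|rewrite mulr_ge0 ?expR_ge0].
have ci0 : 0 <= (isotropic_const R)^-1 by rewrite invr_ge0 ltW.
pose L1 := log_const R * (1 + (isotropic_const R)^-1).
have L10 : 0 <= L1 by rewrite mulr_ge0// addr_ge0.
have LL1 : log_const R <= L1 by rewrite ler_peMr// lerDl.
(* The second term meets the threshold of [packing_main]. The factor 2 on L1 is the value of r / u^2
   + sqrt r / u at u = sqrt r. *)
pose C := 1 + sep_const R * (4 * expR 3) + 2 * L1.
have CS : sep_const R * (4 * expR 3) <= C by rewrite /C; lra.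
have CL : 2 * L1 <= C by rewrite /C; lra.
exists C; first by rewrite /C; lra.
move=> d T P n X hX hL hC hD Z I.
have main r p u : 2 <= r -> 1 <= p -> 0 < u ->
    (packing (Z p) (dilate (C * u * I r) (polar (Z r))) <=
    (expR (log_const R * p * ((r * I 2 / (u * I r)) ^+ 2 + r * I 2 / (u * I r))))%:E)%E.
  by move=> r2 p1 u0; exact: packing_main.
have iso r p u : isotropic P X -> 2 <= r -> r <= n%:R -> 1 <= p -> 0 < u ->
    (packing (Z p) (dilate (C * u * I r) (polar (Z r))) <=
    (expR (L1 * p * (r / u ^+ 2 + Num.sqrt r / u)))%:E)%E.
  move=> hiso r2 rn p1 u0; apply: le_trans (main _ _ _ r2 p1 u0) _.
  have p0 : 0 <= p by lra.
  rewrite lee_fin ler_expR (_ : L1 * p = log_const R * p * (1 + (isotropic_const R)^-1)); last by rewrite /L1; ring.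
  rewrite -(mulrA (log_const R * p)) ler_wpM2l//; first exact: mulr_ge0.
  have h1 := ratio_isotropic hX hL hC hD hiso r2 rn u0.
  have a0 := ratio_ge0 hX hL r2 u0.
  rewrite -/I in h1 a0; move: h1 a0; move: (r * I 2 / (u * I r)) => a h1 a0.
  have q0 : 0 <= r / u ^+ 2 by rewrite divr_ge0 ?exprn_ge0 ?(ltW u0)//; lra.
  have s0 : 0 <= Num.sqrt r / u by rewrite divr_ge0 ?sqrtr_ge0 ?(ltW u0).
  (* With c the inverse of [isotropic_const], c <= (1 + c)^2; so 1 + c serves in place of the square
     root of c. *)
  have h2 : a <= (1 + (isotropic_const R)^-1) * (Num.sqrt r / u).
    have c10 : 0 <= 1 + (isotropic_const R)^-1 by rewrite addr_ge0.
    rewrite -(ler_pXn2r (n := 2)) ?nnegrE ?(mulr_ge0 c10 s0)//.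
    apply: le_trans h1 _.
    have -> : ((1 + (isotropic_const R)^-1) * (Num.sqrt r / u)) ^+ 2 = (1 + (isotropic_const R)^-1) ^+ 2 * (r / u ^+ 2).
      by rewrite exprMn expr_div_n sqr_sqrtr//; lra.
    rewrite ler_wpM2r//; nra.
  rewrite mulrDr; apply: lerD => //; apply: le_trans h1 _.
  by rewrite ler_wpM2r// lerDr.
split.
  move=> r p u r2 p1 u1; have u0 : 0 < u by lra.
  have p0 : 0 <= p by lra.
  have a0 := ratio_ge0 hX hL r2 u0; have ha := ratio_le hX hL r2 u0.
  rewrite -/I in a0 ha; set a := r * I 2 / (u * I r) in a0 ha *.
  have LC : log_const R <= C by lra.
  split.
  - apply: lne_le; apply: le_trans (main _ _ _ r2 p1 u0) _.
    rewrite lee_fin ler_expR -/a ler_wpM2r//; first by rewrite addr_ge0// exprn_ge0.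
    by rewrite ler_wpM2r.
  - apply: lne_le; apply: le_trans (main _ _ _ r2 p1 u0) _.
    have aq : a ^+ 2 + a <= (r / u) ^+ 2 + r / u.
      by rewrite lerD// ler_pXn2r ?nnegrE// (le_trans a0).
    rewrite lee_fin ler_expR -/a; apply: ler_pM => //; first exact: mulr_ge0.
      by rewrite addr_ge0// exprn_ge0.
    by rewrite ler_wpM2r.
  - move=> hiso rn; apply: lne_le; apply: le_trans (iso _ _ _ hiso r2 rn p1 u0) _.
    rewrite lee_fin ler_expR ler_wpM2r//; last by rewrite ler_wpM2r//; lra.
    by rewrite addr_ge0// divr_ge0 ?exprn_ge0 ?sqrtr_ge0 ?(ltW u0)//; lra.
move=> hiso r p r2 rn p1; have r0 : 0 < r by lra.
have sr : 0 < Num.sqrt r by rewrite sqrtr_gt0.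
apply: le_trans (iso r p _ hiso r2 rn p1 sr) _.
rewrite lee_fin ler_expR sqr_sqrtr ?(ltW r0)// !divff ?gt_eqF//.
have p0 : 0 <= p by lra.
have := ler_wpM2r p0 CL; lra.
Qed.
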